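(* Consider the impulse control model, the associated MDP, problem (P), the set $V$ and the linear program (LP2) described in the context, and suppose Conditions (I) and (II) of the context are satisfied. Let $f^\ast:\mathbf X_\Delta\to\mathbf B$ be a measurable mapping (deterministic stationary strategy) with properties (i) and (ii) of the context. Then the following assertions hold. (a) There exist an optimal solution $\mu^\ast$ to the linear program (LP2) and a stationary strategy $\widetilde\pi$ that is optimal for the impulse control problem (P) such that $$\mu^\ast(dx\times db)=\mu^\ast(dx\times\mathbf B)\,\widetilde\pi(db|x)\quad\text{on }\mathcal B(V\times\mathbf B),$$ and $\widetilde\pi(db|x)=\delta_{f^\ast(x)}(db)$ for $x\in V^c$. (b) The linear program (LP2) has the same optimal value as the impulse control problem (P). Moreover, if $\pi^\ast=\{\pi^\ast_i\}_{i=1}^\infty$ is a strategy such that the restriction $\mu^{\pi^\ast}|_{V\times\mathbf B}$ of its occupation measure to $V\times\mathbf B$ solves (i.e. is an optimal solution of) the linear program (LP2), and such that for each $i=0,1,2,\dots$ and each history $h_i$ whose last state satisfies $x_i\in V^c$, the measure $\pi^\ast_{i+1}(db|h_i)$ is concentrated on $\{b\in\mathbf B:\sum_{j=0}^J\bar C_j(x_i,b)=0\}$, then $\pi^\ast$ is an optimal strategy for the impulse control problem (P).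
   Context: **Impulse control model.** A Borel space is a topological space homeomorphic to a Borel subset of a Polish space. $\mathbf X$ (states) and $\mathbf A$ (impulses) are Borel spaces with their Borel $\sigma$-algebras; $J$ is a fixed natural number. $\phi:\mathbf X\times[0,\infty)\to\mathbf X$ is a measurable flow: $\phi(x,0)=x$ and $\phi(x,t+s)=\phi(\phi(x,s),t)$ for all $x\in\mathbf X$, $s,t\ge0$. $l:\mathbf X\times\mathbf A\to\mathbf X$ is measurable (the state after an impulse). For $j=0,\dots,J$, $C_j^g:\mathbf X\to[0,\infty)$ and $C_j^I:\mathbf X\times\mathbf A\to[0,\infty)$ are measurable. Fixed: an initial state $x_0\in\mathbf X$ and constants $d_1,\dots,d_J\in[0,\infty)$. **Associated MDP.** $\mathbf X_\Delta:=\mathbf X\cup\{\Delta\}$ with $\Delta\notin\mathbf X$ an isolated point; $\mathbf B:=[0,\infty]\times\mathbf A$ with the product topology. The transition kernel is $Q(dy|x,(\theta,a)):=\delta_{l(\phi(x,\theta),a)}(dy)$ if $x\ne\Delta$ and $\theta\neq\infty$, and $:=\delta_\Delta(dy)$ otherwise. The costs are $$\bar C_j(x,(\theta,a)):=\mathbb I\{x\neq\Delta\}\Big\{\int_{[0,\theta]}C_j^g(\phi(x,u))\,du+\mathbb I\{\theta<\infty\}C_j^I(\phi(x,\theta),a)\Big\},\quad j=0,\dots,J,$$ where for $\theta=\infty$ the integral is over $[0,\infty)$. **Strategies.** Histories are $h_i=(x_0,b_1,x_1,\dots,b_i,x_i)$ with $x_k\in\mathbf X_\Delta$, $b_k=(\theta_k,a_k)\in\mathbf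 B$. A strategy $\pi=\{\pi_i\}_{i=1}^\infty$ is a sequence of stochastic kernels $\pi_i(db|h_{i-1})$ on $\mathbf B$. It is stationary, denoted $\widetilde\pi$, if $\pi_i(db|h_{i-1})=\widetilde\pi(db|x_{i-1})$ for all $i$, for one stochastic kernel $\widetilde\pi$ on $\mathbf B$ given $\mathbf X_\Delta$; it is deterministic stationary, denoted $f$, if $\pi_i(db|h_{i-1})=\delta_{f(x_{i-1})}(db)$ for a measurable $f:\mathbf X_\Delta\to\mathbf B$. For an initial state $x$ and strategy $\pi$, $P^\pi_x$ (expectation $E^\pi_x$) is the Ionescu-Tulcea law of the process $X_0,B_1,X_1,B_2,\dots$ (with $B_n=(\Theta_n,A_n)$) for which $X_0=x$, $B_i$ has conditional law $\pi_i(\cdot|H_{i-1})$ given $H_{i-1}$, and $X_i$ has conditional law $Q(\cdot|X_{i-1},B_i)$ given $(H_{i-1},B_i)$. **Problem (P).** Let $\mathcal V_j(x_0,\pi):=E^\pi_{x_0}\big[\sum_{n=0}^\infty\bar C_j(X_n,B_{n+1})\big]$. Problem (P): minimize $\mathcal V_0(x_0,\pi)$ over strategies $\pi$ subject to $\mathcal V_j(x_0,\pi)\le d_j$, $j=1,\dots,J$. A strategy is feasible if it satisfies these constraints; it is optimal if it is feasible and its $\mathcal V_0(x_0,\cdot)$ is minimal among feasible strategies. **Occupation measure.** $\mu^\pi(\Gamma_1\times\Gamma_2):=E^\pi_{x_0}\big[\sum_{n=0}^\infty\mathbb I\{(X_n,B_{n+1})\in\Gamma_1\times\Gamma_2\}\big]$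 for $\Gamma_1\in\mathcal B(\mathbf X_\Delta)$, $\Gamma_2\in\mathcal B(\mathbf B)$; it is a $[0,\infty]$-valued measure on $\mathbf X_\Delta\times\mathbf B$. **Condition (I).** There is a feasible strategy $\pi$ with $\mathcal V_0(x_0,\pi)<\infty$. **Condition (II).** (a) $\mathbf A$ is compact, and $[0,\infty]$ is the one-point compactification of $[0,\infty)$; (b) $l$ is continuous on $\mathbf X\times\mathbf A$; (c) $\phi$ is continuous on $\mathbf X\times[0,\infty)$; (d) each $C_j^I$ is lower semicontinuous on $\mathbf X\times\mathbf A$; (e) each $C_j^g$ is lower semicontinuous on $\mathbf X$. **The set $V$ and the strategy $f^\ast$.** $V:=\{x\in\mathbf X_\Delta:\inf_\pi E^\pi_x[\sum_{n=0}^\infty\sum_{j=0}^J\bar C_j(X_n,B_{n+1})]>0\}$ and $V^c:=\mathbf X_\Delta\setminus V$. Under Condition (II), $V^c$ is closed in $\mathbf X_\Delta$ and there exists a measurable $f^\ast:\mathbf X_\Delta\to\mathbf B$ such that (i) $E^{f^\ast}_x[\sum_{n=0}^\infty\sum_{j=0}^J\bar C_j(X_n,B_{n+1})]=\inf_\pi E^\pi_x[\sum_{n=0}^\infty\sum_{j=0}^J\bar C_j(X_n,B_{n+1})]$ for all $x\in\mathbf X_\Delta$, and (ii) $Q(V|x,f^\ast(x))=0$ for all $x\in V^c$. **Linear program (LP2).** Minimize $\int_{V\times\mathbf B}\bar C_0(x,b)\,\mu(dx\times db)$ over $\sigma$-finite measures $\mu$ on $V\times\mathbf B$ subject to $\mu(dx\times\mathbf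 B)=\delta_{x_0}(dx)+\int_{V\times\mathbf B}Q(dx|y,b)\,\mu(dy\times db)$ on $\mathcal B(V)$ and $\int_{V\times\mathbf B}\bar C_j(x,b)\,\mu(dx\times db)\le d_j$, $j=1,\dots,J$. An optimal solution is a feasible measure attaining the minimum. *)

(* Defs.v *)
From HB Require Import structures.
From mathcomp Require Import all_boot all_order all_algebra.
From mathcomp Require Import all_classical all_reals all_analysis
  measurable_realfun.

Set Implicit Arguments.
Unset Strict Implicit.
Unset Printing Implicit Defensive.

Import Order.TTheory GRing.Theory Num.Theory.
Import numFieldNormedType.Exports.

Local Open Scope classical_set_scope.
Local Open Scope ring_scope.

(* [T] with its Borel sigma-algebra. Products of measurable types carry the
   product sigma-algebra, which is the Borel one for the second countable
   spaces considered below. *)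
Notation borel T := (g_sigma_algebraType (@open T)).

(* A Hausdorff pseudometric is a metric. *)
Definition polish {R : realType} (P : completePseudoMetricType R) : Prop :=
  hausdorff_space P /\ exists2 D : set P, countable D & dense D.

Definition borel_space (R : realType) (T : topologicalType) : Prop :=
  exists (P : completePseudoMetricType R) (B : set P),
    [/\ polish P, measurable (B : set (borel P)) &
      exists (f : T -> set_type B) (g : set_type B -> T),
        [/\ cancel f g, cancel g f, continuous f & continuous g]].

(* X together with the isolated point None, i.e. the disjoint sum topology
   (and not the one-point compactification). *)
Definition with_cemetery (X : Type) : Type := option X.

Section with_cemetery_topology.
Variable X : topologicalType.

Definition with_cemetery_open (U : set (with_cemetery X)) : Prop :=
  open ((@Some X) @^-1` U).

Let open_setT : with_cemetery_open setT. Proof. exact: openT. Qed.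

Let open_setI : setI_closed with_cemetery_open.
Proof. by move=> U W oU oW; exact: openI. Qed.

Let open_bigcup (I : Type) (f : I -> set (with_cemetery X)) :
  (forall i, with_cemetery_open (f i)) -> with_cemetery_open (\bigcup_i f i).
Proof.
move=> of_; rewrite /with_cemetery_open preimage_bigcup.
by apply: bigcup_open => i _; exact: of_.
Qed.

HB.instance Definition _ := Choice.on (with_cemetery X).
HB.instance Definition _ := Pointed.on (with_cemetery X).
HB.instance Definition _ := isOpenTopological.Build (with_cemetery X)
  open_setT open_setI open_bigcup.
End with_cemetery_topology.

Definition half_line (R : realType) : set R := [set t | 0 <= t].
Arguments half_line R : clear implicits.

Notation state X := (borel (with_cemetery X)).
(* [0, oo] is the one-point compactification of [0, oo); oo is None. *)
Notation action R A :=
  (borel (one_point_compactification (set_type (half_line R))) * borel A)%type.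
(* step n of a trajectory is the pair (X_n, B_{n+1}) *)
Notation step R X A := (state X * action R A)%type.
(* ((x_0, b_1), ..., (x_{n-1}, b_n), x_n) *)
Notation history R X A n := (n.-tuple (step R X A) * state X)%type.

Definition cylinders d (S : measurableType d) : set_system (nat -> S) :=
  [set C | exists n (E : set S), measurable E /\ C = [set w | E (w n)]].

Notation trajectory R X A := (g_sigma_algebraType (@cylinders _ (step R X A))).

Definition hist {R : realType} {X A : ptopologicalType} (n : nat)
    (w : trajectory R X A) : history R X A n :=
  ([tuple w i | i < n], (w n).1).

(* [flow x t] is only meaningful for t >= 0. *)
Record impulse_model (R : realType) (X A : ptopologicalType) (J : nat) :=
  ImpulseModel {
  flow : X -> R -> X ;
  jump : X -> A -> X ;
  gcost : 'I_J.+1 -> X -> R ;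
  icost : 'I_J.+1 -> X -> A -> R ;
  borel_X : borel_space R X ;
  borel_A : borel_space R A ;
  measurable_flow :
    measurable_fun ([set: borel X] `*` half_line R)
      (fun z : borel X * R => flow z.1 z.2 : borel X) ;
  flow0 : forall x, flow x 0 = x ;
  flowD : forall x s t, 0 <= s -> 0 <= t -> flow x (t + s) = flow (flow x s) t ;
  measurable_jump :
    measurable_fun [set: borel X * borel A]
      (fun z : borel X * borel A => jump z.1 z.2 : borel X) ;
  measurable_gcost : forall j, measurable_fun [set: borel X] (gcost j) ;
  gcost_ge0 : forall j x, 0 <= gcost j x ;
  measurable_icost : forall j,
    measurable_fun [set: borel X * borel A]
      (fun z : borel X * borel A => icost j z.1 z.2) ;
  icost_ge0 : forall j x a, 0 <= icost j x a }.

Section strategies.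
Context (R : realType) (X A : ptopologicalType).

(* [pi n] is the kernel choosing B_{n+1} given the history up to X_n. *)
Definition strategy : Type :=
  forall n : nat, R.-pker (history R X A n) ~> (action R A).

Section stationary.
Variable k : R.-pker (state X) ~> (action R A).

Definition last_state_kernel (n : nat) (h : history R X A n) :
  {measure set (action R A) -> \bar R} := k h.2.

Variable n : nat.

Let measurable_last_state_kernel U : measurable U ->
  measurable_fun [set: history R X A n] (@last_state_kernel n ^~ U).
Proof.
move=> mU; apply: (@measurableT_comp _ _ _ _ _ _ (fun x => k x U) _ snd).
  exact: measurable_kernel.
exact: measurable_snd.
Qed.

HB.instance Definition _ := isKernel.Build _ _ _ _ _
  (@last_state_kernel n) measurable_last_state_kernel.

Let last_state_kernelT h : @last_state_kernel n h [set: _] = 1%E.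
Proof. exact: prob_kernel. Qed.

HB.instance Definition _ := Kernel_isProbability.Build _ _ _ _ _
  (@last_state_kernel n) last_state_kernelT.
End stationary.

Definition stationary (k : R.-pker (state X) ~> (action R A)) : strategy :=
  fun n => (@last_state_kernel k n : R.-pker _ ~> _).

Definition deterministic (f : state X -> action R A)
    (mf : measurable_fun [set: state X] f) : strategy :=
  stationary (kdirac mf).
End strategies.

Section mdp.
Local Open Scope ereal_scope.
Context (R : realType) (X A : ptopologicalType) (J : nat).
Variable M : impulse_model R X A J.

Definition next (x : state X) (b : action R A) : state X :=
  match x, b.1 with
  | Some y, Some t => Some (jump M (flow M y (set_val t)) b.2)
  | _, _ => None
  end.

Definition transition (x : state X) (b : action R A) :
  {measure set (state X) -> \bar R} := dirac (next x b).

Definition cost (j : 'I_J.+1) (x : state X) (b : action R A) : \bar R :=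
  match x with
  | None => 0
  | Some y =>
    match b.1 with
    | Some t =>
        \int[lebesgue_measure]_(u in `[0%R, set_val t]) (gcost M j (flow M y u))%:E
        + (icost M j (flow M y (set_val t)) b.2)%:E
    | None =>
        \int[lebesgue_measure]_(u in `[0%R, +oo[) (gcost M j (flow M y u))%:E
    end
  end.

Definition has_law (pi : strategy R X A) (x : state X)
    (P : {measure set (trajectory R X A) -> \bar R}) : Prop :=
  [/\ P setT = 1,
    forall E : set (state X), measurable E ->
      P [set w : trajectory R X A | E (w 0%N).1] = \d_x E,
    forall n (D : set (history R X A n)) (E : set (action R A)),
      measurable D -> measurable E ->
      P [set w : trajectory R X A | D (hist n w) /\ E (w n).2] =
      \int[P]_(w in [set w : trajectory R X A | D (hist n w)])
        pi n (hist n w) E &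
    forall n (D : set (history R X A n * action R A)) (E : set (state X)),
      measurable D -> measurable E ->
      P [set w : trajectory R X A | D (hist n w, (w n).2) /\ E (w n.+1).1] =
      \int[P]_(w in [set w : trajectory R X A | D (hist n w, (w n).2)])
        transition (w n).1 (w n).2 E].

(* A measure such that [has_law pi x]. By the Ionescu-Tulcea theorem it exists
   (so the default value is irrelevant) and is unique on measurable sets. *)
Definition law (pi : strategy R X A) (x : state X) :
    {measure set (trajectory R X A) -> \bar R} :=
  match pselect (exists P, has_law pi x P) with
  | left h => sval (cid h)
  | right _ => mzero
  end.

Definition total_cost (j : 'I_J.+1) (x : state X) (pi : strategy R X A) :=
  \int[law pi x]_w \sum_(0 <= n <oo) cost j (w n).1 (w n).2.

Definition aggregate_cost (x : state X) (pi : strategy R X A) :=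
  \int[law pi x]_w
    \sum_(0 <= n <oo) \sum_(j < J.+1) cost j (w n).1 (w n).2.

Definition optimal_aggregate_cost (x : state X) : \bar R :=
  ereal_inf [set aggregate_cost x pi | pi in [set: strategy R X A]].

Definition V : set (state X) := [set x | 0 < optimal_aggregate_cost x].

Variables (x0 : X) (d : 'I_J -> R).

Definition feasible (pi : strategy R X A) : Prop :=
  forall j : 'I_J, total_cost (lift ord0 j) (Some x0) pi <= (d j)%:E.

Definition optimal (pi : strategy R X A) : Prop :=
  feasible pi /\ forall pi', feasible pi' ->
    total_cost ord0 (Some x0) pi <= total_cost ord0 (Some x0) pi'.

Definition optimal_value : \bar R :=
  ereal_inf [set total_cost ord0 (Some x0) pi | pi in feasible].

Definition occupation (pi : strategy R X A) (G : set (step R X A)) : \bar R :=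
  \int[law pi (Some x0)]_w \sum_(0 <= n <oo) (\1_G (w n))%:E.

Definition VB : set (step R X A) := V `*` setT.

(* A measure on V x B is encoded as a measure on the whole space vanishing off
   V x B: the measurable types of the library are nonempty, whereas V may be
   empty. *)
Definition lp2_feasible (mu : {measure set (step R X A) -> \bar R}) : Prop :=
  [/\ mu (~` VB) = 0,
    sigma_finite setT mu,
    forall G : set (state X), measurable G -> G `<=` V ->
      mu (G `*` setT) =
      \d_(Some x0 : state X) G + \int[mu]_(z in VB) transition z.1 z.2 G &
    forall j : 'I_J,
      \int[mu]_(z in VB) cost (lift ord0 j) z.1 z.2 <= (d j)%:E].

Definition lp2_objective (mu : {measure set (step R X A) -> \bar R}) : \bar R :=
  \int[mu]_(z in VB) cost ord0 z.1 z.2.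

Definition lp2_optimal (mu : {measure set (step R X A) -> \bar R}) : Prop :=
  lp2_feasible mu /\
  forall nu, lp2_feasible nu -> lp2_objective mu <= lp2_objective nu.

Definition lp2_value : \bar R :=
  ereal_inf [set lp2_objective mu | mu in lp2_feasible].

Definition condition_I : Prop :=
  exists2 pi, feasible pi & total_cost ord0 (Some x0) pi < +oo.

End mdp.

(* The remaining requirement, that [0, oo] be the one-point compactification of
   [0, oo), is built into [action]. *)
Definition condition_II (R : realType) (X A : ptopologicalType) (J : nat)
    (M : impulse_model R X A J) : Prop :=
  [/\ compact [set: A],
    continuous (fun z : X * A => jump M z.1 z.2),
    {within [set: X] `*` half_line R,
      continuous (fun z : X * R => flow M z.1 z.2)},
    forall j, lower_semicontinuous (fun z : X * A => (icost M j z.1 z.2)%:E) &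
    forall j, lower_semicontinuous (fun x : X => (gcost M j x)%:E)].

(* Main.v *)
(* The transitions are deterministic, so a strategy merely mixes over plans,
   i.e. sequences of actions. Plans form a compact space (Tychonoff), on which
   the total costs F_0, ..., F_J from x_0 are lower semicontinuous. For
   nonnegative multipliers lam, the minimum H(lam) of sum_j lam_j F_j over the
   plans bounds from below both sum_j lam_j V_j(x_0, pi) for every strategy pi
   and sum_j lam_j int C_j dmu for every feasible measure mu of (LP2): integrate
   the Bellman inequality for finite horizons along the process, respectively
   against the flow equation. With v_0 the lesser of the two optimal values and
   v_j = d_j for j >= 1, this gives H(lam) <= sum_j lam_j v_j, and convex duality
   produces a mixture of J + 2 plans with costs at most v.

   Stopped when it leaves V, the occupation measure of this mixture is feasible
   for (LP2) and purely atomic. A plan of finite cost visits no state of V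
   infinitely often, since its tails bound the value there; hence the measure
   has finite mass above each state and disintegrates into a kernel, completed by
   f^* off V. The costs of this stationary strategy are at most the integrals of
   the C_j over V x B, so that all the inequalities are equalities. *)

From HB Require Import structures.
Require Import Defs.
From mathcomp Require Import all_boot all_order all_algebra.
From mathcomp Require Import all_classical all_reals all_analysis
  measurable_realfun giry.
From mathcomp Require Import ring lra.

Set Implicit Arguments.
Unset Strict Implicit.
Unset Printing Implicit Defensive.

Import Order.TTheory GRing.Theory Num.Theory.
Import numFieldNormedType.Exports.

Local Open Scope classical_set_scope.
Local Open Scope ring_scope.
Local Open Scope ereal_scope.

(** * Lower semicontinuity and mixtures *)

(** The obstacle is [next]: at theta = oo the state drops to the isolated cemetery, so the states
    visited do not depend continuously on the plan. The costs stay lower semicontinuous, because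
    everything after the cemetery costs 0 and omitting a nonnegative continuation can only lower a
    sum. Finite horizons serve two purposes: their values are lower semicontinuous, hence
    measurable, and can be integrated against a law or a feasible measure; and by compactness of the
    plans they increase to the infinite-horizon value, so the bounds pass to the limit. A test
    function for the flow equation, which is known on V only, must vanish off V; here f^* enters,
    since following it keeps the state off V at zero cost, whatever the multipliers. As costs may be
    infinite, the cost vectors do not form a subset of a Euclidean space that could be separated
    from v. The duality argument therefore minimises a squared excess over mixtures and uses
    strictly positive multipliers only, for which a finite weighted sum forces every cost to be
    finite. *)

Definition liminf_ge (R : realType) (T : Type) (F : set_system T)
    (f : T -> \bar R) (l : \bar R) :=
  forall a : R, a%:E < l -> \forall x \near F, a%:E < f x.

Section liminf_ge.
Context (R : realType) (T : Type) (F : set_system T) {FF : Filter F}.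
Implicit Types (f g : T -> \bar R) (l m : \bar R).

Lemma liminf_ge_lbound f l : (\forall x \near F, l <= f x) -> liminf_ge F f l.
Proof. by move=> fl a al; apply: filterS fl => x; exact: lt_le_trans. Qed.

Lemma liminf_geS f g l : (\forall x \near F, f x <= g x) ->
  liminf_ge F f l -> liminf_ge F g l.
Proof.
move=> fg fl a /fl; apply: filterS2 fg => x fg af; exact: lt_le_trans fg.
Qed.

Lemma liminf_geD f g l m : 0 <= l -> 0 <= m ->
  liminf_ge F f l -> liminf_ge F g m ->
  liminf_ge F (fun x => f x + g x) (l + m).
Proof.
move=> l0 m0 fl gm a alm.
suff [s [t [sl tm ast]]] : exists s t : R, [/\ s%:E < l, t%:E < m & (a <= s + t)%R].
  apply: filterS2 (fl _ sl) (gm _ tm) => x sf tg.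
  by apply: le_lt_trans (lteD sf tg); rewrite -EFinD lee_fin.
case: l l0 alm {fl} => [l| |]// l0; last first.
  (* If one limit is infinite, -1 is strictly below the other, of which only nonnegativity is
     known. *)
  move=> _; exists (a + 1)%R, (-1)%R; split; rewrite ?ltry//; last lra.
  by apply: lt_le_trans m0; rewrite lte_fin; lra.
case: m m0 {gm} => [m| |]// m0; last first.
  move=> _; exists (-1)%R, (a + 1)%R; split; rewrite ?ltry//; last lra.
  by apply: lt_le_trans l0; rewrite lte_fin; lra.
rewrite -EFinD lte_fin => alm.
exists (l - (l + m - a) / 2)%R, (m - (l + m - a) / 2)%R.
by split; rewrite ?lte_fin; lra.
Qed.

Lemma liminf_ge_sum (I : Type) (r : seq I) (f : I -> T -> \bar R) (l : I -> \bar R) :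
  (forall i, 0 <= l i) -> (forall i, liminf_ge F (f i) (l i)) ->
  liminf_ge F (fun x => \sum_(i <- r) f i x) (\sum_(i <- r) l i).
Proof.
move=> l0 fl; elim: r => [|i r IH].
  by rewrite big_nil; apply: liminf_ge_lbound; near=> x; rewrite big_nil.
rewrite big_cons; apply: (@liminf_geS (fun x => f i x + \sum_(i <- r) f i x)).
  by near=> x; rewrite big_cons.
by apply: liminf_geD => //; exact: sume_ge0.
Unshelve. all: by end_near. Qed.

(** The convention 0 * oo = 0 is harmless: for a threshold a >= 0 the inequality a < q * l forces q
    > 0, and then f > r and p > a / r eventually, for some r strictly between a / q and l. Negative
    thresholds follow from nonnegativity. *)
Lemma liminf_geM (p : T -> R) (q : R) f l : (0 <= q)%R -> 0 <= l ->
  p @ F --> q -> (\forall x \near F, (0 <= p x)%R) ->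
  (\forall x \near F, 0 <= f x) -> liminf_ge F f l ->
  liminf_ge F (fun x => (p x)%:E * f x) (q%:E * l).
Proof.
move=> q0 l0 pq p0 f0 fl a aql.
have [a0|a0] := ltP a 0%R.
  apply: filterS2 p0 f0 => x p0 f0; apply: lt_le_trans (mule_ge0 _ f0) => //.
have {}q0 : (0 < q)%R.
  by rewrite lt_neqAle q0 andbT; apply/eqP => q0'; move: aql;
    rewrite -q0' mul0e lte_fin ltNge a0.
have [r [r1 r2]] : exists r : R, (a / q < r)%R /\ r%:E < l.
  case: l {fl} l0 aql => [l| |]// l0; last by exists (a / q + 1)%R; rewrite ltry; split => //; lra.
  rewrite -EFinM !lte_fin => aql; exists ((a / q + l) / 2)%R.
  have : (a / q < l)%R by rewrite ltr_pdivrMr// mulrC.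
  by move=> h; rewrite lte_fin; split; lra.
have r0 : (0 < r)%R by apply: le_lt_trans r1; rewrite divr_ge0// ltW.
have arq : (a / r < q)%R by rewrite ltr_pdivrMr// mulrC -ltr_pdivrMr.
have : \forall x \near F, (a / r < p x)%R by apply: (pq [set y | (a / r < y)%R]); exact: lt_nbhsr.
apply: filterS2 (fl _ r2) => x rf ap.
have p0' : (0 < p x)%R by apply: le_lt_trans ap; rewrite divr_ge0// ltW.
apply: (@lt_trans _ _ ((p x)%:E * r%:E)); last by rewrite lte_pmul2l.
by rewrite -EFinM lte_fin -ltr_pdivrMr.
Qed.

End liminf_ge.

(** The form with [liminf_ge] makes sense for any filter: the trace of a neighbourhood filter on a
    compact set, a sequence, the image under a continuous map. *)
Lemma lower_semicontinuous_liminf (R : realType) (T : topologicalType)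
    (f : T -> \bar R) :
  lower_semicontinuous f <-> forall x, liminf_ge (nbhs x) f (f x).
Proof.
split=> [h x a /h [V xV fV]|h x a /h ?]; first exact: filterS xV.
by exists [set y | a%:E < f y].
Qed.

Lemma ereal_between (R : realType) (x y : \bar R) : x < y -> 0 <= x ->
  exists a : R, x < a%:E /\ a%:E < y.
Proof.
case: x => [x| |]//; case: y => [y| |]// => xy x0.
  by exists ((x + y) / 2)%R; rewrite !lte_fin in xy *; split; lra.
by exists (x + 1)%R; rewrite ltry lte_fin; split => //; lra.
Qed.

(** The sublevel sets above the infimum generate a proper filter on A, and semicontinuity makes its
    cluster points minimisers. An infinite infimum is treated apart, since no level lies above
    it. *)
Lemma compact_min (R : realType) (T : topologicalType) (A : set T)
    (f : T -> \bar R) : compact A -> A !=set0 -> (forall x, 0 <= f x) ->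
  (forall x, A x -> liminf_ge (within A (nbhs x)) f (f x)) ->
  exists2 x, A x & forall y, A y -> f x <= f y.
Proof.
move=> cA [x0 Ax0] f0 flsc.
pose m := ereal_inf (f @` A).
have mf y : A y -> m <= f y by move=> Ay; apply: ereal_inf_lbound; exists y.
have [moo|moo] := eqVneq m +oo.
  by exists x0 => // y /mf; rewrite moo leye_eq => /eqP ->; rewrite leey.
have m0 : 0 <= m by apply: le_ereal_inf_tmp => _ [y _ <-].
pose G := filter_from [set a : \bar R | m < a] (fun a => [set y | A y /\ f y < a]).
have PG : ProperFilter G.
  apply: filter_from_proper; last first.
    move=> a /= /ereal_inf_lt [_ [y Ay <-] ya]; exists y; split => //.
  apply: filter_from_filter; first by exists +oo; rewrite /= ltey.
  move=> a b /= ma mb; exists (Order.min a b); first by rewrite /= lt_min ma mb.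
  by move=> y [Ay]; rewrite lt_min => /andP[].
have GA : G A by exists +oo => //=; [rewrite ltey|move=> y []].
have [x [Ax xcl]] := cA G PG GA.
exists x => // y Ay; apply: le_trans (mf _ Ay).
rewrite leNgt; apply/negP => mx.
have [a [ma ax]] := ereal_between mx m0.
have [|z [/= [Az za] az]] := xcl [set y | A y /\ f y < a%:E] _ _ (flsc _ Ax _ ax).
  by exists a%:E.
by move: (az Az); rewrite ltNge (ltW za).
Qed.

(** * Affine dependence and Caratheodory's reduction *)

Lemma affine_dependency (K : fieldType) n (q : 'I_n.+2 -> 'I_n -> K) :
  exists u : 'I_n.+2 -> K, [/\ exists i, (u i != 0)%R, (\sum_i u i = 0)%R &
    forall j, (\sum_i u i * q i j = 0)%R].
Proof.
(* With n + 2 rows and n + 1 columns the left kernel is nonzero. The column [ord0] of ones turns its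
   relation into a vanishing sum of coefficients; the other columns hold the coordinates. *)
pose M := (\matrix_(i < n.+2, j < n.+1) oapp (q i) 1%R (unlift ord0 j))%R.
have : (kermx M != 0)%R.
  rewrite kermx_eq0 /row_free; apply/eqP => rM.
  by have := rank_leq_col M; rewrite rM ltnn.
move=> /matrix0Pn[i [k Mik]]; exists (fun k => kermx M i k).
have kM j : (\sum_k kermx M i k * M k j = 0)%R.
  by have /matrixP/(_ i j) := mulmx_ker M; rewrite !mxE.
split; first by exists k.
  rewrite -[RHS](kM ord0); apply: eq_bigr => l _.
  by rewrite [M _ _]mxE unlift_none mulr1.
move=> j; rewrite -[RHS](kM (lift ord0 j)); apply: eq_bigr => l _.
by rewrite [M _ _]mxE liftK.
Qed.

(** Moving the weights against an affine dependency u preserves their sum and barycentre. The step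
    length is the least ratio w / u over the positive u: one weight reaches 0 before any becomes
    negative. *)
Lemma caratheodory_step (K : realFieldType) n (q : 'I_n.+2 -> 'I_n -> K)
    (w : 'I_n.+2 -> K) : (forall i, 0 <= w i)%R ->
  exists w' : 'I_n.+2 -> K, [/\ forall i, (0 <= w' i)%R,
    (\sum_i w' i = \sum_i w i)%R,
    forall j, (\sum_i w' i * q i j = \sum_i w i * q i j)%R &
    exists i, w' i = 0%R].
Proof.
move=> w0; have [u [[k uk] u0 uq]] := affine_dependency q.
have [i0 ui0] : exists i, (0 < u i)%R.
  apply/not_existsP => un.
  have un' i : (u i <= 0)%R by rewrite leNgt; apply/negP/un.
  have : (\sum_i - u i == 0)%R by rewrite sumrN u0 oppr0.
  rewrite psumr_eq0; last by move=> i _; rewrite oppr_ge0.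
  by move=> /allP/(_ k); rewrite mem_index_enum oppr_eq0 (negbTE uk) => /(_ isT).
case: (@arg_minP _ _ _ i0 (fun i => 0 < u i)%R (fun i => w i / u i)%R ui0) => i ui imin.
exists (fun j => w j - w i / u i * u j)%R; split.
- move=> j; rewrite subr_ge0; have [uj|uj] := ltP 0%R (u j).
    by rewrite -ler_pdivlMr//; exact: imin.
  by apply: le_trans (w0 j); rewrite mulr_ge0_le0// divr_ge0// ltW.
- by rewrite sumrB -mulr_sumr u0 mulr0 subr0.
- move=> j; under eq_bigr do rewrite mulrBl -[(_ * u _ * _)%R]mulrA.
  by rewrite sumrB -mulr_sumr uq mulr0 subr0.
- by exists i; rewrite divfK ?subrr// gt_eqF.
Qed.

(** Adding c makes n + 2 points, and the reduction discards one whose weight becomes 0. That the new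
    points are among c and the old ones is recorded because they must inherit finite costs. *)
Lemma caratheodory_segment (K : realFieldType) (T : Type) n (q : T -> 'I_n -> K)
    (p : 'I_n.+1 -> K) (b : 'I_n.+1 -> T) (c : T) (t : K) :
  (forall i, 0 <= p i)%R -> (\sum_i p i = 1)%R -> (0 <= t <= 1)%R ->
  exists (p' : 'I_n.+1 -> K) (b' : 'I_n.+1 -> T),
    [/\ forall i, (0 <= p' i)%R, (\sum_i p' i = 1)%R,
      forall i, b' i = c \/ (exists k, b' i = b k) &
      forall j, (\sum_i p' i * q (b' i) j =
        (1 - t) * \sum_i p i * q (b i) j + t * q c j)%R].
Proof.
move=> p0 p1 /andP[t0 t1].
pose bb (i : 'I_n.+2) := oapp b c (unlift ord0 i).
pose w (i : 'I_n.+2) := oapp (fun k => (1 - t) * p k)%R t (unlift ord0 i).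
have w0 i : (0 <= w i)%R.
  by rewrite /w; case: unliftP => [k _|_]//=; rewrite mulr_ge0// subr_ge0.
have [w' [w'0 w'1 w'q [i0 w'i0]]] := caratheodory_step (fun i => q (bb i)) w0.
exists (fun i => w' (lift i0 i)), (fun i => bb (lift i0 i)).
have big (f : 'I_n.+2 -> K) : f i0 = 0%R -> (\sum_i f (lift i0 i) = \sum_i f i)%R.
  by move=> fi0; rewrite [RHS](bigD1_ord i0)//= fi0 add0r.
split => //.
- rewrite big// w'1 big_ord_recl /w unlift_none /=.
  under eq_bigr do rewrite liftK /=.
  by rewrite -mulr_sumr p1; lra.
- move=> i; rewrite /bb; case: unliftP => [k _|_] /=; [by right; exists k|by left].
- move=> j; rewrite (big (fun i => w' i * q (bb i) j)%R) ?w'i0 ?mul0r// w'q.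
  rewrite big_ord_recl /w /bb unlift_none /= addrC; congr (_ + _)%R.
  by rewrite mulr_sumr; apply: eq_bigr => i _; rewrite liftK /= mulrA.
Qed.

(** * Finite mixtures and convex duality *)

Section mixtures.
Context (R : realType) (K : topologicalType) (n : nat) (F : 'I_n -> K -> \bar R).

Definition mixture (p : 'I_n.+1 -> R) (b : 'I_n.+1 -> K) (j : 'I_n) : \bar R :=
  \sum_i (p i)%:E * F j (b i).

Hypothesis cK : compact [set: K].
Hypothesis F0 : forall j b, 0 <= F j b.
Hypothesis lscF : forall j, lower_semicontinuous (F j).

Local Notation PT := (prod_topology (fun _ : 'I_n.+1 => (R * K)%type)).

Let simplex := [set z : PT |
  (forall i, 0 <= (z i).1)%R /\ (\sum_i (z i).1 = 1)%R].

Let cvg_weight i (z : PT) :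
  (fun y => (y i).1) @ nbhs z --> (z i).1.
Proof.
apply: (@cvg_comp _ _ _ (fun y => y i) fst _ (nbhs (z i))); last exact: cvg_fst.
exact: (@proj_continuous _ (fun _ : 'I_n.+1 => (R * K)%type) i z).
Qed.

Let cvg_atom i (z : PT) :
  (fun y => (y i).2) @ nbhs z --> (z i).2.
Proof.
apply: (@cvg_comp _ _ _ (fun y => y i) snd _ (nbhs (z i))); last exact: cvg_snd.
exact: (@proj_continuous _ (fun _ : 'I_n.+1 => (R * K)%type) i z).
Qed.

Let total (r : seq 'I_n.+1) (y : PT) : R := (\sum_(i <- r) (y i).1)%R.

Let cvg_total r (z : PT) : total r @ nbhs z --> total r z.
Proof.
elim: r => [|i r IH].
  rewrite (_ : total [::] = fun=> 0%R); first exact: cvg_cst.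
  by apply/funext => y; rewrite /total big_nil.
rewrite (_ : total (i :: r) = fun y => (y i).1 + total r y)%R.
  by apply: (@cvgD _ _ _ _ (@nbhs_filter PT z)); [exact: cvg_weight|exact: IH].
by apply/funext => y; rewrite /total big_cons.
Qed.

Lemma compact_simplex : compact simplex.
Proof.
have := @tychonoff _ (fun _ : 'I_n.+1 => (R * K)%type)
  (fun=> `[0%R : R, 1%R]%classic `*` [set: K])
  (fun=> compact_setX (@segment_compact _ _ _) cK).
move=> c.
have -> : simplex = [set f : PT |
    forall i, (`[0%R : R, 1%R]%classic `*` [set: K]) (f i)] `&`
    total (index_enum _) @^-1` [set 1%R].
  apply/seteqP; split => z /=; last first.
    move=> [z01 z1]; split => // i; have [/=] := z01 i.
    by rewrite in_itv /= => /andP[].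
  move=> [z0 z1]; split => // i; split => //=; rewrite in_itv /= z0 /=.
  by rewrite -z1 (bigD1 i)//= lerDl sumr_ge0.
apply: compact_closedI => //.
apply: preimage_closed; last exact: closed_eq.
by move=> z _; exact: cvg_total.
Qed.

Lemma liminf_ge_mixture z j : simplex z ->
  liminf_ge (within simplex (nbhs z)) (fun y => mixture (fst \o y) (snd \o y) j)
    (mixture (fst \o z) (snd \o z) j).
Proof.
move=> [z0 z1]; apply: liminf_ge_sum => i.
  by rewrite mule_ge0// lee_fin; exact: z0.
apply: liminf_geM => //=.
- by apply: cvg_within_filter; exact: cvg_weight.
- by apply: filterS (withinT _ _) => y [].
- by near=> y.
- move=> a az.
  have h := (lower_semicontinuous_liminf (F j)).1 (@lscF j) _ _ az.
  apply: cvg_within; exact: (cvg_atom h).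
Unshelve. all: by end_near. Qed.

(** The squared positive part is monotone in f: for a >= 0 its superlevel set at a is that of f at c
    + sqrt a. *)
Lemma sqr_max_liminf (T : Type) (G : set_system T) (FG : Filter G)
    (f : T -> \bar R) (l : \bar R) (c : R) :
  liminf_ge G f l ->
  liminf_ge G (fun y => maxe (f y - c%:E) 0 * maxe (f y - c%:E) 0)
     (maxe (l - c%:E) 0 * maxe (l - c%:E) 0).
Proof.
have m0 (x : \bar R) : 0 <= maxe (x - c%:E) 0 by rewrite le_max lexx orbT.
move=> fl a al; have [a0|a0] := ltP a 0%R.
  by near=> y; apply: lt_le_trans (mule_ge0 (m0 _) (m0 _)); rewrite lte_fin.
have sq (x : \bar R) : (a%:E < maxe (x - c%:E) 0 * maxe (x - c%:E) 0) =
    ((c + Num.sqrt a)%:E < x).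
  case: x => [x| |].
  - rewrite -EFinB -EFin_max -EFinM !lte_fin.
    rewrite -{1}(sqr_sqrtr a0) -expr2 ltr_pXn2r ?nnegrE ?sqrtr_ge0//; last first.
      by rewrite le_max lexx orbT.
    by rewrite lt_max ltrBrDl [(_ < 0)%R]ltNge sqrtr_ge0 orbF.
  - by rewrite /= maxye mulyy !ltry.
  - by rewrite /= maxNye mule0 lte_fin !ltNge a0 /= leNye.
by move: al; rewrite sq => /fl; apply: filterS => y; rewrite sq.
Unshelve. all: by end_near. Qed.

(* The minimiser of the sum of the squared excesses over [v] exists because the
   mixtures of [n.+1] points form a compact set. Mixing in one more point does
   not leave this set (Caratheodory), so the excesses satisfy a variational
   inequality; slightly perturbed, they would be multipliers contradicting the
   hypothesis if they did not vanish. *)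
Lemma mixture_of_duality (v : 'I_n -> R) :
  (forall (lam : 'I_n -> R) (e : R), (forall j, 0 < lam j)%R -> (0 < e)%R ->
    exists b, \sum_j (lam j)%:E * F j b <= (\sum_j lam j * v j + e)%:E) ->
  exists (p : 'I_n.+1 -> R) (b : 'I_n.+1 -> K),
    [/\ forall i, (0 <= p i)%R, (\sum_i p i = 1)%R &
      forall j, mixture p b j <= (v j)%:E].
Proof.
move=> dual.
have Ffin (lam : 'I_n -> R) b (r : R) : (forall j, 0 < lam j)%R ->
    \sum_j (lam j)%:E * F j b <= r%:E -> forall j, F j b \is a fin_num.
  move=> lam0 Fr j; rewrite ge0_fin_numE// ltey; apply/eqP => Foo.
  move: Fr; rewrite (bigD1 j)//= Foo gt0_muley ?lte_fin// addye ?leye_eq//.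
  rewrite gt_eqF// (@lt_le_trans _ _ 0)// sume_ge0// => k _.
  by rewrite mule_ge0// lee_fin ltW.
pose ex (z : PT) j :=
  maxe (mixture (fst \o z) (snd \o z) j - (v j)%:E) 0.
have ex0 z j : 0 <= ex z j by rewrite le_max lexx orbT.
pose phi z := \sum_j ex z j * ex z j.
have phi0 z : 0 <= phi z by apply: sume_ge0 => j _; exact: mule_ge0.
(* Unit multipliers yield a point with finite costs, so that the minimum of [phi] is finite. *)
have [b1 Fb1] := dual (fun=> 1%R) 1%R (fun=> ltr01) ltr01.
have {}Fb1 := Ffin (fun=> 1%R) b1 _ (fun=> ltr01) Fb1.
have lift1 b : let z := (fun i : 'I_n.+1 => ((i == ord0)%:R%R, b)) :
      PT in
    simplex z /\ forall j, mixture (fst \o z) (snd \o z) j = F j b.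
  move=> z; split.
    split; first by move=> i; rewrite /z /= ler0n.
    by rewrite /= (bigD1 ord0)//= big1 ?addr0// => i /negbTE /= ->.
  move=> j; rewrite /mixture /= (bigD1 ord0)//= big1 ?adde0 ?mul1e//.
  by move=> i /negbTE /= ->; rewrite mul0e.
have [||z [zw z1] zmin] := @compact_min _ _ _ phi compact_simplex _ phi0 _.
- by eexists; exact: (lift1 b1).1.
- move=> z Sz; apply: liminf_ge_sum => j; first exact: mule_ge0.
  by apply: sqr_max_liminf; exact: liminf_ge_mixture.
have z0 : phi z < +oo.
  apply: le_lt_trans (zmin _ (lift1 b1).1) _; rewrite /phi.
  apply: lte_sum_pinfty => j _; rewrite /ex (lift1 b1).2 -(fineK (Fb1 j)).
  by rewrite -EFinB -EFin_max -EFinM ltry.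
have zfin j : mixture (fst \o z) (snd \o z) j \is a fin_num.
  rewrite ge0_fin_numE; last first.
    by apply: sume_ge0 => i _; rewrite mule_ge0// lee_fin; exact: zw.
  rewrite ltey; apply/eqP => zoo; move: z0; rewrite /phi (bigD1 j)//= /ex zoo.
  rewrite /= maxye mulyy addye// gt_eqF// (@lt_le_trans _ _ 0)// sume_ge0// => k _.
  exact: (mule_ge0 (ex0 z k) (ex0 z k)).
pose P j := fine (mixture (fst \o z) (snd \o z) j).
pose e j := Num.max (P j - v j)%R 0%R.
have e0 j : (0 <= e j)%R by rewrite le_max lexx orbT.
have phiz : phi z = (\sum_j e j ^+ 2)%:E.
  rewrite /phi -sumEFin; apply: eq_bigr => j _.
  by rewrite /ex -(fineK (zfin j)) -EFinB -EFin_max -EFinM expr2.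
have variational b : (forall j, F j b \is a fin_num) ->
    (0 <= \sum_j e j * (fine (F j b) - P j))%R.
  move=> Fb; set s := (\sum_j _)%R.
  pose c := (\sum_j (fine (F j b) - P j) ^+ 2)%R.
  have c0 : (0 <= c)%R by apply: sumr_ge0 => j _; exact: sqr_ge0.
  (* The first-order condition, divided by t. Were s negative, t = -s / (-s + c), which lies in ]0,
     1], would violate it. *)
  suff key t : (0 < t <= 1)%R -> (0 <= 2 * s + t * c)%R.
    rewrite leNgt; apply/negP => s0.
    have t01 : (0 < - s / (- s + c) <= 1)%R.
      rewrite divr_gt0/= ?ler_pdivrMr ?mul1r//; lra.
    have := key _ t01; set t := (_ / _)%R => h.
    have : (t * (- s + c) = - s)%R by rewrite /t divfK//; lra.
    have : (0 < t)%R by case/andP: t01.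
    nra.
  move=> /andP[t0 t1].
  pose q (x : K) (j : 'I_n) := fine (F j x).
  (* An atom of weight 0 may have infinite costs, on which [fine] is meaningless; replacing it by b
     does not change the mixture. *)
  pose b' i := if (z i).1 == 0%R then b else (z i).2.
  have b'fin i j : F j (b' i) \is a fin_num.
    rewrite /b'; case: eqP => // /eqP zi; rewrite ge0_fin_numE// ltey.
    apply/eqP => Foo; have := zfin j; rewrite /mixture (bigD1 i)//= Foo.
    rewrite gt0_muley ?lte_fin ?lt_neqAle ?[(0 == _)%R]eq_sym ?zi ?zw//.
    rewrite addye// gt_eqF// (@lt_le_trans _ _ 0)// sume_ge0// => k _.
    by rewrite mule_ge0// lee_fin; exact: zw.
  have Pq j : (\sum_i (z i).1 * q (b' i) j)%R = P j.
    rewrite /P (_ : mixture _ _ j = (\sum_i (z i).1 * q (b' i) j)%R%:E)//.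
    rewrite -sumEFin; apply: eq_bigr => i _ /=; rewrite EFinM /q fineK//.
    by rewrite /b'; case: eqP => // ->; rewrite !mul0e.
  have [|p' [b'' [p'0 p'1 b''b p'q]]] :=
    @caratheodory_segment _ _ _ q (fun i => (z i).1) b' b t zw z1.
    by rewrite (ltW t0).
  have b''fin i j : F j (b'' i) \is a fin_num.
    by case: (b''b i) => [->|[k ->]].
  pose z' := (fun i => (p' i, b'' i)) : PT.
  have mz' j : mixture (fst \o z') (snd \o z') j = ((1 - t) * P j + t * fine (F j b))%:E.
    rewrite -Pq -p'q -sumEFin; apply: eq_bigr => i _ /=.
    by rewrite EFinM /q fineK.
  have : phi z <= phi z' by exact: zmin.
  rewrite phiz /phi; under [X in _ <= X]eq_bigr do rewrite /ex mz' -EFinB -EFin_max -EFinM.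
  rewrite sumEFin lee_fin => h.
  (* Since P - v <= e, the excess of the perturbed mixture is at most the positive part of e + t (F
     - P), and dropping the positive part can only enlarge the square. *)
  have : (\sum_j e j ^+ 2 <= \sum_j (e j + t * (fine (F j b) - P j)) ^+ 2)%R.
    apply: le_trans h _; apply: ler_sum => j _; rewrite -expr2.
    have : (P j - v j <= e j)%R by rewrite le_max lexx.
    rewrite maxEle; case: ifPn => [_ _|]; first by rewrite expr0n /= sqr_ge0.
    rewrite -ltNge => h1 h2; rewrite ler_pXn2r ?nnegrE//; lra.
  rewrite -subr_ge0 -sumrB.
  under eq_bigr do rewrite sqrrD [(_ ^+ 2 + _)%R]addrC -addrA [(_ ^+ 2 + _)%R]addrC addrA addrK.
  rewrite big_split /=.
  under eq_bigr do rewrite mulrA [(e _ * t)%R]mulrC -mulrA -mulrnAr.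
  rewrite -mulr_sumr sumrMnl -/s.
  under [X in (_ + X)%R]eq_bigr do rewrite exprMn.
  rewrite -mulr_sumr -/c => h2.
  rewrite -(pmulr_rge0 _ t0); move: h2; rewrite mulr2n; nra.
have [E0|E0] := eqVneq (\sum_j e j ^+ 2)%R 0%R.
  exists (fst \o z), (snd \o z); split => // j.
  rewrite -(fineK (zfin j)) lee_fin -/(P j).
  move/eqP : E0; rewrite psumr_eq0; last by move=> k _; exact: sqr_ge0.
  move=> /allP/(_ j); rewrite mem_index_enum sqrf_eq0 => /(_ isT)/eqP ej.
  by rewrite -subr_le0 -ej le_max lexx.
exfalso.
set E := (\sum_j _)%R in E0.
have {}E0 : (0 < E)%R by rewrite lt_neqAle eq_sym E0 sumr_ge0// => j _; exact: sqr_ge0.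
pose V := (\sum_j `|v j|)%R.
have V0 : (0 <= V)%R by exact: sumr_ge0.
(* The shift d makes all multipliers e + d positive and is also the tolerance. Its total effect d (V
   + 1) is E / 2, whereas the variational inequality would require at least E. *)
pose d := (E / (2 * (V + 1)))%R.
have d0 : (0 < d)%R by rewrite divr_gt0//; lra.
have lam0 j : (0 < e j + d)%R by exact: ltr_wpDl.
have [b Fb] := dual _ d lam0 d0.
have bfin := Ffin _ _ _ lam0 Fb.
have := variational _ bfin.
have eP : (\sum_j e j * P j = \sum_j e j * v j + E)%R.
  rewrite -big_split; apply: eq_bigr => j _ /=.
  rewrite expr2 -mulrDr /e; case: (leP (P j - v j)%R 0%R) => h; last by congr (_ * _)%R; lra.
  by rewrite !mul0r.
under eq_bigr do rewrite mulrBr.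
rewrite sumrB eP => h1.
have h2 : (\sum_j (e j + d) * fine (F j b) <= \sum_j (e j + d) * v j + d)%R.
  rewrite -lee_fin -sumEFin; apply: le_trans Fb; apply: lee_sum => j _.
  by rewrite EFinM fineK.
have h3 : (\sum_j e j * fine (F j b) <= \sum_j (e j + d) * fine (F j b))%R.
  apply: ler_sum => j _; apply: ler_wpM2r; first exact: fine_ge0.
  by rewrite lerDl ltW.
have h4 : (\sum_j (e j + d) * v j <= \sum_j e j * v j + d * V)%R.
  rewrite mulr_sumr -big_split; apply: ler_sum => j _ /=.
  by rewrite mulrDl lerD2l ler_wpM2l ?ler_norm// ltW.
have h5 : (d * (V + 1) = E / 2)%R.
  rewrite /d -[(2 * _)%R]mulrC invfM mulrA -mulrA mulrCA [(_^-1 * _)%R]mulrC; field; lra.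
have : (E <= d * (V + 1))%R by lra.
rewrite h5; lra.
Unshelve. all: by end_near. Qed.

End mixtures.

(** * The Ionescu-Tulcea theorem *)

Section trajectories.
Context d (S : measurableType d).
Local Notation traj := (g_sigma_algebraType (@cylinders _ S)).

Lemma measurable_coordinate n : measurable_fun [set: traj] (fun w : traj => w n).
Proof.
by move=> _ E mE; rewrite setTI; apply: sub_sigma_algebra; exists n, E.
Qed.

Lemma measurable_trajectory d' (T : measurableType d') (f : T -> traj) :
  (forall n, measurable_fun [set: T] (fun t => f t n)) -> measurable_fun [set: T] f.
Proof.
move=> mf; apply: (@measurability _ _ T traj setT f (@cylinders _ S)) => //.
move=> _ [_ [n [E [mE ->]]] <-].
exact: (mf n measurableT E mE).
Qed.

Definition update n (z : traj * S) : traj := fun i => if i == n then z.2 else z.1 i.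

Lemma measurable_update n : measurable_fun [set: traj * S] (update n).
Proof.
apply: measurable_trajectory => i; rewrite /update; case: eqP => _.
  exact: measurable_snd.
exact: (measurableT_comp (measurable_coordinate i) measurable_fst).
Qed.

Definition depends U n (f : traj -> U) :=
  forall w w', (forall i, (i < n)%N -> w i = w' i) -> f w = f w'.

Lemma depends_le U n m (f : traj -> U) : (n <= m)%N -> depends n f -> depends m f.
Proof. by move=> nm fn w w' ww'; apply: fn => i ni; apply: ww'; exact: leq_trans nm. Qed.

Definition determined n (A : set traj) := depends n A.

Lemma depends_indic (R : realType) n (A : set traj) : determined n A ->
  depends n (EFin \o \1_A : traj -> \bar R).
Proof.
move=> dA w w' ww'; rewrite /= !indicE; congr (nat_of_bool _)%:R%:E.
by apply/idP/idP; rewrite !inE (dA w w').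
Qed.

Definition truncate n (w : traj) : traj := fun i => if (i < n)%N then w i else point.

Lemma measurable_truncate n : measurable_fun [set: traj] (truncate n).
Proof.
apply: measurable_trajectory => i; rewrite /truncate; case: (i < n)%N.
  exact: measurable_coordinate.
exact: measurable_cst.
Qed.

(** A second copy of the sequence space, to carry the algebra of measurable sets determined by
    finitely many coordinates. *)
Definition cylinder_algebra : Type := nat -> S.

End trajectories.

Definition cylinder_display : measure_display. Proof. by constructor. Qed.

Section cylinder_algebra.
Context d (S : measurableType d).
Local Notation traj := (g_sigma_algebraType (@cylinders _ S)).

HB.instance Definition _ := Pointed.copy (cylinder_algebra S) (nat -> S).

Let cyl : set (set (cylinder_algebra S)) :=
  [set A | measurable (A : set traj) /\ exists n, determined n (A : set traj)].

Let cyl0 : cyl set0. Proof. by split; [exact: measurable0|exists 0%N]. Qed.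

Let cylU : setU_closed cyl.
Proof.
move=> A B [mA [n dA]] [mB [m dB]]; split; first exact: measurableU.
exists (maxn n m) => w w' ww'; rewrite /setU /mkset.
by rewrite (dA w w') ?(dB w w')// => i ni; apply: ww'; rewrite leq_max ni ?orbT.
Qed.

Let cylC : setC_closed cyl.
Proof.
move=> A [mA [n dA]]; split; first exact: measurableC.
by exists n => w w' ww'; rewrite /setC /mkset (dA w w').
Qed.

HB.instance Definition _ := isAlgebraOfSets.Build cylinder_display
  (cylinder_algebra S) cyl0 cylU cylC.

Lemma cylinder_measurableE (A : set (cylinder_algebra S)) :
  measurable A <-> measurable (A : set traj) /\ exists n, determined n (A : set traj).
Proof. by []. Qed.

End cylinder_algebra.

Section ionescu_tulcea.
Context d (S : measurableType d) (R : realType).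
Local Notation traj := (g_sigma_algebraType (@cylinders _ S)).
Variables (K : nat -> traj -> giry S R).
Hypothesis mK : forall n, measurable_fun [set: traj] (K n).
Hypothesis K1 : forall n w, K n w setT = 1.
Hypothesis adaptedK : forall n, depends n (K n).

(** For f depending on the coordinates up to n, this is the conditional expectation given those
    below n. The kernels take whole trajectories and adaptedness is a property, which avoids tuples
    of varying length. *)
Definition extend n (f : traj -> \bar R) (w : traj) : \bar R :=
  \int[K n w]_s f (update n (w, s)).

(** The Giry monad makes the resampling of coordinate n a measurable kernel on trajectories, which
    yields the measurability of [extend n f]. *)
Let kappa n (w : traj) : giry traj R :=
  giry_map (measurable_update n) (giry_prod (giry_ret w, K n w)).

Let mkappa n : measurable_fun [set: traj] (kappa n).
Proof.
apply: (measurableT_comp (measurable_giry_map (measurable_update n))).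
apply: (measurableT_comp measurable_giry_prod).
by apply: measurable_fun_pair => //; exact: measurable_giry_ret.
Qed.

Let int_kappa n w f : measurable_fun [set: traj] f -> (forall w, 0 <= f w) ->
  giry_int (kappa n w) f = extend n f w.
Proof.
move=> mf f0; rewrite /kappa giry_int_map//.
have mfu : measurable_fun [set: traj * S] (f \o update n).
  exact: (measurableT_comp mf (measurable_update n)).
rewrite giry_int_prod1//; last by move=> ?; exact: f0.
rewrite giry_int_ret//.
apply: (@measurable_fun_fubini_tonelli_F _ _ _ _ _ (K n w) _ mfu).
by move=> ?; exact: f0.
Qed.

Lemma measurable_extend n f : measurable_fun [set: traj] f ->
  (forall w, 0 <= f w) -> measurable_fun [set: traj] (extend n f).
Proof.
move=> mf f0; rewrite (_ : extend n f = fun w => giry_int (kappa n w) f).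
  exact: (measurableT_comp (measurable_giry_int mf f0) (mkappa n)).
by apply/funext => w; rewrite int_kappa.
Qed.

Lemma extend_ge0 n f : (forall w, 0 <= f w) -> forall w, 0 <= extend n f w.
Proof. by move=> f0 w; apply: integral_ge0. Qed.

Lemma measurable_section n (f : traj -> \bar R) (w : traj) : measurable_fun [set: traj] f ->
  measurable_fun [set: S] (fun s => f (update n (w, s))).
Proof.
move=> mf; apply: (measurableT_comp mf).
by apply: (measurableT_comp (measurable_update n)); exact: pair1_measurable.
Qed.

Lemma extend_le n f g : measurable_fun [set: traj] f ->
  measurable_fun [set: traj] g -> (forall w, 0 <= f w) ->
  (forall w, f w <= g w) -> forall w, extend n f w <= extend n g w.
Proof.
move=> mf mg f0 fg w; apply: ge0_le_integral => //.
- exact: measurable_section.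
- exact: measurable_section.
Qed.

Lemma update_lt n (w : traj) (s : S) i : (i < n)%N -> update n (w, s) i = w i.
Proof. by rewrite /update; case: eqP => // ->; rewrite ltnn. Qed.

Lemma extend_depends n f : depends n f -> extend n f = f.
Proof.
move=> df; apply/funext => w; rewrite /extend.
rewrite (eq_integral (fun=> f w)); last first.
  by move=> s _; apply: df => i ni; rewrite update_lt.
by rewrite integral_cst// [X in _ * X]K1 mule1.
Qed.

Lemma depends_extend n f : depends n.+1 f -> depends n (extend n f).
Proof.
move=> df w w' ww'; rewrite /extend (adaptedK ww').
apply: eq_integral => s _; apply: df => i; rewrite ltnS leq_eqVlt => /predU1P[->|ni].
  by rewrite /update eqxx.
by rewrite !update_lt// ww'.
Qed.

Fixpoint backward n m (f : traj -> \bar R) :=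
  if m is m'.+1 then extend n (backward n.+1 m' f) else f.

Lemma backwardSr n m f : backward n m.+1 f = backward n m (extend (n + m) f).
Proof.
elim: m n => [|m IH] n; first by rewrite addn0.
by rewrite [LHS]/= -[X in extend _ X]/(backward n.+1 m.+1 f) IH /= addSnnS.
Qed.

Lemma backward_stable n m k f : depends (n + m) f ->
  backward n (m + k) f = backward n m f.
Proof.
move=> df; elim: k => [|k IH]; first by rewrite addn0.
rewrite addnS backwardSr extend_depends ?IH//.
by apply: depends_le df; rewrite addnA leq_addr.
Qed.

Lemma backward_ge0 n m f : (forall w, 0 <= f w) -> forall w, 0 <= backward n m f w.
Proof. by elim: m n f => [|m IH] n f f0 w//=; apply: extend_ge0 => ?; exact: IH. Qed.

Lemma measurable_backward n m f : measurable_fun [set: traj] f ->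
  (forall w, 0 <= f w) -> measurable_fun [set: traj] (backward n m f).
Proof.
elim: m n f => [|m IH] n f mf f0//=.
by apply: measurable_extend; [exact: IH|exact: backward_ge0].
Qed.

Lemma backward_le n m f g : measurable_fun [set: traj] f ->
  measurable_fun [set: traj] g -> (forall w, 0 <= f w) ->
  (forall w, f w <= g w) -> forall w, backward n m f w <= backward n m g w.
Proof.
move=> mf mg f0 fg; have g0 w : 0 <= g w by exact: le_trans (fg w).
elim: m n => [|m IH] n w//=; apply: extend_le => //.
- exact: measurable_backward.
- exact: measurable_backward.
- exact: backward_ge0.
Qed.

Lemma backward1 n m : backward n m (cst 1) = cst 1.
Proof. by elim: m n => //= m IH n; rewrite IH extend_depends. Qed.

(** The law of a trajectory whose coordinates below n have been drawn while the later ones are still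
    those of [point]. *)
Fixpoint marginal n : giry traj R :=
  if n is n'.+1 then giry_bind (marginal n') (mkappa n') else giry_ret point.

Lemma int_marginalS n f : measurable_fun [set: traj] f -> (forall w, 0 <= f w) ->
  \int[marginal n.+1]_w f w = \int[marginal n]_w extend n f w.
Proof.
move=> mf f0; rewrite -[LHS]/(giry_int _ f) giry_int_bind//.
by apply: eq_integral => w _; exact: int_kappa.
Qed.

Lemma int_marginal_backward n m f : measurable_fun [set: traj] f ->
  (forall w, 0 <= f w) ->
  \int[marginal (n + m)]_w f w = \int[marginal n]_w backward n m f w.
Proof.
move=> mf f0; elim: m n => [|m IH] n; first by rewrite addn0.
rewrite -addSnnS IH int_marginalS//; [exact: measurable_backward|exact: backward_ge0].
Qed.

Lemma marginal_backward m f : measurable_fun [set: traj] f ->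
  (forall w, 0 <= f w) -> \int[marginal m]_w f w = backward 0 m f point.
Proof.
move=> mf f0; rewrite -[m]add0n int_marginal_backward// -[LHS]/(giry_int _ _).
by rewrite giry_int_ret//; exact: measurable_backward.
Qed.

Lemma marginal_stable n m (A : set traj) : measurable A -> determined n A ->
  (n <= m)%N -> marginal m A = marginal n A.
Proof.
move=> mA dA nm; rewrite -(setIT A) -!integral_indic//.
have mI : measurable_fun [set: traj] (EFin \o \1_A : traj -> \bar R).
  by apply/measurable_EFinP; exact: measurable_indic.
rewrite -(subnKC nm) !marginal_backward//; try by move=> w; rewrite lee_fin.
by rewrite backward_stable//; exact: depends_indic.
Qed.

Lemma backward_indic_le1 n m (A : set traj) w : measurable A ->
  backward n m (EFin \o \1_A) w <= 1.
Proof.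
move=> mA; rewrite -[leRHS]/((cst 1 : traj -> \bar R) w) -(backward1 n m).
apply: backward_le => // [|v|v].
- by apply/measurable_EFinP; exact: measurable_indic.
- by rewrite lee_fin.
- by rewrite lee_fin indicE; case: (v \in A).
Qed.

Section continuity.
Variables (B : nat -> set traj) (N : nat -> nat).
Hypothesis mB : forall k, measurable (B k).
Hypothesis dB : forall k, determined (N k) (B k).
Hypothesis decB : forall k, B k.+1 `<=` B k.
Hypothesis B0 : \bigcap_k B k = set0.

Let ind k : traj -> \bar R := EFin \o \1_(B k).
Let mind k : measurable_fun [set: traj] (ind k).
Proof. by apply/measurable_EFinP; exact: measurable_indic. Qed.
Let ind0 k w : 0 <= ind k w. Proof. by rewrite lee_fin. Qed.

(** The truncated difference is deliberate: if the first n coordinates already determine B k, no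
    step remains and this is the indicator. *)
Let cond n k : traj -> \bar R := backward n (N k - n) (ind k).

Let condE n m k : (N k <= n + m)%N -> cond n k = backward n m (ind k).
Proof.
move=> Nk; have h : (N k - n <= m)%N by rewrite leq_subLR.
rewrite -(subnKC h) backward_stable//.
apply: (@depends_le _ _ _ (N k)); last exact: depends_indic.
by rewrite -leq_subLR.
Qed.

Let cond_dec n w : {homo (fun k => cond n k w) : k l / (k <= l)%N >-> l <= k}.
Proof.
move=> k l kl; pose m := maxn (N k) (N l).
rewrite (@condE n m k) ?(@condE n m l) ?(leq_trans _ (leq_addl _ _)) ?leq_maxl ?leq_maxr//.
apply: backward_le => // v; rewrite lee_fin !indicE ler_nat.
case: (boolP (v \in B l)) => //; rewrite inE => Bl.
suff : (v \in B k) by move=> ->.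
rewrite inE; move: Bl; rewrite -(subnKC kl); elim: (l - k)%N => [|j IH]; first by rewrite addn0.
by rewrite addnS => /decB/IH.
Qed.

Let cond_extend n k : cond n k = extend n (cond n.+1 k).
Proof.
rewrite [cond n.+1 k](@condE _ (N k)) ?leq_addl// (@condE n (N k).+1)//.
by rewrite (leq_trans _ (leq_addl _ _)).
Qed.

Let mcond n k : measurable_fun [set: traj] (cond n k).
Proof. exact: measurable_backward. Qed.

Let cond0 n k w : 0 <= cond n k w. Proof. exact: backward_ge0. Qed.

Let cond1 n k w : cond n k w <= 1. Proof. exact: backward_indic_le1. Qed.

Let limit n w := ereal_inf (range (fun k => cond n k w)).

Let cvg_limit n w : (fun k => cond n k w) @ \oo --> limit n w.
Proof. exact: ereal_nonincreasing_cvgn (@cond_dec n w). Qed.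

Let limit_extend n w : limit n w = \int[K n w]_s limit n.+1 (update n (w, s)).
Proof.
have h : (fun k => \int[K n w]_s cond n.+1 k (update n (w, s))) @ \oo -->
    \int[K n w]_s limit n.+1 (update n (w, s)).
  apply: (@dominated_cvg _ _ _ _ _ measurableT _ _ (cst 1)) => //.
  - by move=> k; exact: measurable_section.
  - apply/integrableP; split => //; rewrite (eq_integral (cst 1))//; last first.
      by move=> s _; rewrite /= normr1.
    by rewrite integral_cst// mul1e [X in X < _]K1 ltry.
  - by move=> k s _; rewrite gee0_abs ?cond1//.
transitivity (limn (fun k => cond n k w)); first exact/esym/cvg_lim.
rewrite (_ : (fun k => _) = (fun k => \int[K n w]_s cond n.+1 k (update n (w, s)))).
  exact: cvg_lim.
by apply/funext => k; rewrite cond_extend.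
Qed.

(* If the conditional probabilities of the [B k] did not tend to 0, some state
   would keep them away from 0 for one more step; iterating this choice builds
   a point of the empty intersection. *)
Let choice n (w : traj) : S := xget point [set s | 0 < limit n.+1 (update n (w, s))].

Let choiceP n w : 0 < limit n w -> 0 < limit n.+1 (update n (w, choice n w)).
Proof.
move=> lnw; rewrite /choice; case: xgetP => [s _ //|none].
exfalso; move: lnw; rewrite limit_extend integral0_eq ?ltxx// => s _.
apply/eqP; rewrite eq_le leNgt; apply/andP; split; first exact/negP/none.
by apply: le_ereal_inf_tmp => _ [k _ <-].
Qed.

Fixpoint branch n : traj :=
  if n is n'.+1 then update n' (branch n', choice n' (branch n')) else point.

Let branch_limit n : 0 < limit 0 point -> 0 < limit n (branch n).
Proof. by move=> l0; elim: n => //= n; exact: choiceP. Qed.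

Let branch_stable n m i : (i < n)%N -> (n <= m)%N -> branch m i = branch n i.
Proof.
move=> ni; elim: m => [|m IH]; first by rewrite leqn0 => /eqP n0; rewrite n0 in ni.
rewrite leq_eqVlt => /predU1P[->//|]; rewrite ltnS => nm /=.
by rewrite update_lt ?IH// (leq_trans ni).
Qed.

(** This is continuity at the empty set, the source of countable additivity. The diagonal of
    [branch] agrees with [branch (N k)] on the coordinates that determine B k, and the indicator is
    positive there. *)
Lemma limit_backward_eq0 : (fun k => backward 0 (N k) (ind k) point) @ \oo --> 0.
Proof.
have -> : (fun k => backward 0 (N k) (ind k) point) = (fun k => cond 0 k point).
  by apply/funext => k; rewrite (@condE 0 (N k)).
suff -> : 0 = limit 0 point by exact: cvg_limit.
apply/esym/eqP; rewrite eq_le leNgt; apply/andP; split; last first.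
  by apply: le_ereal_inf_tmp => _ [k _ <-].
apply/negP => /branch_limit lim0.
pose w : traj := fun i => branch i.+1 i.
have : (\bigcap_k B k) w.
  move=> k _; have : 0 < ind k (branch (N k)).
    apply: lt_le_trans (lim0 (N k)) _; apply: ereal_inf_lbound; exists k => //.
    by rewrite (@condE _ 0)// addn0.
  rewrite /ind /= lte_fin indicE; case: (boolP (_ \in _)); last by rewrite ltxx.
  rewrite inE => Bk _; rewrite (dB (w := w) (w' := branch (N k)))// => i iN.
  by rewrite /w (branch_stable _ iN).
by rewrite B0.
Qed.

End continuity.

Definition rank (A : set (cylinder_algebra S)) : nat :=
  xget 0%N [set n | determined n (A : set traj)].

Lemma rankP (A : set (cylinder_algebra S)) : measurable A -> determined (rank A) A.
Proof.
move=> /cylinder_measurableE[_ [n dA]]; rewrite /rank.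
by case: xgetP => // /(_ n).
Qed.

Definition premeasure (A : set (cylinder_algebra S)) : \bar R := marginal (rank A) A.

Lemma premeasureE n (A : set (cylinder_algebra S)) : measurable A ->
  determined n (A : set traj) -> premeasure A = marginal n A.
Proof.
move=> mA dA; have mA' := (cylinder_measurableE A).1 mA.
rewrite /premeasure -(@marginal_stable (rank A) (maxn (rank A) n)) ?leq_maxl//; last 2 first.
- exact: mA'.1.
- exact: rankP.
by rewrite (@marginal_stable n) ?leq_maxr//; exact: mA'.1.
Qed.

Let premeasure0 : premeasure set0 = 0. Proof. exact: measure0. Qed.

Let premeasure_ge0 A : 0 <= premeasure A. Proof. exact: measure_ge0. Qed.

Let premeasureU (A B : set (cylinder_algebra S)) : measurable A -> measurable B ->
  A `&` B = set0 -> premeasure (A `|` B) = premeasure A + premeasure B.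
Proof.
move=> mA mB AB0; have mAB := measurableU _ _ mA mB.
pose n := maxn (rank A) (rank B).
have dA : determined n (A : set traj).
  by apply: depends_le (rankP mA); rewrite leq_maxl.
have dB : determined n (B : set traj).
  by apply: depends_le (rankP mB); rewrite leq_maxr.
have dAB : determined n (A `|` B : set traj).
  by move=> w w' ww'; rewrite /setU /mkset (dA w w') ?(dB w w').
rewrite !(@premeasureE n)// measureU//.
- exact: ((cylinder_measurableE A).1 mA).1.
- exact: ((cylinder_measurableE B).1 mB).1.
Qed.

Let premeasure_semi_sigma_additive : semi_sigma_additive premeasure.
Proof.
move=> F mF tF mUF.
(* The tails of the union decrease to the empty set by disjointness; their premeasures are the gaps
   between the partial sums and the whole. *)
pose B n := \bigcup_(i in [set i | (n <= i)%N]) F i.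
have BS n : B n = F n `|` B n.+1.
  apply/seteqP; split => w.
    move=> [i /=]; rewrite leq_eqVlt => /predU1P[->|ni] Fi; [by left|by right; exists i].
  by move=> [Fw|[i /= ni Fi]]; [exists n => //=|exists i => //=; exact: ltnW].
have FB n : F n `&` B n.+1 = set0.
  apply/seteqP; split => // w [Fw [i /= ni Fi]].
  by move: ni; rewrite (tF n i I I) ?ltnn//; exists w.
have mB n : measurable (B n).
  elim: n => [|n IH].
    rewrite (_ : B 0%N = \bigcup_n F n)//.
    by apply/seteqP; split => w [i _ Fi]; exists i.
  rewrite (_ : B n.+1 = B n `\` F n); first exact: measurableD.
  rewrite [in RHS]BS setDUl setDv set0U; apply/esym/setDidPl.
  by rewrite setIC.
have B0 : B 0%N = \bigcup_n F n.
  by apply/seteqP; split => w [i _ Fi]; exists i.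
have fin A : measurable A -> premeasure A \is a fin_num.
  move=> mA; apply: fin_num_measure; exact: ((cylinder_measurableE A).1 mA).1.
have sumE n : \sum_(0 <= i < n) premeasure (F i) = premeasure (\bigcup_n F n) - premeasure (B n).
  elim: n => [|n IH]; first by rewrite big_nil B0 subee// fin// -B0.
  rewrite big_nat_recr//= IH (BS n) premeasureU// fin_num_oppeD ?fin//.
  by rewrite addeAC addeA addeK// fin.
have cB : (fun n => premeasure (B n)) @ \oo --> 0; last first.
  rewrite (_ : (fun n => _) = (fun n => premeasure (\bigcup_n F n) - premeasure (B n))).
    rewrite -[premeasure (\bigcup_n F n) in X in _ --> X]sube0.
    by apply: cvgeB => //; [rewrite fin_num_adde_defl|exact: cvg_cst].
  exact/funext.
have := @limit_backward_eq0 B (fun k => rank (B k)).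
have -> : (fun k => backward 0 (rank (B k)) (EFin \o \1_(B k)) point) = (fun k => premeasure (B k)).
  apply/funext => k; have mBk := ((cylinder_measurableE _).1 (mB k)).1.
  have -> : premeasure (B k) = \int[marginal (rank (B k))]_w (\1_(B k) w)%:E.
    by rewrite integral_indic// setIT.
  rewrite marginal_backward//.
  by apply/measurable_EFinP; exact: measurable_indic.
apply => //.
- by move=> k; exact: ((cylinder_measurableE _).1 (mB k)).1.
- by move=> k; exact: rankP.
- by move=> k w [i /= ki Fi]; exists i => //=; exact: ltnW.
- apply/seteqP; split => // w Bw; have [i _ Fi] := Bw 0%N I.
  have [j /= ij Fj] := Bw i.+1 I.
  by move: ij; rewrite (tF i j I I) ?ltnn//; exists w.
Qed.

HB.instance Definition _ := isMeasure.Build _ (cylinder_algebra S) R premeasure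
  premeasure0 premeasure_ge0 premeasure_semi_sigma_additive.

Definition path_measure (A : set traj) : \bar R :=
  measure_extension (premeasure : {measure set (cylinder_algebra S) -> \bar R}) A.

Let measurable_sub (A : set traj) : measurable A ->
  measurable (A : set (g_sigma_algebraType (@measurable _ (cylinder_algebra S)))).
Proof.
move: A; apply: smallest_sub; first exact: sigma_algebra_measurable.
move=> _ [n [E [mE ->]]]; apply: sub_sigma_algebra.
apply/cylinder_measurableE; split; first by apply: sub_sigma_algebra; exists n, E.
by exists n.+1 => w w' ww'; rewrite /mkset ww'.
Qed.

Let path_measure0 : path_measure set0 = 0. Proof. exact: measure0. Qed.

Let path_measure_ge0 A : 0 <= path_measure A. Proof. exact: measure_ge0. Qed.

Let path_measure_semi_sigma_additive : semi_sigma_additive path_measure.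
Proof.
move=> F mF tF mUF; apply: measure_semi_sigma_additive => //.
- by move=> i; exact: measurable_sub.
- exact: measurable_sub.
Qed.

HB.instance Definition _ := isMeasure.Build _ traj R path_measure
  path_measure0 path_measure_ge0 path_measure_semi_sigma_additive.

Lemma path_measureE n (A : set traj) : measurable A -> determined n A ->
  path_measure A = marginal n A.
Proof.
move=> mA dA; have mA' : measurable (A : set (cylinder_algebra S)).
  by apply/cylinder_measurableE; split => //; exists n.
by rewrite /path_measure /measure_extension measurable_mu_extE//; exact: premeasureE.
Qed.

Lemma path_measureT : path_measure setT = 1.
Proof.
by rewrite (@path_measureE 0%N)//= /giry_ret diracT.
Qed.

(** A function of the first n coordinates factors through [truncate n], whose preimages are sets
    determined by n coordinates; on these both measures agree. *)
Lemma int_path_measure n f : measurable_fun [set: traj] f ->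
  (forall w, 0 <= f w) -> depends n f ->
  \int[path_measure]_w f w = \int[marginal n]_w f w.
Proof.
move=> mf f0 df.
have fE : f = f \o truncate n.
  by apply/funext => w /=; apply: df => i ni; rewrite /truncate ni.
have mt := @measurable_truncate _ S n.
rewrite fE -!(ge0_integral_pushforward mt _ (D := setT))//.
apply: eq_measure_integral => A mA _; apply: path_measureE.
  by rewrite -[X in measurable X]setTI; exact: mt.
move=> w w' ww'; rewrite /preimage /mkset; congr (A _).
by apply/funext => i; rewrite /truncate; case: ifPn => // /ww'.
Qed.

Lemma int_path_measure_extend n f : measurable_fun [set: traj] f ->
  (forall w, 0 <= f w) -> depends n.+1 f ->
  \int[path_measure]_w f w = \int[path_measure]_w extend n f w.
Proof.
move=> mf f0 df; rewrite (@int_path_measure n.+1)// int_marginalS//.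
by rewrite (@int_path_measure n)//; [exact: measurable_extend|exact: extend_ge0|exact: depends_extend].
Qed.

End ionescu_tulcea.

Section probability_giry.
Context d (T : measurableType d) (R : realType).
Variables (mu : {measure set T -> \bar R}) (mu1 : mu setT <= 1).

Definition giry_fun (B : set T) : \bar R := mu B.

Let giry_fun0 : giry_fun set0 = 0. Proof. exact: measure0. Qed.
Let giry_fun_ge0 B : 0 <= giry_fun B. Proof. exact: measure_ge0. Qed.
Let giry_fun_semi_sigma_additive : semi_sigma_additive giry_fun.
Proof. exact: measure_semi_sigma_additive. Qed.

HB.instance Definition _ := isMeasure.Build _ T R giry_fun
  giry_fun0 giry_fun_ge0 giry_fun_semi_sigma_additive.

HB.instance Definition _ := Measure_isSubProbability.Build _ T R giry_fun mu1.

Definition giry_of : giry T R := giry_fun.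

End probability_giry.

Section pker_giry.
Context d d' (T : measurableType d) (U : measurableType d') (R : realType).
Variable k : R.-pker T ~> U.

Let pker_le1 t : k t setT <= 1. Proof. by rewrite prob_kernel. Qed.

Definition pker_giry (t : T) : giry U R := giry_of (pker_le1 t).

Lemma measurable_pker_giry : measurable_fun [set: T] pker_giry.
Proof. by apply: measurable_giry_codensity => // B mB; exact: measurable_kernel. Qed.

End pker_giry.

(** * Existence of the law of a strategy *)

Section law_existence.
Context (R : realType) (X A : ptopologicalType) (J : nat).
Variable M : impulse_model R X A J.
Hypothesis mnext : measurable_fun [set: step R X A]
  (fun z : step R X A => Defs.next M z.1 z.2).
Variables (pi : strategy R X A) (x : state X).

(** As transitions are deterministic, the state at step n is a function of step n - 1. Coordinate n
    can thus be drawn, state and action together, by a kernel that reads only earlier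
    coordinates. *)
Let state_at n (w : trajectory R X A) : state X :=
  if n is m.+1 then Defs.next M (w m).1 (w m).2 else x.

Let past n (w : trajectory R X A) : history R X A n :=
  ([tuple w i | i < n], state_at n w).

Let mstate_at n : measurable_fun [set: trajectory R X A] (state_at n).
Proof.
case: n => [|n]; first exact: measurable_cst.
exact: (measurableT_comp mnext (measurable_coordinate n)).
Qed.

Let mtuple n : measurable_fun [set: trajectory R X A]
  (fun w : trajectory R X A => [tuple w i | i < n] : n.-tuple (step R X A)).
Proof.
apply/measurable_fun_tnthP => i; rewrite (_ : (_ \o _)%FUN = fun w : trajectory R X A => w i).
  exact: measurable_coordinate.
by apply/funext => w /=; rewrite tnth_mktuple.
Qed.

Let mpast n : measurable_fun [set: trajectory R X A] (past n).
Proof. by apply: measurable_fun_pair => //; exact: mtuple. Qed.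

Lemma measurable_hist n : measurable_fun [set: trajectory R X A] (@hist R X A n).
Proof.
apply: measurable_fun_pair; first exact: mtuple.
exact: (measurableT_comp measurable_fst (measurable_coordinate n)).
Qed.

Let K n (w : trajectory R X A) : giry (step R X A) R :=
  giry_prod (giry_ret (state_at n w), pker_giry (pi n) (past n w)).

Let mK n : measurable_fun [set: trajectory R X A] (K n).
Proof.
apply: (measurableT_comp measurable_giry_prod).
apply: measurable_fun_pair.
  exact: (measurableT_comp measurable_giry_ret (mstate_at n)).
apply: (@measurableT_comp _ _ _ _ _ _ (pker_giry (pi n)) _ (past n)).
  exact: measurable_pker_giry.
exact: mpast.
Qed.

Let int_K n w (g : step R X A -> \bar R) : measurable_fun [set: step R X A] g ->
  (forall s, 0 <= g s) ->
  \int[K n w]_s g s = \int[pi n (past n w)]_b g (state_at n w, b).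
Proof.
move=> mg g0; rewrite -[LHS]/(giry_int (K n w) g) giry_int_prod1// giry_int_ret//.
exact: (@measurable_fun_fubini_tonelli_F _ _ _ _ _ (pker_giry (pi n) (past n w)) _ mg g0).
Qed.

Let K1 n w : K n w setT = 1.
Proof.
have -> : K n w setT = \int[K n w]_s (cst 1 s) by rewrite integral_cst// mul1e.
by rewrite int_K//= integral_cst// prob_kernel mule1.
Qed.

Let adaptedK n : depends n (K n).
Proof.
move=> w w' ww'.
have e1 : state_at n w = state_at n w'.
  by case: n ww' => //= n ww'; rewrite ww'.
have e2 : past n w = past n w'.
  rewrite /past e1; congr pair; apply: eq_from_tnth => i.
  by rewrite !tnth_mktuple ww'.
by rewrite /K e1 e2.
Qed.

Let extendE n f w : measurable_fun [set: trajectory R X A] f ->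
  (forall w, 0 <= f w) ->
  extend K n f w = \int[pi n (past n w)]_b f (update n (w, (state_at n w, b))).
Proof.
by move=> mf f0; rewrite /extend int_K//; exact: measurable_section.
Qed.

Let hist_update n w b : hist n (update n (w, (state_at n w, b))) = past n w.
Proof.
rewrite /hist /past {2}/update eqxx /=; congr pair; apply: eq_from_tnth => i.
by rewrite !tnth_mktuple update_lt.
Qed.

Let P : {measure set (trajectory R X A) -> \bar R} :=
  path_measure mK K1.

(** Each clause of [has_law] reduces to this form: given the earlier steps, only the action of the
    last step is still random. *)
Let P_extend n (B : set (trajectory R X A)) (g : trajectory R X A -> \bar R) :
  measurable B -> determined n.+1 B ->
  (forall w, \int[pi n (past n w)]_b (\1_B (update n (w, (state_at n w, b))))%:E = g w) ->
  P B = \int[P]_w g w.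
Proof.
move=> mB dB Bg.
have mI : measurable_fun [set: trajectory R X A] (EFin \o \1_B : _ -> \bar R).
  by apply/measurable_EFinP; exact: measurable_indic.
have I0 w : 0 <= (EFin \o \1_B : _ -> \bar R) w by rewrite lee_fin.
rewrite -[in LHS](setIT B) -integral_indic//.
rewrite (int_path_measure_extend mK K1 adaptedK mI I0 (depends_indic R dB)).
by apply: eq_integral => w _; rewrite extendE.
Qed.

(** The recorded state (w n).1 is P-almost surely the computed one, since coordinate n is drawn that
    way. *)
Let int_P n (g : history R X A n -> \bar R) :
  measurable_fun [set: history R X A n] g -> (forall h, 0 <= g h) ->
  \int[P]_w g (hist n w) = \int[P]_w g (past n w).
Proof.
move=> mg g0.
have mgh : measurable_fun [set: trajectory R X A] (g \o @hist R X A n).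
  exact: (measurableT_comp mg (@measurable_hist n)).
rewrite -[LHS]/(\int[P]_w (g \o hist n) w).
rewrite (@int_path_measure_extend _ _ _ K mK K1 adaptedK n _ mgh)//; last first.
  move=> w w' ww' /=; congr g; rewrite /hist ww'//; congr pair.
  by apply: eq_from_tnth => i; rewrite !tnth_mktuple ww'// (ltn_trans (ltn_ord i)).
  by move=> w; exact: g0.
apply: eq_integral => w _; rewrite extendE//=.
rewrite (eq_integral (cst (g (past n w)))); last by move=> b _; rewrite hist_update.
by rewrite integral_cst// prob_kernel mule1.
Qed.

Lemma has_law_exists : exists P0, has_law M pi x P0.
Proof.
exists P; split.
- exact: path_measureT.
- move=> E mE; set B := [set _ | _].
  have mB : measurable B.
    have := measurableT_comp measurable_fst (@measurable_coordinate _ (step R X A) 0%N).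
    by move=> /(_ measurableT E mE); rewrite setTI.
  rewrite (@P_extend 0%N B (cst (\d_x E)))//.
  + by rewrite integral_cst// [X in _ * X]path_measureT mule1.
  + by move=> w w' ww'; rewrite /B /mkset ww'.
  + move=> w; rewrite (eq_integral (cst (\d_x E))).
      by rewrite integral_cst// prob_kernel mule1.
    by move=> b _; rewrite diracE !indicE; congr (nat_of_bool _)%:R%:E; apply/idP/idP; rewrite !inE.
- move=> n D E mD mE; set B := [set _ | _].
  pose g (h : history R X A n) := (\1_D h)%:E * pi n h E.
  have mg : measurable_fun [set: history R X A n] g.
    apply: emeasurable_funM; last exact: measurable_kernel.
    by apply/measurable_EFinP; exact: measurable_indic.
  have g0 h : 0 <= g h by rewrite mule_ge0// lee_fin.
  have -> : \int[P]_(w in [set w | D (hist n w)]) pi n (hist n w) E =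
      \int[P]_w g (hist n w).
    rewrite [LHS]integral_mkcond; apply: eq_integral => w _.
    rewrite patchE /g indicE.
    have -> : (w \in [set w0 | D (hist n w0)]) = (hist n w \in D).
      by apply/idP/idP; rewrite !inE.
    by case: (_ \in D); rewrite ?mul1e ?mul0e.
  rewrite int_P//; apply: (@P_extend n).
  + have mD' := @measurable_hist n measurableT D mD.
    have mE' := measurableT_comp measurable_snd (@measurable_coordinate _ (step R X A) n).
    by move: (measurableI _ _ mD' (mE' measurableT E mE)); rewrite !setTI.
  + move=> w w' ww'; rewrite /B /mkset ww'//.
    suff -> : hist n w = hist n w' by [].
    rewrite /hist ww'//; congr pair.
    by apply: eq_from_tnth => i; rewrite !tnth_mktuple ww'// (ltn_trans (ltn_ord i)).
  + move=> w; rewrite /g.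
    rewrite (eq_integral (fun b => (\1_D (past n w))%:E * (\1_E b)%:E)); last first.
      move=> b _; rewrite -EFinM !indicE -natrM mulnb; congr (nat_of_bool _)%:R%:E.
      apply/idP/idP; rewrite !inE.
        move=> [Dp Eb]; apply/andP; rewrite !inE; split.
          by rewrite -(hist_update n w b); exact: Dp.
        by move: Eb; rewrite /update eqxx.
      move=> /andP[]; rewrite !inE -(hist_update n w b) => Dp Eb.
      by split; [exact: Dp|rewrite /update eqxx].
    rewrite ge0_integralZl ?lee_fin//.
    * by rewrite integral_indic// setIT.
    * by apply/measurable_EFinP; exact: measurable_indic.
- move=> n D E mD mE; set B := [set _ | _].
  have -> : \int[P]_(w in [set w | D (hist n w, (w n).2)]) transition M (w n).1 (w n).2 E =
      \int[P]_w ((\1_D (hist n w, (w n).2))%:E * (\1_E (state_at n.+1 w))%:E).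
    rewrite [LHS]integral_mkcond; apply: eq_integral => w _.
    rewrite patchE (_ : transition M (w n).1 (w n).2 E = (\1_E (state_at n.+1 w))%:E)// !indicE.
    have -> : (w \in [set w | D (hist n w, (w n).2)]) = ((hist n w, (w n).2) \in D).
      by apply/idP/idP; rewrite !inE.
    by case: (_ \in D); rewrite ?mul1e ?mul0e.
  apply: (@P_extend n.+1).
  + have mD' : measurable [set w | D (hist n w, (w n).2)].
      have := measurable_fun_pair (@measurable_hist n)
        (measurableT_comp measurable_snd (@measurable_coordinate _ (step R X A) n)).
      by move=> /(_ measurableT D mD); rewrite setTI.
    have mE' := measurableT_comp measurable_fst (@measurable_coordinate _ (step R X A) n.+1).
    by move: (measurableI _ _ mD' (mE' measurableT E mE)); rewrite setTI.
  + move=> w w' ww'; rewrite /B /mkset ww'// ww'//.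
    suff -> : hist n w = hist n w' by [].
    rewrite /hist ww'//; congr pair.
    apply: eq_from_tnth => i; rewrite !tnth_mktuple ww'//.
    by rewrite ltnS ltnW// ltnS ltnW.
  + move=> w; rewrite (eq_integral (cst ((\1_D (hist n w, (w n).2))%:E * (\1_E (state_at n.+1 w))%:E))).
      by rewrite integral_cst// prob_kernel mule1.
    move=> b _; rewrite -EFinM !indicE -natrM mulnb; congr (nat_of_bool _)%:R%:E.
    have hE : hist n (update n.+1 (w, (state_at n.+1 w, b))) = hist n w.
      rewrite /hist update_lt//; congr pair.
      apply: eq_from_tnth => i; rewrite !tnth_mktuple update_lt//.
      by rewrite ltnS ltnW.
    apply/idP/idP; rewrite !inE.
      move=> []; rewrite hE update_lt// /update eqxx => Dp Eb.
      by apply/andP; rewrite !inE.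
    move=> /andP[]; rewrite !inE => Dp Eb; split; last by rewrite /update eqxx.
    by rewrite hE update_lt.
Qed.

Lemma lawP : has_law M pi x (law M pi x).
Proof.
rewrite /law; case: pselect => [h|/(_ has_law_exists)//].
by case: (cid h).
Qed.

End law_existence.

(** * Countable bases and the topology of the model *)

Definition countable_base (T : topologicalType) : Prop :=
  exists e : nat -> set T, (forall n, open (e n)) /\
    forall x U, nbhs x U -> exists n, e n x /\ e n `<=` U.

Section countable_base.

Lemma countable_baseP (T : topologicalType) (I : countType) (e : I -> set T) :
  (forall i, open (e i)) ->
  (forall x U, nbhs x U -> exists i, e i x /\ e i `<=` U) -> countable_base T.
Proof.
move=> oe eb; exists (fun n => oapp e set0 (unpickle n)); split.
  by move=> n; case: unpickle => [i|]//=; exact: open0.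
by move=> x U /eb[i [ei eU]]; exists (pickle i); rewrite pickleK.
Qed.

Lemma countable_base_prod (T U : topologicalType) :
  countable_base T -> countable_base U -> countable_base (T * U)%type.
Proof.
move=> [e [oe eb]] [f [of_ fb]].
apply: (@countable_baseP _ (nat * nat)%type (fun ij => e ij.1 `*` f ij.2)).
  move=> [i j] /=; rewrite openE => -[x y] [/= ex fy].
  by exists (e i, f j) => //; split => /=; apply: open_nbhs_nbhs.
move=> [x y] W [[V1 V2] /= [/eb[i [ei eV]] /fb[j [fj fV]]] VW].
by exists (i, j); split => //= z [/= /eV ? /fV ?]; exact: VW.
Qed.

Lemma countable_base_initial (T U : topologicalType) (f : T -> U) :
  continuous f -> (forall x V, nbhs x V -> exists2 W, nbhs (f x) W & f @^-1` W `<=` V) ->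
  countable_base U -> countable_base T.
Proof.
move=> cf fW [e [oe eb]]; exists (fun n => f @^-1` e n); split.
  by move=> n; apply: open_comp => // x _; exact: cf.
move=> x V /fW[W /eb[n [en eW]] WV]; exists n; split => // y /eW; exact: WV.
Qed.

Lemma countable_base_separable (R : realType) (T : pseudoMetricType R) (D : set T) :
  countable D -> dense D -> countable_base T.
Proof.
move=> /pfcard_geP[D0|[f]] dD.
  have e0 (x : T) : False.
    by have [] := dD setT (ex_intro _ x I) openT; rewrite D0 => y [].
  by exists (fun=> set0); split => [n|x]; [exact: open0|have := e0 x].
apply: (@countable_baseP _ (nat * nat)%type
  (fun ij => (ball (f ij.1) (ij.2.+1%:R^-1 : R))^°)).
  by move=> ij; exact: open_interior.
move=> x U /nbhs_ballP[r /= r0 rU].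
have [n nr] : exists n : nat, (n.+1%:R^-1 < r / 2)%R.
  by have [n nr] := @ltr_add_invr _ 0%R (r / 2)%R (divr_gt0 r0 (ltr0n _ 2)); exists n; rewrite add0r in nr.
have n2 : (0 < n.+1%:R^-1 / 2 :> R)%R by rewrite divr_gt0// invr_gt0 ltr0n.
have [||y [yx Dy]] := dD (ball x (n.+1%:R^-1 / 2))^°.
- by exists x; apply: nbhs_singleton; apply: nbhs_interior; exact: nbhsx_ballx.
- exact: open_interior.
have [m _ fm] := @surj _ _ _ _ f y Dy.
have {}yx := interior_subset yx.
exists (m, n); split => /=.
  rewrite fm; apply/nbhs_ballP; exists (n.+1%:R^-1 / 2)%R => // z xz.
  by rewrite [n.+1%:R^-1%R](splitr _); apply: ball_triangle xz; exact: ball_sym.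
rewrite fm => z /interior_subset yz; apply: rU.
have : ball x (n.+1%:R^-1 / 2 + n.+1%:R^-1)%R z by exact: ball_triangle yz.
apply: le_ball; move: nr n2; set a := (_^-1)%R => ? ?; lra.
Qed.

Lemma countable_base_nbhs (T : topologicalType) (x : T) : countable_base T ->
  exists V : nat -> set T, (forall n, nbhs x (V n)) /\
    forall U, nbhs x U -> exists n, forall m, (n <= m)%N -> V m `<=` U.
Proof.
move=> [e [oe eb]].
pose V n := \bigcap_(i in [set i | (i < n)%N /\ e i x]) e i.
exists V; split.
  move=> n; elim: n => [|n IH].
    by apply: filterS filterT => y _ i [].
  have [ex|ex] := pselect (e n x).
    have : nbhs x (V n `&` e n) by apply: filterI => //; exact: open_nbhs_nbhs.
    apply: filterS => y [Vy ey] i [/=]; rewrite ltnS leq_eqVlt => /predU1P[-> //|i_n ei].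
    by apply: Vy.
  apply: filterS IH => y Vy i [/=]; rewrite ltnS leq_eqVlt => /predU1P[-> //|i_n ei].
  by apply: Vy.
move=> U /eb[n [en eU]]; exists n.+1 => m nm y Vy; apply: eU.
by apply: Vy; split.
Qed.

(** With countable bases an open set is a countable union of open boxes, hence lies in the product
    sigma-algebra. This is how semicontinuous functions of a step become measurable. *)
Lemma measurable_open_prod3 (T U W : ptopologicalType) :
  countable_base T -> countable_base U -> countable_base W ->
  forall O : set (T * (U * W)), open O ->
  measurable (O : set (borel T * (borel U * borel W))).
Proof.
move=> [e [oe eb]] [f [of_ fb]] [g [og gb]] O oO.
have -> : O = \bigcup_(ijk in [set ijk : nat * nat * nat |
    e ijk.1.1 `*` (f ijk.1.2 `*` g ijk.2) `<=` O])
    (e ijk.1.1 `*` (f ijk.1.2 `*` g ijk.2)).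
  apply/seteqP; split; last by move=> z [ijk /= ijkO]; exact: ijkO.
  move=> [x [y z]] /= Oxyz.
  have : nbhs (x, (y, z)) O by exact: open_nbhs_nbhs.
  move=> [[V1 V23] /= [/eb[i [ei eV]] [[V2 V3] /= [/fb[j [fj fV]] /gb[k [gk gV]]] V23']] VO].
  exists (i, j, k) => //= -[x' [y' z']] /= [ex [fy gz]].
  by apply: VO; split; [exact: eV|apply: V23'; split; [exact: fV|exact: gV]].
rewrite bigcup_mkcond; apply: countable_bigcupT_measurable; first exact: countableP.
move=> ijk; case: ifP => _; last exact: measurable0.
by apply: measurableX; [|apply: measurableX]; exact: sub_sigma_algebra.
Qed.

End countable_base.

(** Prepares for Fatou's lemma, which speaks of sequences: a countable neighbourhood base turns a
    failure of the bound into a sequence violating it. *)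
Lemma liminf_ge_sequential (R : realType) (T : topologicalType) (x : T)
    (f : T -> \bar R) (l : \bar R) : countable_base T ->
  (forall u : nat -> T, u @ \oo --> x -> liminf_ge \oo (f \o u) l) ->
  liminf_ge (nbhs x) f l.
Proof.
move=> bT seqf a al; apply: contrapT => notnear.
have [V [xV VU]] := countable_base_nbhs x bT.
have pick n : exists y, V n y /\ f y <= a%:E.
  apply: contrapT => none; apply: notnear; apply: filterS (xV n) => y Vy.
  by rewrite ltNge; apply/negP => fy; apply: none; exists y.
have [u uP] := choice pick.
have ux : u @ \oo --> x.
  move=> U /VU[n nU]; exists n => // m /= nm; apply: nU nm _ _.
  exact: (uP m).1.
have [n _ nf] := seqf u ux a al.
by have := nf n (leqnn n); rewrite /= ltNge (uP n).2.
Qed.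

Lemma limn_einf_ge (R : realType) (u : nat -> \bar R) (l : \bar R) :
  (forall n, 0 <= u n) -> liminf_ge \oo u l -> l <= limn_einf u.
Proof.
move=> u0 lu; rewrite limn_einf_lim (cvg_lim _ (@cvg_einfs_sup _ u))//.
rewrite leNgt; apply/negP => sl.
have s0 : 0 <= ereal_sup (range (einfs u)).
  apply: (@le_trans _ _ (einfs u 0%N)); last by apply: ereal_sup_ubound; exists 0%N.
  by apply: le_ereal_inf_tmp => _ [n _ <-].
have [a [sa al]] := ereal_between sl s0.
have [N _ Na] := lu a al.
move: sa; rewrite ltNge => /negP; apply.
apply: (@le_trans _ _ (einfs u N)); last by apply: ereal_sup_ubound; exists N.
by apply: le_ereal_inf_tmp => _ [n /= Nn <-]; apply: ltW; exact: Na.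
Qed.

Lemma le_limn_einf (R : realType) (u : nat -> \bar R) (l : \bar R) :
  l <= limn_einf u -> liminf_ge \oo u l.
Proof.
rewrite limn_einf_lim (cvg_lim _ (@cvg_einfs_sup _ u))// => lu a al.
have /ereal_sup_gt[_ [n _ <-] an] := lt_le_trans al lu.
exists n => // m /= nm; apply: lt_le_trans an _.
by apply: ereal_inf_lbound; exists m.
Qed.

Lemma nbhs_with_cemetery (X : topologicalType) (x : X) (U : set (with_cemetery X)) :
  nbhs (Some x : with_cemetery X) U <-> nbhs x (Some @^-1` U).
Proof.
rewrite !nbhsE; split.
  by move=> [V [oV Vx] VU]; exists (Some @^-1` V) => //; move=> y /VU.
move=> [V [oV Vx] VU]; exists (Some @` V).
  split; last by exists x.
  rewrite /open/= /with_cemetery_open (_ : _ @^-1` _ = V)//.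
  by apply/seteqP; split => y; [move=> [z Vz [<-]]|exists y].
by move=> _ [y /VU Uy <-].
Qed.

Lemma countable_base_cemetery (X : topologicalType) : countable_base X ->
  countable_base (with_cemetery X).
Proof.
move=> [e [oe eb]].
apply: (@countable_baseP (with_cemetery X) (option nat) (fun i =>
  if i is Some n then (Some @` e n : set (with_cemetery X)) else [set None])).
  case=> [n|]; rewrite /open/= /with_cemetery_open.
    rewrite (_ : _ @^-1` _ = e n)//.
    by apply/seteqP; split => y; [move=> [z ez [<-]]|exists y].
  rewrite (_ : _ @^-1` _ = set0); first exact: open0.
  by apply/seteqP; split.
case=> [x|] U.
  move=> /nbhs_with_cemetery/eb[n [en eU]]; exists (Some n); split; first by exists x.
  by move=> _ [y /eU Uy <-].
by move=> /nbhs_singleton U0; exists None; split => // _ ->.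
Qed.

Lemma countable_base_real (R : realType) : countable_base R.
Proof.
apply: (@countable_base_separable R R (range (ratr : rat -> R))).
  exact: card_le_trans (card_image_le _ _) (countableP _).
exact: dense_rat.
Qed.

(** * The one-point compactification of the half-line *)

Section extended_half_line.
Context (R : realType).
Local Notation time := (one_point_compactification (set_type (half_line R))).

Lemma nbhs_half_line (t : set_type (half_line R)) (V : set (set_type (half_line R))) :
  nbhs t V -> exists2 W, nbhs (set_val t : R) W & set_val @^-1` W `<=` V.
Proof.
rewrite nbhsE => -[_ [[W oW <-] Wt] WV]; exists W => //.
exact: open_nbhs_nbhs.
Qed.

Lemma continuous_half_line_val : continuous (set_val : set_type (half_line R) -> R).
Proof. exact: initial_continuous. Qed.

Lemma countable_base_half_line : countable_base (set_type (half_line R)).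
Proof.
apply: (countable_base_initial continuous_half_line_val nbhs_half_line).
exact: countable_base_real.
Qed.

Lemma compact_initial_segment (u : R) :
  compact (set_val @^-1` [set s : R | (s <= u)%R] : set (set_type (half_line R))).
Proof.
have max0 (s : R) : Num.max s 0%R \in half_line R.
  by rewrite inE /half_line /mkset le_max lexx orbT.
pose h (s : R) : set_type (half_line R) := exist _ (Num.max s 0%R) (max0 s).
have ch : continuous h.
  apply: continuous_comp_initial => s; rewrite (_ : _ \o _ = fun s => Num.max s 0%R)//.
  by apply: continuous_max; [exact: cvg_id|exact: cvg_cst].
rewrite (_ : _ @^-1` _ = h @` `[0%R, u]%classic).
  apply: continuous_compact; last exact: segment_compact.
  exact: continuous_subspaceT.
apply/seteqP; split => [t /= tu|_ [s /= + <-]]; last first.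
  by rewrite in_itv /= => /andP[s0 su]; rewrite /preimage /= set_valE /= ge_max su (le_trans s0).
have t0 : (0 <= set_val t)%R := set_valP t.
exists (set_val t); first by rewrite /= in_itv /= t0.
by apply: val_inj => /=; rewrite max_l.
Qed.

(** For natural u these sets of times form a neighbourhood base of the point at infinity. *)
Definition before (u : R) (th : time) : Prop :=
  if th is Some t then (u < set_val t)%R else True.

Lemma before_nbhs u th : before u th -> \forall th' \near th, before u th'.
Proof.
case: th => [t ut|_].
  have : \forall s \near (set_val t : R), (u < s)%R by exact: lt_nbhsr.
  by move=> /continuous_half_line_val.
exists (set_val @^-1` [set s : R | (s <= u)%R]).
  split.
    exact: compact_initial_segment.
  apply: preimage_closed; last exact: closed_le.
  by move=> t _; exact: continuous_half_line_val.
by move=> th' [[s /= us <-]|->//]; rewrite /before ltNge; exact/negP.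
Qed.

Lemma before_cofinal (U : set time) : nbhs (None : time) U ->
  exists n : nat, [set th | before n%:R th] `<=` U.
Proof.
move=> [K [cK _] KU].
have : compact (set_val @` K : set R).
  apply: continuous_compact => //; apply: continuous_subspaceT.
  exact: continuous_half_line_val.
move=> /compact_bounded [r [_ rK]].
pose r' := Num.max (r + 1)%R 0%R.
exists (Num.trunc r').+1 => -[t /= tn|_]; last by apply: KU; right.
apply: KU; left; exists t => // Kt.
have : (`|set_val t| <= r')%R.
  apply: rK; first by rewrite lt_max ltrDl ltr01.
  by exists t.
rewrite ger0_norm; last exact: (set_valP t).
have : (r' < (Num.trunc r').+1%:R)%R by rewrite truncnS_gt.
lra.
Qed.

Lemma countable_base_time : countable_base time.
Proof.
have [e [oe eb]] := countable_base_half_line.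
apply: (@countable_baseP time (nat + nat)%type (fun i => match i with
  | inl n => (Some @` e n : set time) | inr n => [set th : time | before n%:R th] end)).
  case=> n; first exact: one_point_compactification_open_some.
  by rewrite openE => th /= /before_nbhs.
case=> [t|] U.
  move=> /eb[n [en eU]]; exists (inl n); split; first by exists t.
  by move=> _ [y /eU Uy <-].
by move=> /before_cofinal[n nU]; exists (inr n).
Qed.

End extended_half_line.

(** * Topology and measurability of the transition map *)

Section model.
Context (R : realType) (X A : ptopologicalType) (J : nat).
Variable M : impulse_model R X A J.
Local Notation time := (one_point_compactification (set_type (half_line R))).

Lemma countable_base_borel_space (T : topologicalType) : borel_space R T -> countable_base T.
Proof.
move=> [P [B [[_ [D cD dD]] _ [f [g [fK gK cf cg]]]]]].
apply: (@countable_base_initial _ P (set_val \o f)).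
- move=> x; apply: continuous_comp; first exact: cf.
  exact: initial_continuous.
- move=> x V xV.
  have : nbhs (f x) (g @^-1` V) by apply: cg; rewrite fK.
  rewrite nbhsE => -[_ [[W oW <-] Wx] WV]; exists W.
    by exists W.
  by move=> y Wy; rewrite -(fK y); apply: WV.
- exact: countable_base_separable cD dD.
Qed.

Lemma closed1_borel_space (T : topologicalType) (x : T) : borel_space R T -> closed [set x].
Proof.
move=> [P [B [[hP _] _ [f [g [fK gK cf cg]]]]]].
have -> : [set x] = (set_val \o f) @^-1` [set set_val (f x)].
  apply/seteqP; split => [y -> //|y /= /val_inj fxy].
  exact: (can_inj fK).
apply: preimage_closed; last exact: accessible_closed_set1 (hausdorff_accessible hP) _.
move=> y _; apply: continuous_comp; first exact: cf.
exact: initial_continuous.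
Qed.

Lemma measurable_state1 (x : state X) : measurable [set x].
Proof.
case: x => [x|].
  rewrite -[X in measurable X]setCK; apply: measurableC; apply: sub_sigma_algebra.
  rewrite /open /= /with_cemetery_open (_ : _ @^-1` _ = ~` [set x]).
    by apply: closed_openC; exact: closed1_borel_space (borel_X M).
  apply/seteqP; split => y /= yx; first by move=> e; apply: yx; rewrite e.
  by move=> [e]; exact: yx.
apply: sub_sigma_algebra; rewrite /open /= /with_cemetery_open (_ : _ @^-1` _ = set0).
  exact: open0.
by apply/seteqP; split.
Qed.

Lemma measurable_open_step (O : set (with_cemetery X * (time * A))) : open O ->
  measurable (O : set (step R X A)).
Proof.
apply: measurable_open_prod3.
- by apply: countable_base_cemetery; exact: countable_base_borel_space (borel_X M).
- exact: countable_base_time.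
- exact: countable_base_borel_space (borel_A M).
Qed.

Lemma measurable_lsc_step (f : with_cemetery X * (time * A) -> \bar R) :
  (forall z, liminf_ge (nbhs z) f (f z)) ->
  measurable_fun [set: step R X A] (f : step R X A -> \bar R).
Proof.
move=> lf; apply: (measurability _ (ErealGenOInfty.measurableE R)).
move=> /= _ [_ [a ->]] <-; rewrite setTI preimage_itvoy.
apply: measurable_open_step.
by rewrite openE => z /= az; exact: lf.
Qed.

Lemma measurable_lsc_state (f : with_cemetery X -> \bar R) :
  (forall x, liminf_ge (nbhs x) f (f x)) ->
  measurable_fun [set: state X] (f : state X -> \bar R).
Proof.
move=> lf; apply: (measurability _ (ErealGenOInfty.measurableE R)).
move=> /= _ [_ [a ->]] <-; rewrite setTI preimage_itvoy.
by apply: sub_sigma_algebra; rewrite openE => z /= az; exact: lf.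
Qed.

Lemma nbhs_step (x : X) (th : time) (a : A) (U : set (with_cemetery X * (time * A))) :
  nbhs (x, (th, a)) [set z | U (Some z.1, z.2)] -> nbhs (Some x : with_cemetery X, (th, a)) U.
Proof.
move=> [[V1 V2] /= [xV1 V2n] VU]; exists (Some @` V1, V2) => /=.
  by split => //; apply/nbhs_with_cemetery; apply: filterS xV1 => y ?; exists y.
by move=> [_ z] [/= [y V1y <-] V2z]; exact: (VU (y, z)).
Qed.

Lemma nbhs_step_finite (x : X) (t : set_type (half_line R)) (a : A)
    (U : set (with_cemetery X * (time * A))) :
  nbhs (x, (t, a)) [set z | U (Some z.1, (Some z.2.1, z.2.2))] ->
  nbhs (Some x : with_cemetery X, (Some t : time, a)) U.
Proof.
move=> [[V1 V23] /= [xV1 [[V2 V3] /= [tV2 aV3] V23']] VU].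
apply: nbhs_step; exists (V1, (Some @` V2) `*` V3) => /=.
  split => //; exists (Some @` V2, V3) => //=; split => //.
  exact: one_point_compactification_some_nbhs.
move=> [y [_ a']] [/= V1y [[s V2s <-] V3a]].
by apply: (VU (y, (s, a'))); split => //=; apply: V23'.
Qed.

Hypothesis CII : condition_II M.

Lemma flow_cvg (T : Type) (F : set_system T) {FF : Filter F} (y : T -> X) (t : T -> R)
    (x : X) (s : R) : y @ F --> x -> t @ F --> s -> (0 <= s)%R ->
  (forall i, (0 <= t i)%R) -> (fun i => flow M (y i) (t i)) @ F --> flow M x s.
Proof.
move=> yx ts s0 t0; have [_ _ /subspace_continuousP cflow _ _] := CII.
have := cflow (x, s) (conj I s0) => /= h U /h.
move=> [[V1 V2] /= [/yx V1n /ts V2n] VW].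
suff : F [set i | U (flow M (y i) (t i))] by [].
apply: (@filterS2 _ F FF _ _ _ _ V1n V2n) => i V1i V2i.
exact: (VW (y i, t i) (conj V1i V2i) (conj I (t0 i))).
Qed.

Lemma next_finite_cvg (x : X) (t : set_type (half_line R)) (a : A) :
  (fun z : X * (set_type (half_line R) * A) =>
     jump M (flow M z.1 (set_val z.2.1)) z.2.2) @ nbhs (x, (t, a)) -->
  jump M (flow M x (set_val t)) a.
Proof.
have [_ cjump _ _ _] := CII.
apply: (@cvg_comp _ _ _ (fun z : X * (set_type (half_line R) * A) =>
  (flow M z.1 (set_val z.2.1), z.2.2)) (fun z => jump M z.1 z.2) _
  (nbhs (flow M x (set_val t), a))); last exact: (cjump (flow M x (set_val t), a)).
apply: cvg_pair.
  apply: flow_cvg; [exact: cvg_fst| |exact: (set_valP t)|by move=> z; exact: (set_valP z.2.1)].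
  apply: (@cvg_comp _ _ _ (fun z : X * (set_type (half_line R) * A) => z.2.1) set_val _ (nbhs t)).
    by apply: cvg_comp; [exact: cvg_snd|exact: cvg_fst].
  exact: continuous_half_line_val.
by apply: cvg_comp; [exact: cvg_snd|exact: cvg_snd].
Qed.

Let nxt (z : with_cemetery X * (time * A)) : with_cemetery X := Defs.next M z.1 z.2.

(** Continuity holds from a state of X at a finite time. At theta = oo the image is the isolated
    cemetery, whereas finite times nearby lead into X. *)
Lemma next_cvg (x : X) (t : set_type (half_line R)) (a : A) :
  nxt @ nbhs (Some x : with_cemetery X, (Some t : time, a)) -->
  (Some (jump M (flow M x (set_val t)) a) : with_cemetery X).
Proof.
move=> U /nbhs_with_cemetery Ux; apply: nbhs_step_finite.
by have := next_finite_cvg Ux.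
Qed.

Lemma measurable_next : measurable_fun [set: step R X A]
  (fun z : step R X A => Defs.next M z.1 z.2).
Proof.
(* [W] is an open set on which [next] is continuous; off [W] it is constantly the cemetery. *)
pose W := [set z : with_cemetery X * (time * A) |
  if z.1 is Some _ then if z.2.1 is Some _ then True else False else False].
have open_part (U : set (with_cemetery X)) : open U -> open (W `&` nxt @^-1` U).
  move=> oU; rewrite openE => -[[x|] [[t|] a]] [/= Wz Uz] //.
  have nU : nbhs (nxt (Some x, (Some t, a))) U by exact: open_nbhs_nbhs.
  apply: filterI; last exact: next_cvg nU.
  by apply: nbhs_step_finite; exact: filterT.
have mW : measurable (W : set (step R X A)).
  apply: measurable_open_step; rewrite -[W]setIT -(preimage_setT nxt).
  by apply: open_part; exact: openT.
apply: (@measurability _ _ (step R X A) (state X) setT _ (@open (with_cemetery X))) => //.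
move=> _ [U oU <-]; rewrite setTI.
rewrite (_ : _ @^-1` _ = (W `&` nxt @^-1` U) `|` (~` W `&` [set _ | U None])).
  apply: measurableU; first exact: (measurable_open_step (open_part U oU)).
  apply: measurableI; first exact: measurableC.
  have [UN|UN] := pselect (U None).
    by rewrite (_ : [set _ | _] = setT)//; apply/seteqP; split.
  by rewrite (_ : [set _ | _] = set0)//; apply/seteqP; split.
apply/seteqP; split => z.
  move=> Uz; have [Wz|Wz] := pselect (W z); [by left|right; split => //].
  by move: z Uz Wz => [[x|] [[t|] a]] //= ? /(_ I).
move=> [[]//|[Wz]] /= UN.
by move: z Wz => [[x|] [[t|] a]] //= /(_ I).
Qed.

End model.

(** * Costs, plans and values *)

Lemma liminf_ge_comp (R : realType) (T U : Type) (F : set_system T) (G : set_system U)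
    (f : T -> U) (g : U -> \bar R) (l : \bar R) :
  f @ F `=>` G -> liminf_ge G g l -> liminf_ge F (g \o f) l.
Proof. by move=> fFG gl a /gl /fFG. Qed.

Section cost_lsc.
Context (R : realType) (X A : ptopologicalType) (J : nat).
Variable M : impulse_model R X A J.
Local Notation time := (one_point_compactification (set_type (half_line R))).
Hypothesis CII : condition_II M.

Definition run j (y : X) (th : time) : \bar R :=
  if th is Some t then
    \int[lebesgue_measure]_(u in `[0%R, set_val t]) (gcost M j (flow M y u))%:E
  else \int[lebesgue_measure]_(u in `[0%R, +oo[) (gcost M j (flow M y u))%:E.

Lemma run_ge0 j y th : 0 <= run j y th.
Proof.
by case: th => [t|] /=; apply: integral_ge0 => u _; rewrite lee_fin gcost_ge0.
Qed.

Lemma cost_ge0 j x b : 0 <= cost M j x b.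
Proof.
case: x => [y|//]; rewrite /cost; case: b => [[t|] a] /=; last exact: (run_ge0 j y None).
by apply: adde_ge0; [exact: (run_ge0 j y (Some t))|rewrite lee_fin icost_ge0].
Qed.

Let measurable_gcost_flow j y :
  measurable_fun (`[0%R, +oo[%classic : set R) (fun u => (gcost M j (flow M y u))%:E).
Proof.
apply/measurable_EFinP; apply: (@measurable_comp _ _ _ R (borel X) R setT) => //.
  exact: measurable_gcost.
apply: (@measurable_comp _ _ _ R (borel X * R)%type (borel X) ([set: borel X] `*` half_line R)
  (fun z : borel X * R => flow M z.1 z.2) _ (fun u => (y, u))).
- apply: measurableX => //; rewrite (_ : half_line R = `[0%R, +oo[%classic)//.
  by apply/seteqP; split => t; rewrite /= in_itv /= andbT.
- by move=> _ [u /= + <-]; rewrite in_itv /= andbT.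
- exact: measurable_flow.
- by apply: measurable_funTS; exact: pair1_measurable.
Qed.

Let upto (s : R) (th : time) : Prop := if th is Some t then (s <= set_val t)%R else True.

Let run_upto j y th :
  run j y th = \int[lebesgue_measure]_(s in `[0%R, +oo[)
    ((fun s => (gcost M j (flow M y s))%:E) \_ [set s | upto s th]) s.
Proof.
rewrite -integral_mkcondr /run; case: th => [t|]; last by rewrite setIT.
congr (integral _ _ _); apply/seteqP; split => s /=; rewrite !in_itv /= ?andbT.
  by move=> /andP[].
by move=> [-> ->].
Qed.

(** The endpoint t is a null set and may be removed. For times t_k tending to t, s < t implies s <=
    t_k eventually, which s <= t would not. *)
Let run_before j y th :
  run j y th = \int[lebesgue_measure]_(s in `[0%R, +oo[)
    ((fun s => (gcost M j (flow M y s))%:E) \_ [set s | before s th]) s.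
Proof.
rewrite -integral_mkcondr /run; case: th => [t|]; last by rewrite setIT.
rewrite -integral_itv_bndo_bndc.
  congr (integral _ _ _); apply/seteqP; split => s /=; rewrite !in_itv /= ?andbT.
    by move=> /andP[].
  by move=> [-> ->].
apply: measurable_funS (measurable_gcost_flow j y) => //.
by move=> s /=; rewrite !in_itv /= andbT => /andP[].
Qed.

Let measurable_upto th : measurable [set s : R | upto s th].
Proof.
case: th => [t|] /=; last first.
  by rewrite (_ : [set _ | _] = setT)//; apply/seteqP; split.
by rewrite (_ : [set _ | _] = `]-oo, set_val t]%classic)//; apply/seteqP; split => s; rewrite /= in_itv.
Qed.

Let measurable_before th : measurable [set s : R | before s th].
Proof.
case: th => [t|] /=; last first.
  by rewrite (_ : [set _ | _] = setT)//; apply/seteqP; split.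
by rewrite (_ : [set _ | _] = `]-oo, set_val t[%classic)//; apply/seteqP; split => s; rewrite /= in_itv.
Qed.

(** Fatou's lemma along a sequence, over the fixed domain [0, oo[: the integrands are cut off by
    [upto] along the sequence and by [before] in the limit. *)
Lemma run_lsc j (y : X) (th : time) :
  liminf_ge (nbhs (y, th)) (fun z => run j z.1 z.2) (run j y th).
Proof.
have [_ _ _ _ gl] := CII.
apply: liminf_ge_sequential.
  apply: countable_base_prod; last exact: countable_base_time.
  exact: countable_base_borel_space (borel_X M).
move=> u uyth; apply: le_limn_einf.
have u1 : (fst \o u) @ \oo --> y by apply: cvg_comp uyth cvg_fst.
have u2 : (snd \o u) @ \oo --> th by apply: cvg_comp uyth cvg_snd.
pose f k := (fun s => (gcost M j (flow M (u k).1 s))%:E) \_ [set s | upto s (u k).2].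
have f0 k s : 0 <= f k s.
  by rewrite /f patchE; case: ifP => // _; rewrite lee_fin gcost_ge0.
have mD : measurable (`[0%R, +oo[%classic : set R) by exact: measurable_itv.
have mf k : measurable_fun (`[0%R, +oo[%classic : set R) (f k).
  apply/(measurable_restrict _ (measurable_upto (u k).2) mD).
  by apply: measurable_funS (measurable_gcost_flow j (u k).1).
rewrite (_ : (fun z => _) \o u = fun k => \int[lebesgue_measure]_(s in `[0%R, +oo[) f k s); last first.
  by apply/funext => k /=; rewrite run_upto.
apply: (le_trans _ (fatou lebesgue_measure mD mf (fun k s _ => f0 k s))).
rewrite run_before; apply: ge0_le_integral => //.
- by move=> s _; rewrite patchE; case: ifP => // _; rewrite lee_fin gcost_ge0.
- apply/measurable_restrict => //; first exact: measurable_before.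
  by apply: measurable_funS (measurable_gcost_flow j y).
- apply: (emeasurable_fun_cvg (fun n s => einfs (f^~ s) n)).
    by move=> n; exact: measurable_fun_einfs.
  move=> s _; rewrite limn_einf_lim; exact: is_cvg_einfs.
move=> s; rewrite /= in_itv /= andbT => s0; apply: limn_einf_ge => //.
rewrite patchE; case: ifPn => [|_]; last first.
  by apply: liminf_ge_lbound; apply: nearW => k; exact: f0.
rewrite inE /= => sth.
have bu (r : time) : before s r -> upto s r.
  by case: r => [t|//] st; exact: ltW.
have su : \forall k \near \oo, upto s (u k).2.
  have := u2 _ (before_nbhs sth); apply: filterS => k /=.
  exact: bu.
have fl : (fun k => flow M (u k).1 s) @ \oo --> flow M y s.
  by apply: (flow_cvg CII) => //; exact: cvg_cst.
have := @liminf_ge_comp R _ _ _ _ (fun k => flow M (u k).1 s) (fun x => (gcost M j x)%:E) _ fl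
  ((lower_semicontinuous_liminf _).1 (gl j) (flow M y s)).
apply: liminf_geS; apply: filterS su => k sk.
by rewrite /f patchE ifT ?inE.
Qed.

Lemma cost_lsc j (z : with_cemetery X * (time * A)) :
  liminf_ge (nbhs z) (fun z => cost M j z.1 z.2) (cost M j z.1 z.2).
Proof.
(* At theta = oo there is no impulse cost, and discarding it nearby only lowers the cost, so the
   running cost alone gives the bound. *)
have runle x b y : x = Some y -> run j y b.1 <= cost M j x b.
  move=> ->; rewrite /cost /run; case: b.1 => // t.
  by rewrite leeDl// lee_fin icost_ge0.
case: z => [[y|] [[t|] a]] /=; last 2 first.
- by apply: liminf_ge_lbound; apply: nearW => z; exact: cost_ge0.
- by apply: liminf_ge_lbound; apply: nearW => z; exact: cost_ge0.
- have [_ _ _ il _] := CII.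
  have h : liminf_ge (nbhs (y, (t, a)))
     (fun z => run j z.1 (Some z.2.1) + (icost M j (flow M z.1 (set_val z.2.1)) z.2.2)%:E)
     (run j y (Some t) + (icost M j (flow M y (set_val t)) a)%:E).
    apply: liminf_geD.
    + exact: run_ge0.
    + by rewrite lee_fin icost_ge0.
    + have := @run_lsc j y (Some t).
      apply: (@liminf_ge_comp _ _ _ _ _
        (fun z : X * (set_type (half_line R) * A) => (z.1, Some z.2.1 : time))).
      move=> U [[V1 V2] /= [V1y V2t] VU].
      exists (V1, (V2 \o Some) `*` setT) => /=.
        by split => //; exists (V2 \o Some, setT) => //=; split => //; exact: filterT.
      by move=> [y' [t' a']] /= [? [? _]]; apply: (VU (y', Some t')).
    + have := (lower_semicontinuous_liminf _).1 (il j) (flow M y (set_val t), a).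
      apply: (@liminf_ge_comp _ _ _ _ _
        (fun z : X * (set_type (half_line R) * A) => (flow M z.1 (set_val z.2.1), z.2.2))).
      apply: cvg_pair.
        apply: (flow_cvg CII); [exact: cvg_fst| |exact: (set_valP t)|by move=> z; exact: (set_valP z.2.1)].
        apply: (@cvg_comp _ _ _ (fun z : X * (set_type (half_line R) * A) => z.2.1) set_val _ (nbhs t)).
          by apply: cvg_comp; [exact: cvg_snd|exact: cvg_fst].
        exact: continuous_half_line_val.
      by apply: cvg_comp; [exact: cvg_snd|exact: cvg_snd].
  by move=> c /h hc; apply: nbhs_step_finite.
- have := @run_lsc j y None => h c /h [[V1 V2] /= [V1y V2n] VU].
  apply: nbhs_step; exists (V1, V2 `*` setT) => /=.
    by split => //; exists (V2, setT) => //=; split => //; exact: filterT.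
  move=> [y' [th' a']] /= [V1y' [V2t' _]].
  have yth : c%:E < cost M j (Some y') (th', a').
    by apply: lt_le_trans (runle _ _ y' erefl); exact: (VU (y', th')).
  exact: yth.
Qed.

Lemma measurable_cost j :
  measurable_fun [set: step R X A] (fun z : step R X A => cost M j z.1 z.2).
Proof. by apply: (measurable_lsc_step M) => z; exact: cost_lsc. Qed.

End cost_lsc.

(** * Plans and their finite-horizon values *)

Section horizon.
Context (R : realType) (X A : ptopologicalType) (J : nat).
Variable M : impulse_model R X A J.
Local Notation time := (one_point_compactification (set_type (half_line R))).
Hypothesis CII : condition_II M.
Local Notation nxt := (Defs.next M).
Local Notation plan := (prod_topology (fun _ : nat => (time * A)%type)).

Lemma compact_plan : compact [set: plan].
Proof.
have [cA _ _ _ _] := CII.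
have := @tychonoff nat (fun=> (time * A)%type) (fun=> setT `*` setT)
  (fun=> compact_setX one_point_compactification_compact cA).
by rewrite (_ : [set f | _] = setT)//; apply/seteqP; split => // b _ n; split.
Qed.

Fixpoint path (x : state X) (b : nat -> action R A) (n : nat) : state X :=
  if n is m.+1 then nxt (path x b m) (b m) else x.

Lemma path_shift x b n : path x b n.+1 = path (nxt x (b 0%N)) (b \o succn) n.
Proof. by elim: n => //= n <-. Qed.

Variable c : state X -> action R A -> \bar R.
Hypothesis c0 : forall x b, 0 <= c x b.
Hypothesis c_lsc : forall z : with_cemetery X * (time * A),
  liminf_ge (nbhs z) (fun z => c z.1 z.2) (c z.1 z.2).
Hypothesis c_cemetery : forall b, c None b = 0.

(** The plan is read from index k on instead of being shifted, so that it stays the same throughout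
    the induction on the horizon. *)
Fixpoint finite_cost k n (x : state X) (b : nat -> action R A) : \bar R :=
  if n is m.+1 then c x (b k) + finite_cost k.+1 m (nxt x (b k)) b else 0.

Definition plan_cost x b := \sum_(0 <= n <oo) c (path x b n) (b n).

Definition horizon_value n x := ereal_inf (range (fun b : nat -> action R A => finite_cost 0 n x b)).

Definition value x := ereal_inf (range (plan_cost x)).

Lemma finite_cost_ge0 k n x b : 0 <= finite_cost k n x b.
Proof. by elim: n k x => //= n IH k x; rewrite adde_ge0. Qed.

Lemma finite_cost_cemetery k n b : finite_cost k n None b = 0.
Proof. by elim: n k => //= n IH k; rewrite c_cemetery add0e IH. Qed.

Lemma finite_cost_shift k n x b : finite_cost k.+1 n x b = finite_cost k n x (b \o succn).
Proof. by elim: n k x => //= n IH k x; rewrite IH. Qed.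

Lemma finite_costE n x b : finite_cost 0 n x b = \sum_(0 <= i < n) c (path x b i) (b i).
Proof.
elim: n x b => [|n IH] x b; first by rewrite big_nil.
rewrite big_nat_recl//= finite_cost_shift IH; congr (_ + _).
by apply: eq_bigr => i _; rewrite -[in RHS]/(path x b i.+1) path_shift.
Qed.

(** Where [next] yields the cemetery it may be discontinuous, but then the continuation costs 0 and
    the current cost alone is a lower bound nearby. Elsewhere [next] is continuous and the induction
    hypothesis applies. *)
Lemma finite_cost_lsc k n (x : with_cemetery X) (b : plan) :
  liminf_ge (nbhs (x, b)) (fun z => finite_cost k n z.1 z.2) (finite_cost k n x b).
Proof.
elim: n k x b => [|n IH] k x b.
  by apply: liminf_ge_lbound; exact: nearW.
have proj_k : (fun z : with_cemetery X * plan => (z.1, z.2 k)) @ nbhs (x, b) --> nbhs (x, b k).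
  move=> U [[V1 V2] /= [xV1 bV2] VU]; exists (V1, (fun b' : plan => V2 (b' k))) => /=.
    by split => //; exact: (@proj_continuous _ (fun=> (time * A)%type) k b _ bV2).
  by move=> [y b'] [/= V1y V2b]; exact: (VU (y, b' k)).
have ck : liminf_ge (nbhs (x, b)) (fun z => c z.1 (z.2 k)) (c x (b k)).
  by move=> a ac; exact: (proj_k _ (@c_lsc (x, b k) a ac)).
have cle : liminf_ge (nbhs (x, b)) (fun z => finite_cost k n.+1 z.1 z.2) (c x (b k)).
  apply: liminf_geS ck; apply: nearW => z /=.
  by rewrite leeDl// finite_cost_ge0.
have [nN|] := pselect (nxt x (b k) = None).
  by rewrite /= nN finite_cost_cemetery adde0.
move=> nN; apply: liminf_geD => //.
- exact: finite_cost_ge0.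
have := IH k.+1 (nxt x (b k)) b.
apply: (@liminf_ge_comp _ _ _ _ _
        (fun z : with_cemetery X * plan => (nxt z.1 (z.2 k) : with_cemetery X, z.2))).
have nk : (fun z : with_cemetery X * plan => nxt z.1 (z.2 k) : with_cemetery X) @ nbhs (x, b) `=>`
    nbhs (nxt x (b k) : with_cemetery X).
  move: proj_k nN {ck cle}.
  case: x => [y|] //; case: (b k) => [[t|] a] // proj_k _.
  by move=> U /(next_cvg CII) /proj_k.
move=> U [[V1 V2] /= [/nk xV1 bV2] VU].
have bV2' : nbhs (x, b) [set z | V2 z.2].
  by exists (setT, V2) => /=; [split => //; exact: filterT|move=> z []].
apply: (@filterS2 _ _ (nbhs_filter (x, b)) _ _ _ _ xV1 bV2') => z V1z V2z.
exact: (VU (_, _)).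
Qed.

Lemma horizon_value_ge0 n x : 0 <= horizon_value n x.
Proof. by apply: le_ereal_inf_tmp => _ [b _ <-]; exact: finite_cost_ge0. Qed.

Lemma horizon_value_le n x b : horizon_value n x <= finite_cost 0 n x b.
Proof. by apply: ereal_inf_lbound; exists b. Qed.

Lemma finite_cost_homo x b : {homo (fun n => finite_cost 0 n x b) : m n / (m <= n)%N >-> m <= n}.
Proof.
by move=> m n mn; rewrite !finite_costE; apply: lee_sum_nneg_natr.
Qed.

Lemma horizon_value_homo x : {homo horizon_value^~ x : m n / (m <= n)%N >-> m <= n}.
Proof.
move=> m n mn; apply: le_ereal_inf_tmp => _ [b _ <-].
exact: le_trans (horizon_value_le m x b) (finite_cost_homo _ _ mn).
Qed.

(** Prepending b to a plan gives a plan with one more step. An infinite cost of b is set aside, as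
    it cannot be subtracted. *)
Lemma horizon_value_bellman n x (b : action R A) :
  horizon_value n.+1 x <= c x b + horizon_value n (nxt x b).
Proof.
have [cb|cb] := eqVneq (c x b) +oo.
  by rewrite cb addye ?leey// gt_eqF// (lt_le_trans _ (horizon_value_ge0 _ _)).
have cfin : c x b \is a fin_num by rewrite ge0_fin_numE// ltey.
rewrite -leeBlDl//; apply: le_ereal_inf_tmp => _ [b' _ <-].
rewrite leeBlDl//.
apply: le_trans (horizon_value_le n.+1 x (fun i => if i is m.+1 then b' m else b)) _.
by rewrite /= finite_cost_shift.
Qed.

(** A tube argument: if all plans cost more than a' from x, compactness of the plans extends this to
    all states near x. *)
Lemma horizon_value_lsc n (x : with_cemetery X) :
  liminf_ge (nbhs x) (horizon_value n) (horizon_value n x).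
Proof.
move=> a ah; have [a0|a0] := ltP a 0%R.
  apply: nearW => y; apply: lt_le_trans (horizon_value_ge0 n y).
  by rewrite lte_fin.
have a0' : 0 <= a%:E by rewrite lee_fin.
have [a' [aa' ha']] := ereal_between ah a0'.
have near_all : \forall y \near nbhs x, [set: plan] `<=` (fun b => a'%:E < finite_cost 0 n y b).
  apply: ((compact_near_coveringP _).1 compact_plan) => b _.
  have := @finite_cost_lsc 0%N n x b _ (lt_le_trans ha' (horizon_value_le n x b)).
  move=> [[V1 V2] /= [xV1 bV2] VU]; exists (V2, V1) => //= -[b' y] [/= V2b V1y].
  exact: (VU (y, b')).
apply: filterS near_all => y ya; apply: lt_le_trans aa' _.
by apply: le_ereal_inf_tmp => _ [b _ <-]; apply: ltW; exact: ya.
Qed.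

Lemma measurable_horizon_value n : measurable_fun [set: state X] (horizon_value n).
Proof. by apply: measurable_lsc_state => x; exact: horizon_value_lsc. Qed.

Lemma plan_cost_ge0 x b : 0 <= plan_cost x b.
Proof. exact: nneseries_ge0. Qed.

Lemma value_ge0 x : 0 <= value x.
Proof. by apply: le_ereal_inf_tmp => _ [b _ <-]; exact: plan_cost_ge0. Qed.

Lemma finite_cost_le_plan_cost n x b : finite_cost 0 n x b <= plan_cost x b.
Proof. by rewrite finite_costE; apply: nneseries_lim_ge. Qed.

Lemma lt_plan_cost x b a : a < plan_cost x b -> exists n, a < finite_cost 0 n x b.
Proof.
have -> : plan_cost x b = ereal_sup (range (fun n => finite_cost 0 n x b)).
  apply/cvg_lim => //; rewrite (_ : (fun n => _) = (fun n => finite_cost 0 n x b)).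
    exact/ereal_nondecreasing_cvgn/finite_cost_homo.
  by apply/funext => n; rewrite finite_costE.
by move=> /ereal_sup_gt[_ [n _ <-] an]; exists n.
Qed.

Lemma plan_cost_lsc x : lower_semicontinuous (plan_cost x : plan -> \bar R).
Proof.
apply/lower_semicontinuous_liminf => b a /lt_plan_cost[n an].
have : liminf_ge (nbhs b) (fun b' : plan => finite_cost 0 n x b') (finite_cost 0 n x b).
  have := @finite_cost_lsc 0%N n x b.
  apply: (@liminf_ge_comp _ _ _ _ _
        (fun b' : plan => (x : with_cemetery X, b'))).
  move=> U [[V1 V2] /= [xV1 bV2] VU]; apply: filterS bV2 => b' V2b.
  by apply: (VU (x, b')); split => //; exact: nbhs_singleton xV1.
move=> /(_ _ an); apply: filterS => b' ab'.
exact: lt_le_trans ab' (finite_cost_le_plan_cost n x b').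
Qed.

Lemma horizon_value_le_value n x : horizon_value n x <= value x.
Proof.
apply: le_ereal_inf_tmp => _ [b _ <-].
exact: le_trans (horizon_value_le n x b) (finite_cost_le_plan_cost n x b).
Qed.

(** With [horizon_value_le_value], this exchanges the infimum over plans and the supremum over
    horizons. If every horizon had a plan of cost below a', a cluster point of these plans would
    have total cost at most a', since partial costs are lower semicontinuous and grow with the
    horizon. *)
Lemma lt_value x (a : R) : (0 <= a)%R -> a%:E < value x ->
  exists n, a%:E < horizon_value n x.
Proof.
move=> a0 av; apply: contrapT => none.
have a0' : 0 <= a%:E by rewrite lee_fin.
have [a' [aa' va']] := ereal_between av a0'.
have pick n : exists b : plan, finite_cost 0 n x b < a'%:E.
  have : horizon_value n x < a'%:E.
    apply: le_lt_trans aa'; rewrite leNgt; apply/negP => an.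
    by apply: none; exists n.
  by move=> /ereal_inf_lt[_ [b _ <-] ba']; exists b.
have [b_ b_a'] := choice pick.
have [b [_ bcl]] := compact_plan (F := b_ @ \oo) _ filterT.
have : plan_cost x b <= a'%:E.
  rewrite leNgt; apply/negP => /lt_plan_cost[m am].
  have nb : nbhs b [set b' : plan | a'%:E < finite_cost 0 m x b'].
    have := @finite_cost_lsc 0%N m x b _ am.
    move=> [[V1 V2] /= [xV1 bV2] VU]; apply: filterS bV2 => b' V2b.
    by apply: (VU (x, b')); split => //; exact: nbhs_singleton xV1.
  have [|b' [[n mn <-] an]] := bcl [set b_ n | n in [set n | (m <= n)%N]] _ _ nb.
    by exists m => // n mn; exists n.
  have := lt_le_trans an (finite_cost_homo x (b_ n) mn).
  by move=> /lt_trans/(_ (b_a' n)); rewrite ltxx.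
apply/negP; rewrite -ltNge; apply: lt_le_trans va' _.
by apply: ereal_inf_lbound; exists b.
Qed.

Lemma measurable_value_gt0 : measurable [set x : state X | 0 < value x].
Proof.
have -> : [set x : state X | 0 < value x] = \bigcup_n [set x | 0 < horizon_value n x].
  apply/seteqP; split => x.
    by move=> /(lt_value (lexx 0%R))[n ?]; exists n.
  by move=> [n _ /= nx]; exact: lt_le_trans nx (horizon_value_le_value n x).
apply: bigcupT_measurable => n.
rewrite (_ : [set x | _] = setT `&` horizon_value n @^-1` `]0, +oo[%classic).
  exact: (@measurable_horizon_value n measurableT `]0, +oo[%classic (emeasurable_itv _)).
by rewrite setTI preimage_itvoy.
Qed.

End horizon.

(** * Expectations under a strategy *)

Lemma eq_integral_image d1 d2 d3 (T : measurableType d1) (T' : measurableType d2)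
    (U : measurableType d3) (R : realType)
    (mu : {measure set T -> \bar R}) (nu : {measure set T' -> \bar R})
    (phi : T -> U) (psi : T' -> U) (g : U -> \bar R) :
  measurable_fun [set: T] phi -> measurable_fun [set: T'] psi ->
  measurable_fun [set: U] g -> (forall u, 0 <= g u) ->
  (forall E, measurable E -> mu (phi @^-1` E) = nu (psi @^-1` E)) ->
  \int[mu]_t g (phi t) = \int[nu]_t g (psi t).
Proof.
move=> mphi mpsi mg g0 munu.
have := @ge0_integral_pushforward _ _ _ _ _ _ mphi mu setT g measurableT mg (fun _ _ => g0 _).
rewrite preimage_setT => <-.
have := @ge0_integral_pushforward _ _ _ _ _ _ mpsi nu setT g measurableT mg (fun _ _ => g0 _).
rewrite preimage_setT => <-.
by apply: eq_measure_integral => E mE _; exact: munu.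
Qed.

Section law_expectation.
Context (R : realType) (X A : ptopologicalType) (J : nat).
Variable M : impulse_model R X A J.
Hypothesis CII : condition_II M.
Variables (pi : strategy R X A) (x : state X).
Local Notation P := (law M pi x).

Let has_lawP : has_law M pi x P := lawP (measurable_next CII) pi x.

Lemma law_setT : P setT = 1.
Proof. by have [] := has_lawP. Qed.

Lemma measurable_step_at n :
  measurable_fun [set: trajectory R X A] (fun w : trajectory R X A => w n).
Proof. exact: measurable_coordinate. Qed.

Lemma measurable_state_at n :
  measurable_fun [set: trajectory R X A] (fun w : trajectory R X A => (w n).1).
Proof. exact: (measurableT_comp measurable_fst (measurable_step_at n)). Qed.

Lemma measurable_action_at n :
  measurable_fun [set: trajectory R X A] (fun w : trajectory R X A => (w n).2).
Proof. exact: (measurableT_comp measurable_snd (measurable_step_at n)). Qed.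

Lemma measurable_next_at n :
  measurable_fun [set: trajectory R X A]
    (fun w : trajectory R X A => Defs.next M (w n).1 (w n).2).
Proof. exact: (measurableT_comp (measurable_next CII) (measurable_step_at n)). Qed.

Section one_step.
Variable g : state X -> \bar R.
Hypotheses (mg : measurable_fun [set: state X] g) (g0 : forall y, 0 <= g y).

Lemma law_start : \int[P]_w g (w 0%N).1 = g x.
Proof.
transitivity (\int[dirac x]_y g (id y)); last by rewrite integral_dirac// diracT mul1e.
apply: eq_integral_image => //; first exact: measurable_state_at.
by move=> E mE; have [_ h _ _] := has_lawP; exact: h.
Qed.

Lemma law_next n : \int[P]_w g (w n.+1).1 = \int[P]_w g (Defs.next M (w n).1 (w n).2).
Proof.
apply: eq_integral_image => //; [exact: measurable_state_at|exact: measurable_next_at|].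
move=> E mE.
have [_ _ _ /(_ n setT E measurableT mE)] := has_lawP.
rewrite (_ : [set w | _ /\ _] = [set w | E (w n.+1).1]); last first.
  by apply/seteqP; split => w //= [].
rewrite (_ : [set w | [set: _] _] = setT)// => h; apply: etrans h _.
have := measurable_next_at n; move=> /(_ measurableT E mE); rewrite setTI => mE'.
by rewrite -(setIT (_ @^-1` E)) -integral_indic.
Qed.
End one_step.

(** [has_law] prescribes the joint law of history and action on rectangles only; these form a
    generating pi-system, so the two measures coincide. *)
Lemma law_action n (g : history R X A n * action R A -> \bar R) :
  measurable_fun [set: history R X A n * action R A] g -> (forall z, 0 <= g z) ->
  \int[P]_w g (hist n w, (w n).2) = \int[P]_w \int[pi n (hist n w)]_b g (hist n w, b).
Proof.
move=> mg g0.
have P1 : P setT <= 1 by rewrite law_setT.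
pose K (w : trajectory R X A) : giry (history R X A n * action R A)%type R :=
  giry_prod (giry_ret (hist n w), pker_giry (pi n) (hist n w)).
have mK : measurable_fun [set: trajectory R X A] K.
  apply: (measurableT_comp measurable_giry_prod); apply: measurable_fun_pair.
    exact: (measurableT_comp measurable_giry_ret (@measurable_hist _ _ _ n)).
  exact: (measurableT_comp (measurable_pker_giry (pi n)) (@measurable_hist _ _ _ n)).
have int_K w (f : history R X A n * action R A -> \bar R) :
    measurable_fun [set: history R X A n * action R A] f -> (forall z, 0 <= f z) ->
    giry_int (K w) f = \int[pi n (hist n w)]_b f (hist n w, b).
  move=> mf f0; rewrite /K giry_int_prod1// giry_int_ret//.
    by apply: (@measurable_fun_fubini_tonelli_F _ _ _ _ _ (pker_giry (pi n) (hist n w)) _ mf).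
have mz : measurable_fun [set: trajectory R X A]
    (fun w : trajectory R X A => (hist n w, (w n).2)).
  by apply: measurable_fun_pair; [exact: measurable_hist|exact: measurable_action_at].
pose Q : giry (history R X A n * action R A)%type R := giry_bind (giry_of P1) mK.
have QE f : measurable_fun [set: history R X A n * action R A] f -> (forall z, 0 <= f z) ->
    \int[Q]_z f z = \int[P]_w \int[pi n (hist n w)]_b f (hist n w, b).
  move=> mf f0; rewrite -[LHS]/(giry_int _ _) giry_int_bind//.
  by rewrite /giry_int; apply: eq_integral => w _; exact: int_K.
rewrite -QE//; apply: (@eq_integral_image _ _ _ _ _ _ _ P Q _ id) => //.
rewrite -[forall E, _ -> _]/(forall E, measurable E -> pushforward P (fun w => (hist n w, (w n).2)) E = Q E).
pose rect : set (set (history R X A n * action R A)) :=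
  [set U | exists D E, [/\ measurable D, measurable E & U = D `*` E]].
apply: (@measure_unique _ _ _ rect (fun=> setT) _ _ _ _ (pushforward P (fun w => (hist n w, (w n).2)))) => //.
- rewrite measurable_prod_measurableType; congr (<<s _ >>).
  apply/seteqP; split => [_ [D mD [E mE <-]]|_ [D [E [mD mE ->]]]]; first by exists D, E.
  by exists D => //; exists E.
- move=> _ _ [D1 [E1 [mD1 mE1 ->]]] [D2 [E2 [mD2 mE2 ->]]].
  exists (D1 `&` D2), (E1 `&` E2); split; [exact: measurableI|exact: measurableI|].
  by rewrite setXI.
- by move=> _; exists setT, setT; split => //; rewrite setXTT.
- exact: bigcup_const.
- move=> _ [D [E [mD mE ->]]]; apply: (@etrans _ _ (\int[Q]_z (\1_(D `*` E) z)%:E)); last first.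
    by rewrite integral_indic ?setIT//; exact: measurableX.
  have mDE : measurable (D `*` E) by exact: measurableX.
  have mI : measurable_fun [set: history R X A n * action R A]
      (fun z => (\1_(D `*` E) z)%:E : \bar R).
    by apply/measurable_EFinP; exact: measurable_indic.
  rewrite (QE _ mI); last by move=> z; rewrite lee_fin.
  have [_ _ /(_ n D E mD mE) h _] := has_lawP.
  apply: etrans h _; rewrite integral_mkcond; apply: eq_integral => w _; rewrite patchE.
  case: ifPn => [/set_mem /= Dw|/negP Dw].
    rewrite (eq_integral (fun b => (\1_E b)%:E)) ?integral_indic ?setIT// => b _.
    by rewrite !indicE; congr (nat_of_bool _)%:R%:E; apply/idP/idP; rewrite !inE => // -[].
  rewrite integral0_eq// => b _; rewrite indicE memNset// => -[/= Dw' _].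
  by apply: Dw; rewrite inE.
- move=> _; rewrite [X in X < _](_ : _ = 1) ?ltry//; exact: law_setT.
Qed.

Lemma law_action_state n (g : step R X A -> \bar R) :
  measurable_fun [set: step R X A] g -> (forall z, 0 <= g z) ->
  \int[P]_w g (w n) = \int[P]_w \int[pi n (hist n w)]_b g ((w n).1, b).
Proof.
move=> mg g0; pose g' (z : history R X A n * action R A) := g (z.1.2, z.2).
have mg' : measurable_fun [set: history R X A n * action R A] g'.
  apply: (measurableT_comp mg); apply: measurable_fun_pair => //.
  exact: (measurableT_comp measurable_snd measurable_fst).
rewrite -[RHS](law_action mg' (fun=> g0 _)).
by apply: eq_integral => w _; rewrite /g' /= -surjective_pairing.
Qed.

End law_expectation.

Section horizon_bound.
Context (R : realType) (X A : ptopologicalType) (J : nat).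
Variable M : impulse_model R X A J.
Hypothesis CII : condition_II M.
Local Notation time := (one_point_compactification (set_type (half_line R))).
Variable c : state X -> action R A -> \bar R.
Hypothesis c0 : forall x b, 0 <= c x b.
Hypothesis c_lsc : forall z : with_cemetery X * (time * A),
  liminf_ge (nbhs z) (fun z => c z.1 z.2) (c z.1 z.2).
Hypothesis c_cemetery : forall b, c None b = 0.

Let mc : measurable_fun [set: step R X A] (fun z : step R X A => c z.1 z.2).
Proof. exact: (measurable_lsc_step M). Qed.

Lemma horizon_value_0 x : horizon_value M c 0 x = 0.
Proof.
by apply/eqP; rewrite eq_le horizon_value_ge0// andbT; exact: (horizon_value_le M c 0 x point).
Qed.

Lemma horizon_value_le_law pi x n : horizon_value M c n x <=
  \sum_(0 <= i < n) \int[law M pi x]_w c (w i).1 (w i).2.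
Proof.
have mh := measurable_horizon_value CII c0 c_lsc c_cemetery.
have h0 m y : 0 <= horizon_value M c m y by exact: horizon_value_ge0.
rewrite -(law_start CII pi x (mh n) (h0 n)).
(* Starting at an arbitrary time m lets the induction on the horizon advance along one law, without
   changing the initial state. *)
suff h m : \int[law M pi x]_w horizon_value M c n (w m).1 <=
    \sum_(0 <= i < n) \int[law M pi x]_w c (w (m + i)%N).1 (w (m + i)%N).2.
  exact: h.
elim: n m => [|n IH] m.
  by rewrite big_nil integral0_eq// => w _; rewrite horizon_value_0.
have mcm k : measurable_fun [set: trajectory R X A] (fun w : trajectory R X A => c (w k).1 (w k).2).
  exact: (measurableT_comp mc (measurable_step_at k)).
have mhm : measurable_fun [set: trajectory R X A] (fun w : trajectory R X A =>
    horizon_value M c n (Defs.next M (w m).1 (w m).2)).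
  exact: (measurableT_comp (mh n) (measurable_next_at CII m)).
rewrite big_nat_recl//= addn0.
apply: (@le_trans _ _ (\int[law M pi x]_w (c (w m).1 (w m).2 +
    horizon_value M c n (Defs.next M (w m).1 (w m).2)))).
  apply: ge0_le_integral => //.
  - exact: (measurableT_comp (mh n.+1) (measurable_state_at m)).
  - exact: emeasurable_funD.
  - by move=> w _; exact: horizon_value_bellman.
rewrite ge0_integralD//; apply: leeD2l.
rewrite -(law_next CII pi x (mh n) (h0 n)).
under eq_bigr do rewrite addnS -addSn; exact: IH.
Qed.

Lemma value_le_of_horizon x (a : \bar R) : 0 <= a ->
  (forall n, horizon_value M c n x <= a) -> value M c x <= a.
Proof.
move=> a0 ha; rewrite leNgt; apply/negP => av.
have [r [ar rv]] := ereal_between av a0.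
have r0 : (0 <= r)%R by rewrite -lee_fin (le_trans a0)// ltW.
have [n /lt_le_trans/(_ (ha n))] := lt_value CII c0 c_lsc c_cemetery r0 rv.
by move=> /lt_trans/(_ ar); rewrite ltxx.
Qed.

Lemma value_le_law pi x : value M c x <=
  \sum_(0 <= n <oo) \int[law M pi x]_w c (w n).1 (w n).2.
Proof.
have i0 n : 0 <= \int[law M pi x]_w c (w n).1 (w n).2 by apply: integral_ge0.
apply: value_le_of_horizon => [|n]; first by apply: nneseries_ge0 => n _ _; exact: i0.
apply: le_trans (horizon_value_le_law pi x n) _.
by apply: nneseries_lim_ge => k _ _; exact: i0.
Qed.

End horizon_bound.

Section open_loop.
Context (R : realType) (X A : ptopologicalType) (J : nat).
Variable M : impulse_model R X A J.
Hypothesis CII : condition_II M.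

(** Turns a plan into a strategy that ignores the history, so that infima over strategies are at
    most those over plans. *)
Definition open_loop (b : nat -> action R A) : strategy R X A :=
  fun n => (kdirac (@measurable_cst _ _ (history R X A n) (action R A) setT (b n)) : R.-pker _ ~> _).

Lemma law_open_loop b x n (g : step R X A -> \bar R) :
  measurable_fun [set: step R X A] g -> (forall z, 0 <= g z) ->
  \int[law M (open_loop b) x]_w g (w n) = g (path M x b n, b n).
Proof.
have act m (f : step R X A -> \bar R) :
    measurable_fun [set: step R X A] f -> (forall z, 0 <= f z) ->
    \int[law M (open_loop b) x]_w f (w m) = \int[law M (open_loop b) x]_w f ((w m).1, b m).
  move=> mf f0; rewrite (law_action_state CII _ _ _ mf f0).
  apply: eq_integral => w _; rewrite integral_dirac ?diracT ?mul1e//.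
  exact: (measurableT_comp mf (pair1_measurable _)).
elim: n g => [|n IH] g mg g0; rewrite act//.
  rewrite (law_start CII _ _ (g := fun y => g (y, b 0%N)))//.
  by apply: (measurableT_comp mg); exact: pair2_measurable.
have mg1 : measurable_fun [set: state X] (fun y => g (y, b n.+1)).
  by apply: (measurableT_comp mg); exact: pair2_measurable.
rewrite (law_next CII _ _ mg1)//.
rewrite (IH (fun z => g (Defs.next M z.1 z.2, b n.+1)))//.
exact: (measurableT_comp mg1 (measurable_next CII)).
Qed.

End open_loop.

(** * Weighted costs and the set V *)

Section weighted_cost.
Context (R : realType) (X A : ptopologicalType) (J : nat).
Variable M : impulse_model R X A J.
Hypothesis CII : condition_II M.
Local Notation time := (one_point_compactification (set_type (half_line R))).
Variable lam : 'I_J.+1 -> R.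

Definition weighted_cost (x : state X) (b : action R A) : \bar R :=
  \sum_j (lam j)%:E * cost M j x b.

Lemma weighted_cost_cemetery b : weighted_cost None b = 0.
Proof. by rewrite /weighted_cost big1// => j _; rewrite mule0. Qed.

Hypothesis lam0 : forall j, (0 <= lam j)%R.

Let wc_ge0 j x b : 0 <= (lam j)%:E * cost M j x b.
Proof. by rewrite mule_ge0 ?lee_fin ?cost_ge0. Qed.

Lemma weighted_cost_ge0 x b : 0 <= weighted_cost x b.
Proof. exact: sume_ge0. Qed.

Lemma weighted_cost_lsc (z : with_cemetery X * (time * A)) :
  liminf_ge (nbhs z) (fun z => weighted_cost z.1 z.2) (weighted_cost z.1 z.2).
Proof.
apply: liminf_ge_sum => j; first exact: wc_ge0.
apply: liminf_geM => //; [exact: cost_ge0|exact: cvg_cst|exact: nearW| |exact: (cost_lsc CII)].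
by apply: nearW => y; exact: cost_ge0.
Qed.

Lemma plan_weighted_cost x b :
  plan_cost M weighted_cost x b = \sum_j (lam j)%:E * plan_cost M (cost M j) x b.
Proof.
rewrite /plan_cost /weighted_cost nneseries_sum//; apply: eq_bigr => j _.
by rewrite nneseriesZl// => n _; exact: cost_ge0.
Qed.

Let measurable_cost_at j n :
  measurable_fun [set: trajectory R X A]
    (fun w : trajectory R X A => cost M j (w n).1 (w n).2).
Proof. exact: (measurableT_comp (measurable_cost CII j) (measurable_step_at n)). Qed.

Lemma total_costE j x pi : total_cost M j x pi =
  \sum_(0 <= n <oo) \int[law M pi x]_w cost M j (w n).1 (w n).2.
Proof. by apply: integral_nneseries => // n w _; exact: cost_ge0. Qed.

Lemma total_weighted_cost x pi : \sum_j (lam j)%:E * total_cost M j x pi =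
  \sum_(0 <= n <oo) \int[law M pi x]_w weighted_cost (w n).1 (w n).2.
Proof.
have i0 j n : 0 <= \int[law M pi x]_w cost M j (w n).1 (w n).2.
  by apply: integral_ge0 => w _; exact: cost_ge0.
rewrite (eq_eseriesr (g := fun n => \sum_j (lam j)%:E *
    \int[law M pi x]_w cost M j (w n).1 (w n).2)); last first.
  move=> n _; rewrite /weighted_cost ge0_integral_sum//; last first.
    by move=> j; exact: measurable_funeM.
  apply: eq_bigr => j _; rewrite ge0_integralZl_EFin// => w _; exact: cost_ge0.
rewrite nneseries_sum => [|j n _]; last by rewrite mule_ge0 ?lee_fin.
by apply: eq_bigr => j _; rewrite nneseriesZl// total_costE.
Qed.

Lemma value_le_total_cost x pi :
  value M weighted_cost x <= \sum_j (lam j)%:E * total_cost M j x pi.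
Proof.
rewrite total_weighted_cost; apply: (value_le_law CII) => //.
- exact: weighted_cost_ge0.
- exact: weighted_cost_lsc.
- exact: weighted_cost_cemetery.
Qed.

End weighted_cost.

Section aggregate.
Context (R : realType) (X A : ptopologicalType) (J : nat).
Variable M : impulse_model R X A J.
Hypothesis CII : condition_II M.
Local Notation unit_cost := (weighted_cost M (fun=> 1%R)).

Let unit_ge0 (j : 'I_J.+1) : (0 <= 1 :> R)%R. Proof. exact: ler01. Qed.

Lemma unit_costE x b : unit_cost x b = \sum_(j < J.+1) cost M j x b.
Proof. by apply: eq_bigr => j _; rewrite mul1e. Qed.

Let measurable_unit_cost :
  measurable_fun [set: step R X A] (fun z : step R X A => unit_cost z.1 z.2).
Proof. by apply: (measurable_lsc_step M) => z; exact: weighted_cost_lsc. Qed.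

Let measurable_unit_cost_at n :
  measurable_fun [set: trajectory R X A]
    (fun w : trajectory R X A => unit_cost (w n).1 (w n).2).
Proof.
exact: (measurableT_comp measurable_unit_cost (measurable_step_at n)).
Qed.

Lemma aggregate_costE x pi : aggregate_cost M x pi =
  \sum_(0 <= n <oo) \int[law M pi x]_w unit_cost (w n).1 (w n).2.
Proof.
rewrite /aggregate_cost -integral_nneseries//; last first.
  by move=> n w _; exact: weighted_cost_ge0.
  apply: eq_integral => w _; apply: eq_eseriesr => n _.
  by rewrite unit_costE.
Qed.

(** Open-loop strategies give one inequality, the finite-horizon bound along the law the other.
    Membership in V becomes a statement about plans. *)
Lemma optimal_aggregate_costE x : optimal_aggregate_cost M x = value M unit_cost x.
Proof.
apply/eqP; rewrite eq_le; apply/andP; split.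
  apply: le_ereal_inf_tmp => _ [b _ <-].
  have le_open : optimal_aggregate_cost M x <= aggregate_cost M x (open_loop X b).
    by apply: ereal_inf_lbound; exists (open_loop X b).
  apply: le_trans le_open _.
  rewrite aggregate_costE /plan_cost; apply: lee_nneseries => n _.
    by move=> _; apply: integral_ge0 => w _; exact: weighted_cost_ge0.
  rewrite (law_open_loop CII b x n (g := fun z => unit_cost z.1 z.2))//.
  by move=> z; exact: weighted_cost_ge0.
apply: le_ereal_inf_tmp => _ [pi _ <-]; rewrite aggregate_costE.
apply: (value_le_law CII).
- exact: weighted_cost_ge0.
- by move=> z; exact: weighted_cost_lsc.
- exact: weighted_cost_cemetery.
Qed.

Lemma in_VE x : V M x <-> 0 < value M unit_cost x.
Proof. by rewrite /V /= optimal_aggregate_costE. Qed.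

Lemma notin_VE x : ~ V M x <-> value M unit_cost x = 0.
Proof.
rewrite in_VE; split=> [|->]; last by rewrite ltxx.
move/negP; rewrite -leNgt => v0; apply/eqP; rewrite eq_le v0 value_ge0//.
exact: weighted_cost_ge0.
Qed.

Lemma measurable_V : measurable (V M).
Proof.
rewrite (_ : V M = [set x : state X | 0 < value M unit_cost x]).
  apply: (measurable_value_gt0 CII).
  - exact: weighted_cost_ge0.
  - by move=> z; exact: weighted_cost_lsc.
  - exact: weighted_cost_cemetery.
by apply/seteqP; split => x /in_VE.
Qed.

Lemma measurable_VB : measurable (VB M).
Proof. by apply: measurableX => //; exact: measurable_V. Qed.

Section law_stationary.
Variable k : R.-pker (state X) ~> (action R A).

Lemma measurable_int_kernel (g : step R X A -> \bar R) :
  measurable_fun [set: step R X A] g -> (forall z, 0 <= g z) ->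
  measurable_fun [set: state X] (fun x => \int[k x]_b g (x, b)).
Proof. by move=> mg g0; exact: measurable_fun_integral_finite_kernel. Qed.

Lemma law_stationary x n (g : step R X A -> \bar R) :
  measurable_fun [set: step R X A] g -> (forall z, 0 <= g z) ->
  \int[law M (stationary k) x]_w g (w n) =
  \int[law M (stationary k) x]_w \int[k (w n).1]_b g ((w n).1, b).
Proof. exact: law_action_state. Qed.

End law_stationary.

Section optimal_selector.
Variables (f : state X -> action R A) (mf : measurable_fun [set: state X] f).
Hypothesis f_opt : forall x : state X,
  aggregate_cost M x (deterministic mf) = optimal_aggregate_cost M x.
Hypothesis f_stay : forall x : state X, ~ V M x -> transition M x (f x) (V M) = 0.

Lemma next_notin_V x : ~ V M x -> ~ V M (Defs.next M x (f x)).
Proof.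
move=> /f_stay tV Vn; move: tV; rewrite [LHS](_ : _ = 1) => [/eqP|].
  by rewrite onee_eq0.
by rewrite /transition /= /dirac indicE mem_set.
Qed.

(** From x off V the strategy f has aggregate cost 0, of which the cost of the first step is a
    part. *)
Lemma cost_notin_V x : ~ V M x -> forall j, cost M j x (f x) = 0.
Proof.
move=> Vx; suff : unit_cost x (f x) = 0.
  rewrite unit_costE => h j; apply/eqP; rewrite eq_le cost_ge0 andbT -[leRHS]h.
  by rewrite (bigD1 j)//= leeDl// sume_ge0// => i _; exact: cost_ge0.
apply/eqP; rewrite eq_le weighted_cost_ge0// andbT.
have mu : measurable_fun [set: step R X A] (fun z : step R X A => unit_cost z.1 z.2).
  by apply: (measurable_lsc_step M) => z; exact: weighted_cost_lsc.
have u0 (z : step R X A) : 0 <= unit_cost z.1 z.2 by exact: weighted_cost_ge0.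
have <- : aggregate_cost M x (deterministic mf) = 0.
  by rewrite f_opt optimal_aggregate_costE; exact/notin_VE.
rewrite aggregate_costE nneseries_recl//; last first.
  by move=> n _; apply: integral_ge0 => w _; exact: weighted_cost_ge0.
rewrite (@law_stationary (kdirac mf) x 0%N _ mu u0).
rewrite (eq_integral (fun w : trajectory R X A => unit_cost (w 0%N).1 (f (w 0%N).1))); last first.
  move=> w _; rewrite integral_dirac ?diracT ?mul1e//.
  by apply: (measurableT_comp mu); exact: pair1_measurable.
rewrite (law_start CII _ x (g := fun y => unit_cost y (f y)))//.
  rewrite leeDl//; apply: nneseries_ge0 => n _ _; apply: integral_ge0 => w _.
  exact: weighted_cost_ge0.
  exact: (measurableT_comp mu (measurable_fun_pair (@measurable_id _ _ setT) mf)).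
by move=> y; exact: weighted_cost_ge0.
Qed.

(** Iterating f gives a plan that stays off V and costs nothing. The horizon values then vanish off
    V too, which makes them test functions for the flow equation. *)
Lemma value_notin_V x lam : (forall j, (0 <= lam j)%R) -> ~ V M x ->
  value M (weighted_cost M lam) x = 0.
Proof.
move=> lam0 Vx; apply/eqP; rewrite eq_le value_ge0 ?andbT; last exact: weighted_cost_ge0.
pose s := fun n => iter n (fun y => Defs.next M y (f y)) x.
have sE n : path M x (f \o s) n = s n by elim: n => //= n ->.
have Vs n : ~ V M (s n) by elim: n => [//|n IH]; exact: (next_notin_V IH).
apply: le_trans (_ : _ <= plan_cost M (weighted_cost M lam) x (f \o s)) _.
  by apply: ereal_inf_lbound; exists (f \o s).
rewrite /plan_cost eseries0// => n _ _.
rewrite sE /weighted_cost big1// => j _ /=.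
by rewrite (cost_notin_V (Vs n)) mule0.
Qed.

End optimal_selector.

End aggregate.

(** * Feasible measures of the linear program *)

Section image_measure.
Context d1 d2 (T : measurableType d1) (U : measurableType d2) (R : realType).
Variables (phi : T -> U) (mphi : measurable_fun [set: T] phi).
Variable mu : {measure set T -> \bar R}.

Definition image_measure of measurable_fun [set: T] phi :=
  fun E : set U => mu (phi @^-1` E).

Let image0 : image_measure mphi set0 = 0.
Proof. by rewrite /image_measure preimage_set0 measure0. Qed.

Let image_ge0 E : 0 <= image_measure mphi E. Proof. exact: measure_ge0. Qed.

Let mpre E : measurable E -> measurable (phi @^-1` E).
Proof. by move=> mE; rewrite -[X in measurable X]setTI; exact: mphi. Qed.

Let image_sigma_additive : semi_sigma_additive (image_measure mphi).
Proof.
move=> F mF tF mUF; rewrite /image_measure preimage_bigcup.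
apply: measure_semi_sigma_additive => //.
- by move=> n; exact: mpre.
- apply/trivIsetP => /= i j _ _ ij; rewrite -preimage_setI.
  by move/trivIsetP : tF => /(_ _ _ _ _ ij) ->//; rewrite preimage_set0.
- by rewrite -preimage_bigcup; exact: mpre.
Qed.

HB.instance Definition _ := isMeasure.Build _ U R (image_measure mphi)
  image0 image_ge0 image_sigma_additive.

Lemma ge0_integral_image (g : U -> \bar R) : measurable_fun [set: U] g ->
  (forall u, 0 <= g u) -> \int[image_measure mphi]_u g u = \int[mu]_t g (phi t).
Proof. by move=> mg g0; apply: (eq_integral_image (phi := id) (psi := phi)). Qed.

End image_measure.

Lemma integral_setT_support d (T : measurableType d) (R : realType)
    (mu : {measure set T -> \bar R}) (D : set T) (g : T -> \bar R) :
  (forall x, ~ D x -> g x = 0) -> \int[mu]_x g x = \int[mu]_(x in D) g x.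
Proof.
move=> gD; rewrite [RHS]integral_mkcond; apply: eq_integral => x _; rewrite patchE.
by case: ifPn => // /negP; rewrite inE => /gD.
Qed.

Section linear_program.
Context (R : realType) (X A : ptopologicalType) (J : nat).
Variable M : impulse_model R X A J.
Hypothesis CII : condition_II M.
Hypothesis value0 : forall (lam : 'I_J.+1 -> R), (forall j, (0 <= lam j)%R) ->
  forall x, ~ V M x -> value M (weighted_cost M lam) x = 0.
Variables (x0 : X) (nu : {measure set (step R X A) -> \bar R}).
Hypothesis nuV : nu (~` VB M) = 0.
Hypothesis nu_flow : forall G : set (state X), measurable G -> G `<=` V M ->
  nu (G `*` setT) =
  \d_(Some x0 : state X) G + \int[nu]_(z in VB M) transition M z.1 z.2 G.

Let mVB : measurable (VB M) := measurable_VB CII.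

Lemma integral_VB (g : step R X A -> \bar R) :
  measurable_fun [set: step R X A] g -> (forall z, 0 <= g z) ->
  \int[nu]_z g z = \int[nu]_(z in VB M) g z.
Proof.
move=> mg g0; rewrite (ge0_negligible_integral (measurableC mVB))// setTD.
by rewrite setCK.
Qed.

(** On subsets of V, the image of nu under the state is the Dirac mass plus its image under [next];
    for g vanishing off V only such subsets matter. *)
Lemma flow_integral (g : state X -> \bar R) :
  measurable_fun [set: state X] g -> (forall x, 0 <= g x) ->
  (forall x, ~ V M x -> g x = 0) ->
  \int[nu]_z g z.1 = g (Some x0) + \int[nu]_z g (Defs.next M z.1 z.2).
Proof.
move=> mg g0 gV.
have mfst : measurable_fun [set: step R X A] (fst : step R X A -> state X).
  exact: measurable_fst.
have mn := measurable_next CII.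
rewrite -(ge0_integral_image mfst nu mg g0) -(ge0_integral_image mn nu mg g0).
have -> : g (Some x0) = \int[\d_(Some x0 : state X)]_x g x.
  by rewrite integral_dirac// diracT mul1e.
rewrite -ge0_integral_measure_add// !(integral_setT_support _ gV).
apply: eq_measure_integral => G mG GV.
rewrite [RHS]measure_addE /= /image_measure (_ : fst @^-1` G = G `*` setT); last first.
  by apply/seteqP; split => z //= [].
have mnG : measurable [set z : step R X A | G (Defs.next M z.1 z.2)].
  by have := mn; move=> /(_ measurableT G mG); rewrite setTI.
rewrite nu_flow// -integral_VB//; last first.
- rewrite (_ : (fun z => _) = fun z : step R X A => (\1_G (Defs.next M z.1 z.2))%:E)//.
  by apply/measurable_EFinP; exact: measurable_indic mnG.
congr (_ + _).
rewrite -[RHS](_ : \int[nu]_z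
  (\1_[set z : step R X A | G (Defs.next M z.1 z.2)] z)%:E = _)//.
by rewrite integral_indic// setIT.
Qed.

Section value_bound.
Variable lam : 'I_J.+1 -> R.
Hypothesis lam0 : forall j, (0 <= lam j)%R.
Local Notation c := (weighted_cost M lam).
Local Notation h := (horizon_value M c).

Let c0 x b : 0 <= c x b. Proof. exact: weighted_cost_ge0. Qed.

Let mc : measurable_fun [set: step R X A] (fun z : step R X A => c z.1 z.2).
Proof. by apply: (measurable_lsc_step M) => z; exact: weighted_cost_lsc. Qed.

Let h0 n x : 0 <= h n x. Proof. exact: horizon_value_ge0. Qed.

Let mh n : measurable_fun [set: state X] (h n).
Proof.
apply: (measurable_horizon_value CII) => //.
- by move=> z; exact: weighted_cost_lsc.
- exact: weighted_cost_cemetery.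
Qed.

Let hV n x : ~ V M x -> h n x = 0.
Proof.
move=> /(value0 lam0) vx; apply/eqP; rewrite eq_le h0 andbT -[leRHS]vx.
exact: horizon_value_le_value.
Qed.

Let mhn n : measurable_fun [set: step R X A]
  (fun z : step R X A => h n (Defs.next M z.1 z.2)).
Proof. exact: (measurableT_comp (mh n) (measurable_next CII)). Qed.

Let C := \int[nu]_z c z.1 z.2.
Let I n := \int[nu]_z h n z.1.

Let IE n : I n = h n (Some x0) + \int[nu]_z h n (Defs.next M z.1 z.2).
Proof. by apply: flow_integral => //; exact: hV. Qed.

Let I_step n : I n.+1 <= C + \int[nu]_z h n (Defs.next M z.1 z.2).
Proof.
rewrite /C -ge0_integralD//; apply: ge0_le_integral => //.
- exact: (measurableT_comp (mh n.+1) measurable_fst).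
- exact: emeasurable_funD.
- by move=> z _; exact: horizon_value_bellman.
Qed.

Let I_homo n : I n <= I n.+1.
Proof.
apply: ge0_le_integral => //.
- exact: (measurableT_comp (mh n) measurable_fst).
- exact: (measurableT_comp (mh n.+1) measurable_fst).
- by move=> z _; exact: horizon_value_homo.
Qed.

(** nu may have infinite mass, so finiteness comes from the flow equation: the integral of h_n after
    one step is at most I n, whence I n.+1 <= C + I n, starting from I 0 = 0. *)
Let I_fin n : C < +oo -> I n < +oo.
Proof.
move=> Coo; elim: n => [|n IH].
  rewrite /I integral0_eq// => z _; apply: horizon_value_0; exact: weighted_cost_ge0.
apply: le_lt_trans (I_step n) _; rewrite lte_add_pinfty//.
by apply: le_lt_trans IH; rewrite IE leeDr.
Qed.

(** By the flow equation I n is h_n(x_0) plus the integral of h_n after one step, while I n <= I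
    n.+1 is at most C plus that integral. Finiteness permits the cancellation. *)
Lemma value_le_lp : value M c (Some x0) <= \int[nu]_z c z.1 z.2.
Proof.
have [->|Coo] := eqVneq (\int[nu]_z c z.1 z.2) +oo; first exact: leey.
have {}Coo : C < +oo by rewrite ltey.
apply: (value_le_of_horizon CII) => //.
- by move=> z; exact: weighted_cost_lsc.
- exact: weighted_cost_cemetery.
- exact: integral_ge0.
move=> n.
have Ifin : I n \is a fin_num by rewrite ge0_fin_numE ?I_fin// integral_ge0.
rewrite -(leeD2lE _ _ Ifin) -/C addeC [leRHS]addeC.
apply: le_trans (leeD2l _ (I_homo n)) _.
apply: le_trans (leeD2l _ (I_step n)) _.
by rewrite addeCA IE.
Qed.

Lemma value_le_lp_costs : value M c (Some x0) <=
  \sum_j (lam j)%:E * \int[nu]_(z in VB M) cost M j z.1 z.2.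
Proof.
apply: le_trans value_le_lp _; rewrite /weighted_cost ge0_integral_sum//; last first.
- by move=> j z _; rewrite mule_ge0 ?lee_fin ?cost_ge0.
- by move=> j; apply: measurable_funeM; exact: measurable_cost.
apply: lee_sum => j _; rewrite ge0_integralZl_EFin//.
- by rewrite -integral_VB//; [exact: measurable_cost|move=> z; exact: cost_ge0].
- by move=> z _; exact: cost_ge0.
- exact: measurable_cost.
Qed.

End value_bound.
End linear_program.

(** * Occupation measures of mixtures and their disintegration *)

Lemma ge0_integral_mrestr d (T : measurableType d) (R : realType)
    (mu : {measure set T -> \bar R}) (D : set T) (mD : measurable D) (g : T -> \bar R) :
  measurable_fun [set: T] g -> (forall x, 0 <= g x) ->
  \int[mrestr mu mD]_x g x = \int[mu]_(x in D) g x.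
Proof.
move=> mg g0; rewrite (@ge0_negligible_integral _ _ _ (mrestr mu mD) _ _ _ (measurableC mD))//; last first.
  by rewrite /= /mrestr setICl measure0.
rewrite setTD setCK; apply: eq_measure_integral => E mE /setIidl ED.
by rewrite /= /mrestr -[in RHS]ED.
Qed.

Section atomic_disintegration.
Context d1 d2 (T : measurableType d1) (U : measurableType d2) (R : realType).
Variables (mu : {measure set (T * U) -> \bar R}) (e : nat -> T).
Hypothesis mset1 : forall x : T, measurable [set x].
Hypothesis mu_atoms : mu (~` (range e `*` setT)) = 0.
Hypothesis mu_finite : forall x, mu ([set x] `*` setT) < +oo.
Variables (f : T -> U) (mf : measurable_fun [set: T] f).

Let mfiber x : measurable ([set x] `*` setT : set (T * U)%type).
Proof. exact: measurableX. Qed.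

Let msnd : measurable_fun [set: T * U] (snd : T * U -> U).
Proof. exact: measurable_snd. Qed.

Definition slice (x : T) : {measure set U -> \bar R} :=
  image_measure (mrestr mu (mfiber x)) msnd.

Lemma sliceE x E : slice x E = mu ([set x] `*` E).
Proof.
rewrite /slice /= /image_measure /mrestr; congr (mu _).
by apply/seteqP; split => [z [? [? _]]|z [? ?]].
Qed.

(** [mnormalize] falls back on the Dirac mass at f x for slices of mass 0 or oo. Under [mu_finite]
    only null slices do so, which is how f^* later completes the kernel off V. *)
Definition conditional_fun (x : T) : {measure set U -> \bar R} :=
  mnormalize (slice x) (\d_(f x)).

Lemma range_measurable (D : set T) : D `<=` range e -> measurable D.
Proof.
move=> De; rewrite (_ : D = \bigcup_n (if `[< D (e n) >] then [set e n] else set0)).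
  by apply: bigcupT_measurable => n; case: ifP.
apply/seteqP; split => x.
  by move=> Dx; have [n _ enx] := De _ Dx; exists n => //; rewrite -enx asboolT// enx.
by move=> [n _]; case: ifPn => // /asboolP ? ->.
Qed.

(** Every subset of the countable set [range e] is measurable, so a function may be altered there
    arbitrarily. *)
Lemma measurable_off_range (g h : T -> \bar R) : measurable_fun [set: T] g ->
  (forall x, ~ range e x -> h x = g x) -> measurable_fun [set: T] h.
Proof.
move=> mg hg _ B mB; rewrite setTI.
have -> : h @^-1` B = (g @^-1` B `\` range e) `|` (h @^-1` B `&` range e).
  apply/seteqP; split => x /=.
    by move=> Bx; have [ex|ex] := pselect (range e x); [right|left; rewrite -hg].
  by move=> [[? ex]|[]//]; rewrite hg.
apply: measurableU; last exact: range_measurable.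
apply: measurableD; last exact: range_measurable.
by rewrite -[X in measurable X]setTI; exact: mg.
Qed.

Lemma fiber_off_range x : ~ range e x -> mu ([set x] `*` setT) = 0.
Proof.
move=> ex; apply: (subset_measure0 (mfiber x) _ _ mu_atoms).
  by apply: measurableC; apply: measurableX => //; exact: range_measurable.
by move=> z [/= zx _] [/=]; rewrite zx => /ex.
Qed.

Lemma atomic_sigma_finite : sigma_finite setT mu.
Proof.
have mR : measurable (~` (range e `*` setT : set (T * U)%type)).
  by apply: measurableC; apply: measurableX => //; exact: range_measurable.
exists (fun n => if n is m.+1 then [set e m] `*` setT else ~` (range e `*` setT)).
  apply/seteqP; split => // -[x u] _.
  have [[n _ enx]|ex] := pselect (range e x); first by exists n.+1.
  by exists 0%N => // -[/= /ex].
by move=> [|n]; split => //; rewrite mu_atoms.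
Qed.

Lemma conditional_null x E : mu ([set x] `*` setT) = 0 ->
  conditional_fun x E = \d_(f x) E.
Proof. by move=> mx; rewrite /conditional_fun /= /mnormalize sliceE mx eqxx. Qed.

Let measurable_conditional E : measurable E ->
  measurable_fun [set: T] (conditional_fun ^~ E).
Proof.
move=> mE; apply: (@measurable_off_range (fun x => \d_(f x) E)).
  exact: (@measurable_kernel _ _ _ _ _ (kdirac mf)).
by move=> x ex; rewrite conditional_null// fiber_off_range.
Qed.

HB.instance Definition _ := isKernel.Build _ _ _ _ _
  conditional_fun measurable_conditional.

Let conditionalT x : conditional_fun x [set: _] = 1.
Proof. exact: probability_setT. Qed.

HB.instance Definition _ := Kernel_isProbability.Build _ _ _ _ _
  conditional_fun conditionalT.

Definition conditional : R.-pker T ~> U := conditional_fun.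

Lemma fiber_conditional x E : measurable E ->
  mu ([set x] `*` E) = mu ([set x] `*` setT) * conditional x E.
Proof.
move=> mE; have [m0|m0] := eqVneq (mu ([set x] `*` setT)) 0.
  rewrite m0 mul0e; apply: (subset_measure0 _ _ _ m0) => //; first exact: measurableX.
  by move=> z [/= ? _]; split.
have mfin : mu ([set x] `*` setT) \is a fin_num by rewrite ge0_fin_numE.
rewrite /conditional /= /conditional_fun /= /mnormalize !sliceE (negPf m0)/=.
rewrite lt_eqF//= muleCA -{1}(fineK mfin) -EFinM divff ?mule1//.
  exact/esym/sliceE.
by rewrite -eqe fineK.
Qed.

Lemma disintegration (g : T * U -> \bar R) :
  measurable_fun [set: T * U] g -> (forall z, 0 <= g z) ->
  \int[mu]_z g z = \int[mu]_z \int[conditional z.1]_b g (z.1, b).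
Proof.
move=> mg g0; pose gbar x := \int[conditional x]_b g (x, b).
have mgbar : measurable_fun [set: T] gbar by exact: measurable_fun_integral_finite_kernel.
have gbar0 x : 0 <= gbar x by apply: integral_ge0.
have mgx x : measurable_fun [set: U] (fun b => g (x, b)).
  by apply: (measurableT_comp mg); exact: pair1_measurable.
have fiber x : \int[mu]_(z in [set x] `*` setT) g z =
    \int[mu]_(z in [set x] `*` setT) gbar z.1.
  rewrite [RHS](eq_integral (fun=> gbar x)) => [|z]; last by rewrite inE => -[/= zx _]; rewrite zx.
  rewrite [RHS]integral_cst//.
  transitivity (\int[slice x]_b g (x, b)).
    rewrite [RHS]ge0_integral_image// ge0_integral_mrestr//; last first.
      exact: (measurableT_comp (mgx x) measurable_snd).
    by apply: eq_integral => z; rewrite inE => -[/= zx _]; rewrite -zx -surjective_pairing.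
  have mfin : mu ([set x] `*` setT) \is a fin_num by rewrite ge0_fin_numE.
  have m0 : (0 <= fine (mu ([set x] `*` setT)))%R by exact: fine_ge0.
  rewrite (eq_measure_integral (mscale (NngNum m0) (conditional x))); last first.
    move=> E mE _; rewrite [LHS]sliceE [RHS](_ : _ = mu ([set x] `*` setT) * conditional x E).
      exact: fiber_conditional.
    by rewrite -[in RHS](fineK mfin).
  by rewrite ge0_integral_mscale//= fineK// muleC.
(* [e] may repeat values; [seqDU] keeps one occurrence of each, so every piece is a whole fiber or
   empty. *)
pose D n := seqDU (fun n => [set e n]) n `*` [set: U].
have De n : seqDU (fun n => [set e n]) n `<=` [set e n] by move=> x [].
have mD n : measurable (D n : set (T * U)%type).
  apply: measurableX => //; apply: range_measurable => x /De ->; exact: imageT.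
have tD : trivIset setT D.
  apply/trivIsetP => i j _ _ ij; rewrite /D -setXI setTI.
  by move/trivIsetP : (trivIset_seqDU (fun n => [set e n])) => /(_ i j I I ij) ->; rewrite set0X.
have cD : \bigcup_n D n = range e `*` setT.
  rewrite -setX_bigcupl -seqDU_bigcup_eq; congr (_ `*` _).
  by apply/seteqP; split => [x [n _ ->]|x [n _ <-]]; exists n.
have mR : measurable (~` (range e `*` setT : set (T * U)%type)).
  by apply: measurableC; apply: measurableX => //; exact: range_measurable.
have split (h : T * U -> \bar R) : measurable_fun [set: T * U] h -> (forall z, 0 <= h z) ->
    \int[mu]_z h z = \sum_(0 <= n <oo) \int[mu]_(z in D n) h z.
  move=> mh h0; rewrite (ge0_negligible_integral mR measurableT)// setTD setCK -cD.
  by rewrite ge0_integral_bigcup//; exact: measurable_funTS.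
rewrite (split _ mg g0) (split (fun z => gbar z.1))//; last exact: (measurableT_comp mgbar measurable_fst).
apply: eq_eseriesr => n _; rewrite /D.
by have [->|->] := subset_set1 (De n); [rewrite set0X !integral_set0|exact: fiber].
Qed.

End atomic_disintegration.

Section path_tails.
Context (R : realType) (X A : ptopologicalType) (J : nat).
Variables (M : impulse_model R X A J) (c : state X -> action R A -> \bar R).
Hypothesis c0 : forall x b, 0 <= c x b.

Lemma path_add x b m n :
  path M x b (n + m)%N = path M (path M x b m) (fun k => b (k + m)%N) n.
Proof. by elim: n => //= n ->. Qed.

Lemma value_le_tail x b n : value M c (path M x b n) <=
  \sum_(n <= k <oo) c (path M x b k) (b k).
Proof.
rewrite -nneseries_addn//; apply: le_trans (_ : _ <= plan_cost M c _ (fun k => b (k + n)%N)) _.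
  by apply: ereal_inf_lbound; exists (fun k => b (k + n)%N).
by apply: lee_nneseries => // k _; rewrite path_add.
Qed.

(* The tails of a convergent series of costs bound the value at a state that
   is visited infinitely often. *)
Lemma value_recurrent x y b : plan_cost M c y b < +oo ->
  (forall m, exists2 n, (m <= n)%N & path M y b n = x) -> value M c x = 0.
Proof.
move=> fin rec; apply/eqP; rewrite eq_le value_ge0// andbT leNgt; apply/negP => vx.
have tail0 := nneseries_tail_cvg fin (fun _ _ => c0 _ _).
have : \forall n \near \oo, \sum_(n <= k <oo) c (path M y b k) (b k) < value M c x.
  have nb : nbhs (0 : \bar R) [set r | r < value M c x].
    by apply: open_nbhs_nbhs; split => //; exact: open_ereal_lt_ereal.
  exact: tail0 nb.
move=> [m _ small]; have [n mn nx] := rec m.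
have := le_lt_trans (value_le_tail y b n) (small n mn).
by rewrite nx ltxx.
Qed.

End path_tails.

Section mixture_occupation.
Context (R : realType) (X A : ptopologicalType) (J : nat).
Variable M : impulse_model R X A J.
Hypothesis CII : condition_II M.
Variables (x0 : X) (N : nat) (p : nat -> R) (b : nat -> nat -> action R A).
Hypothesis p0 : forall i, (0 <= p i)%R.

Let s i n : state X := path M (Some x0) (b i) n.

(** Stopping is absorbing: a path that has left V stays discarded even if it returns. *)
Definition inside i n : bool := `[< forall m, (m <= n)%N -> V M (s i m) >].

Definition weight i n : R := if inside i n then p i else 0%R.

Lemma weight_ge0 i n : (0 <= weight i n)%R.
Proof. by rewrite /weight; case: ifP. Qed.

Lemma inside_V i n : inside i n -> V M (s i n).
Proof. by move=> /asboolP; exact. Qed.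

Lemma weight_notin_V i n : ~ V M (s i n) -> weight i n = 0%R.
Proof. by rewrite /weight; case: ifP => // /inside_V. Qed.

Lemma inside_next i n : V M (s i n.+1) -> inside i n.+1 = inside i n.
Proof.
move=> Vn; apply/idP/idP => /asboolP h; apply/asboolP => m mn.
  by apply: h; exact: leqW.
by move: mn; rewrite leq_eqVlt => /predU1P[->//|]; exact: h.
Qed.

Definition mixture_occupation : {measure set (step R X A) -> \bar R} :=
  msum (fun i => mseries (fun n =>
    mscale (NngNum (weight_ge0 i n)) (dirac ((s i n, b i n) : step R X A))) 0) N.

Lemma mixture_integral (g : step R X A -> \bar R) :
  measurable_fun [set: step R X A] g -> (forall z, 0 <= g z) ->
  \int[mixture_occupation]_z g z =
  \sum_(i < N) \sum_(0 <= n <oo) (weight i n)%:E * g (s i n, b i n).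
Proof.
move=> mg g0; rewrite ge0_integral_measure_sum//; apply: eq_bigr => i _.
rewrite ge0_integral_measure_series//; apply: eq_eseriesr => n _.
by rewrite ge0_integral_mscale//= integral_dirac// diracT mul1e.
Qed.

Lemma mixture_measure (G : set (step R X A)) : measurable G ->
  mixture_occupation G =
  \sum_(i < N) \sum_(0 <= n <oo) (weight i n)%:E * (\1_G (s i n, b i n))%:E.
Proof.
move=> mG; rewrite -[G in LHS]setIT -integral_indic//.
rewrite mixture_integral//; first by apply/measurable_EFinP; exact: measurable_indic.
Qed.

Lemma mixture_VB : mixture_occupation (~` VB M) = 0.
Proof.
rewrite mixture_measure; last by apply: measurableC; exact: measurable_VB.
rewrite big1// => i _; rewrite eseries0// => n _ _.
have [Vs|Vs] := pselect (V M (s i n)); last by rewrite weight_notin_V// mul0e.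
by rewrite indicE memNset ?mule0// => /= -[]; split.
Qed.

(** Only steps with state in V contribute, and by [inside_next] the weight at time n + 1 is then
    that at time n. The two series differ by a shift, whose first term is g at x_0. *)
Lemma mixture_flow (g : state X -> \bar R) : (\sum_(i < N) p i = 1)%R ->
  measurable_fun [set: state X] g -> (forall x, 0 <= g x) ->
  (forall x, ~ V M x -> g x = 0) ->
  \int[mixture_occupation]_z g z.1 =
  g (Some x0) + \int[mixture_occupation]_z g (Defs.next M z.1 z.2).
Proof.
move=> p1 mg g0 gV.
rewrite mixture_integral//; last exact: (measurableT_comp mg measurable_fst).
rewrite mixture_integral//; last exact: (measurableT_comp mg (measurable_next CII)).
have -> : g (Some x0) = \sum_(i < N) (p i)%:E * g (Some x0).
  rewrite -ge0_sume_distrl; last by move=> i _; rewrite lee_fin.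
  by rewrite sumEFin p1 mul1e.
rewrite -big_split/=; apply: eq_bigr => i _.
have wg n : 0 <= (weight i n)%:E * g (s i n) by rewrite mule_ge0// lee_fin weight_ge0.
rewrite nneseries_recl// -nneseries_addn//; congr (_ + _).
  have [Vx|/gV ->] := pselect (V M (Some x0)); last by rewrite !mule0.
  rewrite /weight ifT//; apply/asboolP => m; rewrite leqn0 => /eqP ->; exact: Vx.
apply: eq_eseriesr => n _; rewrite addn1 -[Defs.next _ _ _]/(s i n.+1).
have [Vs|/gV ->] := pselect (V M (s i n.+1)); last by rewrite !mule0.
by rewrite /weight inside_next.
Qed.

Lemma mixture_cost (c : state X -> action R A -> \bar R) :
  measurable_fun [set: step R X A] (fun z : step R X A => c z.1 z.2) ->
  (forall x b, 0 <= c x b) ->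
  \int[mixture_occupation]_z c z.1 z.2 <=
  \sum_(i < N) (p i)%:E * plan_cost M c (Some x0) (b i).
Proof.
move=> mc c0; rewrite (@mixture_integral (fun z => c z.1 z.2))//=.
apply: lee_sum => i _; rewrite /plan_cost -nneseriesZl//.
apply: lee_nneseries => n _; first by move=> _; rewrite mule_ge0// lee_fin weight_ge0.
apply: lee_wpmul2r => //; rewrite lee_fin /weight.
by case: ifP.
Qed.

Local Notation unit_cost := (weighted_cost M (fun=> 1%R)).

Hypothesis finite_plans : forall i, (i < N)%N -> (0 < p i)%R ->
  plan_cost M unit_cost (Some x0) (b i) < +oo.

Lemma mixture_fiber x : mixture_occupation ([set x] `*` setT) < +oo.
Proof.
rewrite mixture_measure; last by apply: measurableX => //; exact: (measurable_state1 M).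
apply: lte_sum_pinfty => i _.
have [Vx|Vx] := pselect (V M x); last first.
  rewrite eseries0// => n _ _; have [sx|sx] := pselect (s i n = x).
    have Vs : ~ V M (s i n) by rewrite sx.
    by rewrite (weight_notin_V Vs) mul0e.
  by rewrite indicE memNset ?mule0// => -[].
have [pi0|] := eqVneq (p i) 0%R.
  by rewrite eseries0// => n _ _; rewrite /weight pi0 if_same mul0e.
rewrite neq_lt ltNge p0 /= => pi0.
have [m never] : exists m, forall n, (m <= n)%N -> s i n <> x.
  apply: contrapT => often; apply: (notin_VE CII x).2 => //.
  apply: (value_recurrent _ (finite_plans (ltn_ord i) pi0)).
    by move=> y a; exact: weighted_cost_ge0.
  move=> m; apply: contrapT => no; apply: often; exists m => n mn snx.
  by apply: no; exists n.
rewrite (nneseries_split 0 m)/=; last first.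
  by move=> k _; rewrite mule_ge0// lee_fin// weight_ge0.
rewrite [X in _ + X]eseries0 ?adde0; last first.
  move=> n mn _; rewrite indicE memNset ?mule0// => -[/= snx _].
  by apply: (never n) => //.
by apply: lte_sum_pinfty => n _; rewrite -EFinM ltry.
Qed.

Definition visited m : state X :=
  if unpickle m is Some (i, n) then s i n else Some x0.

Lemma mixture_visited : mixture_occupation (~` (range visited `*` setT)) = 0.
Proof.
have sv i n : range visited (s i n).
  by exists (pickle (i, n)) => //; rewrite /visited pickleK.
rewrite mixture_measure.
  rewrite big1// => i _; rewrite eseries0// => n _ _.
  by rewrite indicE memNset ?mule0//; apply; split; [exact: sv|].
apply: measurableC; apply: measurableX => //.
by apply: (range_measurable (e := visited)) => // x; exact: (measurable_state1 M).
Qed.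

End mixture_occupation.

(** * Costs in terms of occupation measures *)

Lemma mrestrE d (T : measurableType d) (R : realType)
    (mu : {measure set T -> \bar R}) (D : set T) (mD : measurable D) E :
  (mrestr mu mD : {measure set T -> \bar R}) E = mu (E `&` D).
Proof. by []. Qed.

Lemma image_measureE d1 d2 (T : measurableType d1) (U : measurableType d2) (R : realType)
    (phi : T -> U) (mphi : measurable_fun [set: T] phi)
    (mu : {measure set T -> \bar R}) E :
  (image_measure mu mphi : {measure set U -> \bar R}) E = mu (phi @^-1` E).
Proof. by []. Qed.

Section restrict.
Context d (T : measurableType d) (R : realType).
Implicit Types (D : set T) (g : T -> \bar R).

Lemma measurable_patch D g : measurable D -> measurable_fun [set: T] g ->
  measurable_fun [set: T] (g \_ D).
Proof.
move=> mD mg; apply/(measurable_restrict _ mD measurableT).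
by rewrite setTI; exact: measurable_funTS.
Qed.

Lemma patch_ge0 D g : (forall x, 0 <= g x) -> forall x, 0 <= (g \_ D) x.
Proof. by move=> g0 x; rewrite patchE; case: ifP. Qed.

End restrict.

(** * The stationary strategy of a disintegrated measure *)

Section stationary_cost.
Context (R : realType) (X A : ptopologicalType) (J : nat).
Variable M : impulse_model R X A J.
Hypothesis CII : condition_II M.
Variables (f : state X -> action R A) (k : R.-pker (state X) ~> (action R A)).
Hypothesis f_next : forall x, ~ V M x -> ~ V M (Defs.next M x (f x)).
Hypothesis f_cost : forall x, ~ V M x -> forall j, cost M j x (f x) = 0.
Hypothesis k_notin_V : forall x, ~ V M x ->
  forall E, measurable E -> k x E = \d_(f x) E.
Variables (x0 : X) (mu : {measure set (step R X A) -> \bar R}).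
Hypothesis mu_VB : mu (~` VB M) = 0.
Hypothesis mu_flow : forall g : state X -> \bar R,
  measurable_fun [set: state X] g -> (forall x, 0 <= g x) ->
  (forall x, ~ V M x -> g x = 0) ->
  \int[mu]_z g z.1 = g (Some x0) + \int[mu]_z g (Defs.next M z.1 z.2).
Hypothesis mu_k : forall g : step R X A -> \bar R,
  measurable_fun [set: step R X A] g -> (forall z, 0 <= g z) ->
  \int[mu]_z g z = \int[mu]_z \int[k z.1]_b g (z.1, b).

Local Notation P := (law M (stationary k) (Some x0)).

Let int_k_notin_V (g : action R A -> \bar R) x : ~ V M x ->
  measurable_fun [set: action R A] g -> \int[k x]_b g b = g (f x).
Proof.
move=> Vx mg; rewrite (eq_measure_integral (dirac (f x))); last first.
  by move=> E mE _; exact: k_notin_V.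
by rewrite integral_dirac// diracT mul1e.
Qed.

(** Off V the kernel is the Dirac mass at f x, so the functions need only agree above V and on the
    graph of f. *)
Let law_k_V n (g h : step R X A -> \bar R) :
  measurable_fun [set: step R X A] g -> (forall z, 0 <= g z) ->
  measurable_fun [set: step R X A] h -> (forall z, 0 <= h z) ->
  (forall z, V M z.1 -> g z = h z) -> (forall x, ~ V M x -> g (x, f x) = h (x, f x)) ->
  \int[P]_w g (w n) = \int[P]_w h (w n).
Proof.
move=> mg g0 mh h0 ghV ghf; rewrite (law_stationary CII _ _ _ mg g0) (law_stationary CII _ _ _ mh h0).
apply: eq_integral => w _.
have [Vx|Vx] := pselect (V M (w n).1).
  by apply: eq_integral => b _; exact: ghV.
rewrite (int_k_notin_V Vx (measurableT_comp mg (pair1_measurable (w n).1))).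
rewrite (int_k_notin_V Vx (measurableT_comp mh (pair1_measurable (w n).1))).
exact: ghf.
Qed.

(** The initial state stays fixed in the induction: later terms are rewritten one step earlier with
    g replaced by its prediction [g1], and the flow equation splits off the initial term.
    Restricting [g1] to [VB] loses nothing, because f keeps the state off V. *)
Lemma occupation_stationary_le N (g : step R X A -> \bar R) :
  measurable_fun [set: step R X A] g -> (forall z, 0 <= g z) ->
  (forall z, ~ V M z.1 -> g z = 0) ->
  \sum_(0 <= n < N) \int[P]_w g (w n) <= \int[mu]_z g z.
Proof.
have mVB := measurable_VB CII; have mn := measurable_next CII.
elim: N g => [|N IH] g mg g0 gV; first by rewrite big_nil integral_ge0.
pose gbar x := \int[k x]_b g (x, b).
have mgbar : measurable_fun [set: state X] gbar by exact: measurable_int_kernel.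
have gbar0 x : 0 <= gbar x by apply: integral_ge0.
have gbarV x : ~ V M x -> gbar x = 0.
  by move=> Vx; rewrite /gbar integral0_eq// => b _; exact: gV.
pose g1 (z : step R X A) := gbar (Defs.next M z.1 z.2).
have mg1 : measurable_fun [set: step R X A] g1 by exact: (measurableT_comp mgbar mn).
have g10 z : 0 <= g1 z by exact: gbar0.
have mg1V := measurable_patch mVB mg1.
have g1V0 := patch_ge0 (VB M) g10.
rewrite big_nat_recl//= (mu_k mg g0) (mu_flow mgbar gbar0 gbarV) -/g1.
apply: leeD.
  by rewrite (law_stationary CII _ _ _ mg g0) (law_start CII (stationary k) (Some x0) mgbar gbar0).
apply: (@le_trans _ _ (\sum_(0 <= n < N) \int[P]_w (g1 \_ (VB M)) (w n))); last first.
  apply: (@le_trans _ _ (\int[mu]_z (g1 \_ (VB M)) z)).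
    apply: IH => // z Vz; rewrite patchE ifF//.
    by apply/negbTE/negP; rewrite inE => -[].
  by rewrite (integral_VB CII mu_VB mg1 g10) [leRHS]integral_mkcond.
apply: lee_sum => n _.
rewrite (law_stationary CII _ _ _ mg g0) (law_next CII (stationary k) (Some x0) mgbar gbar0).
rewrite (law_k_V n (g := g1) (h := g1 \_ (VB M)))//.
  by move=> z Vz; rewrite patchE ifT// inE; split.
move=> x Vx; rewrite patchE ifF; first by rewrite /g1 (gbarV _ (f_next Vx)).
by apply/negbTE/negP; rewrite inE => -[].
Qed.

Lemma total_cost_stationary j :
  total_cost M j (Some x0) (stationary k) <= \int[mu]_(z in VB M) cost M j z.1 z.2.
Proof.
have mVB := measurable_VB CII.
pose c (z : step R X A) := cost M j z.1 z.2.
have mc : measurable_fun [set: step R X A] c by exact: measurable_cost.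
have c0 z : 0 <= c z by exact: cost_ge0.
have mcV := measurable_patch mVB mc.
have cV0 := patch_ge0 (VB M) c0.
have cVE n : \int[P]_w c (w n) = \int[P]_w (c \_ (VB M)) (w n).
  apply: law_k_V => // [z Vz|x Vx]; first by rewrite patchE ifT// inE; split.
  rewrite patchE ifF; first exact: f_cost.
  by apply/negbTE/negP; rewrite inE => -[].
rewrite (total_costE CII) [leRHS]integral_mkcond.
apply: lime_le.
  by apply: is_cvg_nneseries => n _ _; apply: integral_ge0 => w _; exact: c0.
apply: nearW => N.
rewrite (eq_bigr (fun n => \int[P]_w (c \_ (VB M)) (w n))) => [|n _]; last exact: cVE.
apply: occupation_stationary_le => // z Vz; rewrite patchE ifF//.
by apply/negbTE/negP; rewrite inE => -[].
Qed.

End stationary_cost.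

(** * Costs of a strategy from its occupation measure on V x B *)

Section occupation_cost.
Context (R : realType) (X A : ptopologicalType) (J : nat).
Variable M : impulse_model R X A J.
Hypothesis CII : condition_II M.
Variables (x0 : X) (pi : strategy R X A) (mu : {measure set (step R X A) -> \bar R}).
Hypothesis mu_occupation : forall G : set (step R X A), measurable G ->
  mu G = occupation M x0 pi (G `&` VB M).
Hypothesis pi_notin_V : forall (i : nat) (h : history R X A i), ~ V M h.2 ->
  pi i h [set b | \sum_(j < J.+1) cost M j h.2 b = 0] = 1.

Local Notation P := (law M pi (Some x0)).

Let mVB : measurable (VB M) := measurable_VB CII.

Lemma integral_occupation (g : step R X A -> \bar R) :
  measurable_fun [set: step R X A] g -> (forall z, 0 <= g z) ->
  \int[mu]_(z in VB M) g z = \sum_(0 <= n <oo) \int[P]_w (g \_ (VB M)) (w n).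
Proof.
move=> mg g0.
pose Q : {measure set (step R X A) -> \bar R} :=
  mseries (fun n => mrestr (image_measure P (@measurable_step_at R X A n)) mVB) 0.
rewrite (eq_measure_integral Q); last first.
  move=> G mG _; rewrite mu_occupation//.
  have mGV : measurable (G `&` VB M) by exact: measurableI.
  have mGn n : measurable [set w : trajectory R X A | (G `&` VB M) (w n)].
    by have := @measurable_step_at R X A n; move=> /(_ measurableT _ mGV); rewrite setTI.
  have mI n : measurable_fun [set: trajectory R X A]
      (fun w : trajectory R X A => (\1_(G `&` VB M) (w n))%:E : \bar R).
    by apply/measurable_EFinP; exact: measurable_indic (mGn n).
  rewrite /occupation (integral_nneseries _ measurableT mI)//.
  apply: eq_eseriesr => n _.
  rewrite mrestrE image_measureE.
  have := integral_indic P measurableT (mGn n); rewrite setIT => <-.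
  by [].
rewrite ge0_integral_measure_series//; last exact: measurable_funTS.
apply: eq_eseriesr => n _.
have mgV := measurable_patch mVB mg; have gV0 := patch_ge0 (VB M) g0.
rewrite [LHS]integral_mkcond (ge0_integral_mrestr _ mVB mgV gV0).
rewrite -(ge0_integral_image (@measurable_step_at R X A n) P mgV gV0).
rewrite [LHS]integral_mkcond; apply: eq_integral => z _.
by rewrite !patchE; case: (z \in VB M).
Qed.

Let cost_notin_V0 j n (h : history R X A n) : ~ V M h.2 ->
  \int[pi n h]_b cost M j h.2 b = 0.
Proof.
move=> Vh; pose Z := [set b | \sum_(j < J.+1) cost M j h.2 b = 0].
have mcost i : measurable_fun [set: action R A] (fun b => cost M i h.2 b).
  exact: (measurableT_comp (measurable_cost CII i) (pair1_measurable h.2)).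
have mZ : measurable Z.
  rewrite /Z (_ : mkset _ = setT `&` (fun b => \sum_(j < J.+1) cost M j h.2 b) @^-1` [set 0]).
    exact: emeasurable_sum.
  by rewrite setTI.
have Z0 : pi n h (~` Z) = 0.
  have piT : pi n h setT = 1 by exact: prob_kernel.
  rewrite -setTD measureD//; last by rewrite [X in X < _]piT ltry.
  by rewrite setTI [X in _ - X](pi_notin_V Vh) [X in X - _]piT subee.
rewrite (ge0_negligible_integral (measurableC mZ) measurableT (mcost j) _ Z0); last first.
  by move=> b _; exact: cost_ge0.
rewrite setTD setCK integral0_eq// => b Zb; apply/eqP; rewrite eq_le cost_ge0 andbT.
rewrite -[leRHS]Zb (bigD1 j)//= leeDl// sume_ge0// => i _; exact: cost_ge0.
Qed.

(** Actions chosen off V are almost surely free by [pi_notin_V], so restricting the occupation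
    measure to V x B discards no cost. *)
Lemma total_cost_occupation j :
  total_cost M j (Some x0) pi = \int[mu]_(z in VB M) cost M j z.1 z.2.
Proof.
pose c (z : step R X A) := cost M j z.1 z.2.
have mc : measurable_fun [set: step R X A] c by exact: measurable_cost.
have c0 z : 0 <= c z by exact: cost_ge0.
rewrite (integral_occupation (g := c))// (total_costE CII); apply: eq_eseriesr => n _.
rewrite -/(c _) (law_action_state CII _ _ _ mc c0).
rewrite (law_action_state CII _ _ _ (measurable_patch mVB mc) (patch_ge0 (VB M) c0)).
apply: eq_integral => w _.
have [Vw|Vw] := pselect (V M (w n).1).
  by apply: eq_integral => b _; rewrite patchE ifT// inE; split.
rewrite (cost_notin_V0 j (h := hist n w))// integral0_eq// => b _.
rewrite patchE ifF//; apply/negbTE/negP; rewrite inE => -[Vw' _].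
exact: Vw.
Qed.

End occupation_cost.

(** * Duality at x_0 and the two assertions *)

Theorem theorem4p1 (R : realType) (X A : ptopologicalType) (J : nat)
    (M : impulse_model R X A J) (x0 : X) (d : 'I_J -> R)
    (d_ge0 : forall j, (0 <= d j)%R)
    (CI : condition_I M x0 d) (CII : condition_II M)
    (fstar : state X -> action R A)
    (mfstar : measurable_fun [set: state X] fstar)
    (fstar_opt : forall x : state X,
      aggregate_cost M x (deterministic mfstar) = optimal_aggregate_cost M x)
    (fstar_stay : forall x : state X, ~ V M x ->
      transition M x (fstar x) (V M) = 0) :
  (exists (mu : {measure set (step R X A) -> \bar R})
          (k : R.-pker (state X) ~> (action R A)),
    [/\ lp2_optimal M x0 d mu,
      optimal M x0 d (stationary k),
      forall G : set (step R X A), measurable G -> G `<=` VB M ->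
        mu G = \int[pushforward mu fst]_(x in V M) k x (xsection G x) &
      forall x : state X, ~ V M x ->
        forall E : set (action R A), measurable E ->
        k x E = \d_(fstar x) E])
  /\
  (lp2_value M x0 d = optimal_value M x0 d /\
   forall (pi : strategy R X A) (mu : {measure set (step R X A) -> \bar R}),
     (forall G : set (step R X A), measurable G ->
       mu G = occupation M x0 pi (G `&` VB M)) ->
     lp2_optimal M x0 d mu ->
     (forall (i : nat) (h : history R X A i), ~ V M h.2 ->
       pi i h [set b | \sum_(j < J.+1) cost M j h.2 b = 0] = 1) ->
     optimal M x0 d pi).
Proof.
have value0 lam : (forall j, (0 <= lam j)%R) -> forall x, ~ V M x ->
    value M (weighted_cost M lam) x = 0.
  by move=> lam0 x; exact: (value_notin_V CII fstar_opt fstar_stay).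
(* The values of both problems are merged: all elements of S obey the same multiplier bound, so one
   mixture serves both without a prior comparison of their infima. *)
pose S := [set lp2_objective M mu | mu in lp2_feasible M x0 d] `|`
  [set total_cost M ord0 (Some x0) pi | pi in feasible M x0 d].
have cost_pi_ge0 j pi : 0 <= total_cost M j (Some x0) pi.
  by apply: integral_ge0 => w _; apply: nneseries_ge0 => n _ _; exact: cost_ge0.
have S_ge0 : 0 <= ereal_inf S.
  apply: le_ereal_inf_tmp => _ [[mu _ <-]|[pi _ <-]]; last exact: cost_pi_ge0.
  by apply: integral_ge0 => z _; exact: cost_ge0.
have S_fin : ereal_inf S \is a fin_num.
  rewrite ge0_fin_numE//; have [pi fpi] := CI; apply: le_lt_trans.
  by apply: ereal_inf_lbound; right; exists pi.
pose r := fine (ereal_inf S).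
have rE : r%:E = ereal_inf S by rewrite fineK.
pose v (j : 'I_J.+1) : R := if unlift ord0 j is Some i then d i else r.
have v0 : v ord0 = r by rewrite /v unlift_none.
have vS i : v (lift ord0 i) = d i by rewrite /v liftK.
have bound lam s : (forall j, (0 <= lam j)%R) -> S s ->
    value M (weighted_cost M lam) (Some x0) <=
    (lam ord0)%:E * s + (\sum_(i < J) lam (lift ord0 i) * d i)%:E.
  move=> lam0 [[nu [nuV _ nu_flow nu_d] <-]|[pi fpi <-]].
    apply: le_trans (value_le_lp_costs CII value0 nuV nu_flow lam0) _.
    rewrite big_ord_recl -sumEFin; apply: leeD => //; apply: lee_sum => i _.
    by rewrite EFinM lee_wpmul2l ?lee_fin//; exact: nu_d.
  apply: le_trans (value_le_total_cost CII lam0 (Some x0) pi) _.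
  rewrite big_ord_recl -sumEFin; apply: leeD => //; apply: lee_sum => i _.
  by rewrite EFinM lee_wpmul2l ?lee_fin//; exact: fpi.
have dual (lam : 'I_J.+1 -> R) (e : R) : (forall j, (0 < lam j)%R) -> (0 < e)%R ->
    exists b, \sum_j (lam j)%:E * plan_cost M (cost M j) (Some x0) b <=
      (\sum_j lam j * v j + e)%:E.
  move=> lam0 e0; have lam0' j : (0 <= lam j)%R by exact: ltW.
  (* Only the objective coordinate is approximated, so the tolerance e is divided by its positive
     multiplier. *)
  have re : ereal_inf S < (r + e / lam ord0)%:E.
    by rewrite -rE lte_fin ltrDl divr_gt0.
  have [s Ss sr] := ereal_inf_lt re.
  have : value M (weighted_cost M lam) (Some x0) < (\sum_j lam j * v j + e)%:E.
    apply: le_lt_trans (bound lam s lam0' Ss) _.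
    rewrite big_ord_recl v0.
    rewrite [X in _ < (_ + X + _)%:E](eq_bigr (fun i => lam (lift ord0 i) * d i)%R); last first.
      by move=> i _; rewrite vS.
    rewrite -addrA [(_ + e)%R]addrC addrA EFinD lte_leD//.
    apply: lt_le_trans (_ : (lam ord0)%:E * s < (lam ord0)%:E * (r + e / lam ord0)%:E) _.
      by rewrite lte_pmul2l// lte_fin.
    by rewrite -EFinM mulrDr mulrCA divff ?mulr1// gt_eqF.
  move=> /ereal_inf_lt[_ [b _ <-] bv]; exists b.
  by rewrite -plan_weighted_cost ?ltW// => j; exact: ltW.
have pc0 j b : 0 <= plan_cost M (cost M j) (Some x0) b.
  by apply: plan_cost_ge0 => *; exact: cost_ge0.
have pcl j : lower_semicontinuous (plan_cost M (cost M j) (Some x0) :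
    prod_topology (fun _ : nat =>
      (one_point_compactification (set_type (half_line R)) * A)%type) -> \bar R).
  apply: (plan_cost_lsc CII) => //; [by move=> *; exact: cost_ge0|].
  by move=> z; exact: cost_lsc.
have [p' [b' [p'0 p'1 p'v]]] := mixture_of_duality (compact_plan CII) pc0 pcl dual.
(* Indices become natural numbers; [inord] has a default value from J + 2 on, but the sums stop
   before it. *)
pose p i := p' (inord i); pose b i := b' (inord i).
have p0 i : (0 <= p i)%R by exact: p'0.
have p1 : (\sum_(i < J.+2) p i = 1)%R.
  by rewrite -p'1; apply: eq_bigr => i _; rewrite /p inord_val.
have pv j : \sum_(i < J.+2) (p i)%:E * plan_cost M (cost M j) (Some x0) (b i) <= (v j)%:E.
  by apply: le_trans (p'v j); apply: lee_sum => i _; rewrite /p /b inord_val.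
have fin i : (i < J.+2)%N -> (0 < p i)%R ->
    plan_cost M (weighted_cost M (fun=> 1%R)) (Some x0) (b i) < +oo.
  move=> iJ pi0; rewrite plan_weighted_cost//; apply: lte_sum_pinfty => j _.
  rewrite mul1e; have : (p i)%:E * plan_cost M (cost M j) (Some x0) (b i) < +oo.
    apply: le_lt_trans (ltry (v j)); apply: le_trans (pv j).
    rewrite (bigD1 (Ordinal iJ))//= leeDl// sume_ge0// => l _.
    by rewrite mule_ge0 ?lee_fin.
  rewrite !ltey; apply: contra => /eqP ->; rewrite gt0_muley ?lte_fin//.
pose mu := mixture_occupation M x0 J.+2 b p0.
have mset1 x : measurable ([set x] : set (state X)) by exact: (measurable_state1 M).
have mVB := measurable_VB CII; have mn := measurable_next CII.
have muV : mu (~` VB M) = 0 by exact: mixture_VB.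
have mu_fin x : mu ([set x] `*` setT) < +oo by exact: mixture_fiber.
have mu_at : mu (~` (range (visited M x0 b) `*` setT)) = 0 by exact: mixture_visited.
have mu_flow (g : state X -> \bar R) : measurable_fun [set: state X] g ->
    (forall x, 0 <= g x) -> (forall x, ~ V M x -> g x = 0) ->
    \int[mu]_z g z.1 = g (Some x0) + \int[mu]_z g (Defs.next M z.1 z.2).
  exact: mixture_flow.
have mu_cost j : \int[mu]_(z in VB M) cost M j z.1 z.2 <= (v j)%:E.
  have mc := measurable_cost CII j.
  have c0 (z : step R X A) : 0 <= cost M j z.1 z.2 by exact: cost_ge0.
  rewrite -(integral_VB CII muV mc c0); apply: le_trans (pv j).
  by apply: mixture_cost => // x a; exact: cost_ge0.
have mu_feasible : lp2_feasible M x0 d mu.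
  split => //.
  - exact: (atomic_sigma_finite mset1 mu_at).
  - move=> G mG GV.
    have mI : measurable_fun [set: state X] (fun x => (\1_G x)%:E : \bar R).
      by apply/measurable_EFinP; exact: measurable_indic.
    have I0 (x : state X) : 0 <= (\1_G x)%:E :> \bar R by rewrite lee_fin.
    have IV (x : state X) : ~ V M x -> (\1_G x)%:E = 0 :> \bar R.
      by move=> Vx; rewrite indicE memNset// => /GV.
    have := mu_flow _ mI I0 IV.
    rewrite (integral_VB CII muV (measurableT_comp mI mn) (fun=> I0 _)) => <-.
    have mGT : measurable (G `*` setT : set (step R X A)) by exact: measurableX.
    rewrite -[LHS](_ : \int[mu]_z (\1_(G `*` setT) z)%:E = _); last first.
      by rewrite integral_indic// setIT.
    apply: eq_integral => z _; rewrite !indicE; congr (nat_of_bool _)%:R%:E.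
    by apply/idP/idP; rewrite !inE; [case|move=> Gz; split].
  - by move=> j; rewrite -vS; exact: mu_cost.
have lower nu : lp2_feasible M x0 d nu -> r%:E <= lp2_objective M nu.
  by move=> fnu; rewrite rE; apply: ereal_inf_lbound; left; exists nu.
have lower_pi pi : feasible M x0 d pi -> r%:E <= total_cost M ord0 (Some x0) pi.
  by move=> fpi; rewrite rE; apply: ereal_inf_lbound; right; exists pi.
have mu_obj : lp2_objective M mu <= r%:E by rewrite -v0; exact: mu_cost.
have mu_opt : lp2_optimal M x0 d mu.
  by split; [exact: mu_feasible|move=> nu fnu; exact: le_trans mu_obj (lower _ fnu)].
(* Used twice: for the stationary strategy with mu, and in (b) for the given strategy with its
   occupation measure. *)
have optimalP pi nu : lp2_feasible M x0 d nu -> lp2_objective M nu <= r%:E ->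
    (forall j, total_cost M j (Some x0) pi <= \int[nu]_(z in VB M) cost M j z.1 z.2) ->
    optimal M x0 d pi /\ total_cost M ord0 (Some x0) pi <= r%:E.
  move=> [_ _ _ nu_d] nu_r le_nu; have pi_r := le_trans (le_nu ord0) nu_r.
  split; last exact: pi_r.
  split => [j|pi' fpi']; first exact: le_trans (le_nu _) (nu_d j).
  exact: le_trans pi_r (lower_pi _ fpi').
pose k : R.-pker (state X) ~> (action R A) := conditional mset1 mu_at mfstar.
have k_off x : ~ V M x -> forall E, measurable E -> k x E = \d_(fstar x) E.
  (* As mu vanishes off [VB], the fiber above x is null and the kernel takes its default there. *)
  move=> Vx E mE; apply: conditional_null.
  apply: (subset_measure0 _ _ _ muV); [exact: measurableX|exact: measurableC|].
  by move=> z [/= zx _] [/=]; rewrite zx.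
have mu_k (g : step R X A -> \bar R) : measurable_fun [set: step R X A] g ->
    (forall z, 0 <= g z) -> \int[mu]_z g z = \int[mu]_z \int[k z.1]_b g (z.1, b).
  exact: disintegration.
have [k_opt k_r] := optimalP (stationary k) mu mu_feasible mu_obj
  (total_cost_stationary CII (next_notin_V fstar_stay)
    (cost_notin_V CII fstar_opt) k_off muV mu_flow mu_k).
split.
  exists mu, k; split; [exact: mu_opt|exact: k_opt| |exact: k_off].
  move=> G mG GV.
  pose h x := \int[k x]_b (\1_G (x, b))%:E.
  have mI : measurable_fun [set: step R X A] (fun z => (\1_G z)%:E : \bar R).
    by apply/measurable_EFinP; exact: measurable_indic.
  have I0 (z : step R X A) : 0 <= (\1_G z)%:E :> \bar R by rewrite lee_fin.
  have hE x : h x = k x (xsection G x).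
    rewrite -[RHS](_ : \int[k x]_b (\1_(xsection G x) b)%:E = _); last first.
      by rewrite integral_indic ?setIT//; exact: measurable_xsection.
    by apply: eq_integral => a _; rewrite !indicE mem_xsection.
  rewrite -[LHS](_ : \int[mu]_z (\1_G z)%:E = _); last by rewrite integral_indic// setIT.
  have mfst : measurable_fun [set: step R X A] (fst : step R X A -> state X).
    exact: measurable_fst.
  have mh : measurable_fun [set: state X] h by exact: (measurable_int_kernel k mI I0).
  have h0 x : 0 <= h x by apply: integral_ge0.
  rewrite (mu_k _ mI I0) -[LHS]/(\int[mu]_z h z.1) -(ge0_integral_image mfst mu mh h0).
  have hV x : ~ V M x -> h x = 0.
    move=> Vx; rewrite /h integral0_eq// => a _; rewrite indicE memNset// => /GV[Vx' _].
    exact: Vx.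
  rewrite (integral_setT_support _ hV).
  by apply: eq_integral => x _; exact: hE.
split.
  apply/eqP; rewrite eq_le; apply/andP; split.
    apply: (@le_trans _ _ r%:E).
      apply: le_trans mu_obj; apply: ereal_inf_lbound; by exists mu.
    by apply: le_ereal_inf_tmp => _ [pi fpi <-]; exact: lower_pi.
  apply: (@le_trans _ _ r%:E).
    by apply: le_trans k_r; apply: ereal_inf_lbound; exists (stationary k) => //; case: k_opt.
  by apply: le_ereal_inf_tmp => _ [nu fnu <-]; exact: lower.
move=> pi nu nu_occ [nu_f nu_min] pi_off.
apply: (optimalP pi nu nu_f (le_trans (nu_min _ mu_feasible) mu_obj) _).1 => j.
by rewrite (total_cost_occupation CII nu_occ pi_off).
Qed.
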